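(* Let $$\mathcal{B} = \left\{ \begin{bmatrix} f & 0 \\ h & \overline{g} \end{bmatrix} : f, g \in A(\mathbb{D}),\ h \in C(\mathbb{T}) \right\} \subset M_2(C(\mathbb{T})).$$ Then $\mathcal{B}$ is residually finite dimensional (RFD), but its maximal $C^*$-algebra $C^*_{\max}(\mathcal{B})$ is not RFD.
   Context: $\mathbb{D}$ is the open unit disc in $\mathbb{C}$, $\mathbb{T} = \partial\mathbb{D}$, and $A(\mathbb{D}) = \{ f \in C(\overline{\mathbb{D}}) : f|_{\mathbb{D}} \text{ is holomorphic} \}$ is the disc algebra, regarded as a subalgebra of $C(\mathbb{T})$ by restriction to $\mathbb{T}$. An operator algebra is a norm closed (not necessarily self-adjoint) subalgebra $\mathcal{A} \subset B(\mathcal{K})$ for some Hilbert space $\mathcal{K}$ (subalgebras of $C^*$-algebras are regarded as such via a faithful $*$-representation, taken to be unital when the $C^*$-algebra is unital); it is unital if it contains the identity operator. A representation of $\mathcal{A}$ is a (not necessarily unital) completely contractive homomorphism $\pi: \mathcal{A} \to B(\mathcal{H})$ for some Hilbert space $\mathcal{H}$; $\pi^{(n)}$ denotes entrywise application of $\pi$ to $n\times n$ matrices. $\mathcal{A}$ is RFD if for every $n \in \mathbb{N}$ and every $a \in M_n(\mathcal{A})$, $\|a\| = \sup \|\pi^{(n)}(a)\|$, where the supremum is over all representations $\pi: \mathcal{A} \to B(\mathcal{H})$ with $\dim \mathcal{H} < \infty$. (For $C^*$-algebras this agrees with the usual $C^*$-algebraic notion.) For a unital operator algebra $\mathcal{A}$,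 the maximal $C^*$-algebra $C^*_{\max}(\mathcal{A})$ is the $C^*$-algebra characterized by the following universal property: there exists a unital completely isometric homomorphism $\iota: \mathcal{A} \to C^*_{\max}(\mathcal{A})$ such that $C^*_{\max}(\mathcal{A})$ is generated by $\iota(\mathcal{A})$ as a $C^*$-algebra, and for every representation $\pi: \mathcal{A} \to B(\mathcal{H})$ there exists a $*$-homomorphism $\sigma: C^*_{\max}(\mathcal{A}) \to B(\mathcal{H})$ with $\sigma \circ \iota = \pi$. *)

(* Defs.v *)
From HB Require Import structures.
From mathcomp Require Import all_boot all_order all_algebra sesquilinear complex.
From mathcomp Require Import all_classical all_reals all_analysis.
Set Implicit Arguments.
Unset Strict Implicit.
Unset Printing Implicit Defensive.
Import Order.TTheory GRing.Theory Num.Theory.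
Import numFieldNormedType.Exports.
Local Open Scope classical_set_scope.
Local Open Scope ring_scope.

(* R[i] has no topology of its own in the libraries; as a numClosedFieldType it
   receives the one given by its norm. *)
Definition C (R : realType) : numClosedFieldType := R[i].

(* The norm of a normed module over C R is C R-valued (with real values), so the
   real norm of x is complex.Re `|x|. *)
Record hilbertType (R : realType) := HilbertType {
  hilbert_sort :> completeNormedModType (C R);
  hdot : {dot hilbert_sort for Num.conj};
  hdot_norm : forall x : hilbert_sort, hdot x x = `|x| ^+ 2
}.

Arguments hdot {R h}.

Definition finite_dimensional (R : realType) (H : hilbertType R) : Prop :=
  exists (n : nat) (e : 'I_n -> H),
    forall x : H, exists c : 'I_n -> C R, x = \sum_(i < n) c i *: e i.

(* B(H) is a set of functions H -> H: its sums and scalar multiples are the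
   pointwise ones of the function space and its product is \o. *)
Definition bounded_operator (R : realType) (H : hilbertType R) : set (H -> H) :=
  [set T : H -> H | linear T /\ continuous T].

Definition is_adjoint (R : realType) (H : hilbertType R) (T S : H -> H) : Prop :=
  forall x y : H, hdot (T x) y = hdot x (S y).

Definition hnorm (R : realType) (H : hilbertType R) (n : nat) (x : 'I_n -> H) : R :=
  Num.sqrt (\sum_(i < n) complex.Re `|x i| ^+ 2).

(* The norm of M_n(B(H)), an n x n matrix of operators acting on H^n. *)
Definition opnorm (R : realType) (H : hilbertType R) (n : nat)
    (T : 'M[H -> H]_n) : R :=
  sup [set hnorm (fun i : 'I_n => \sum_(j < n) T i j (x j))
      | x in [set x : 'I_n -> H | hnorm x <= 1]].

Definition norm_closed (R : realType) (H : hilbertType R) (A : set (H -> H)) : Prop :=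
  forall T : H -> H, bounded_operator T ->
    (forall e : R, 0 < e ->
       exists2 S : H -> H, A S & opnorm (const_mx (T - S) : 'M[H -> H]_1) < e) ->
    A T.

Definition operator_algebra (R : realType) (H : hilbertType R)
    (A : set (H -> H)) : Prop :=
  [/\ A `<=` @bounded_operator R H,
      [/\ A 0,
          forall S T : H -> H, A S -> A T -> A (S + T),
          forall (c : C R) (T : H -> H), A T -> A (c *: T) &
          forall S T : H -> H, A S -> A T -> A (S \o T)] &
      norm_closed A].

Definition cstar_algebra (R : realType) (H : hilbertType R)
    (A : set (H -> H)) : Prop :=
  operator_algebra A /\
  forall T : H -> H, A T -> exists2 S : H -> H, A S & is_adjoint T S.

Section Representations.
Variables (R : realType) (K H : hilbertType R).
Variables (A : set (K -> K)) (phi : (K -> K) -> (H -> H)).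

(* Maps defined on A are total functions whose values outside A are irrelevant. *)
Definition algebra_hom : Prop :=
  [/\ forall T : K -> K, A T -> bounded_operator (phi T),
      forall S T : K -> K, A S -> A T -> phi (S + T) = phi S + phi T,
      forall (c : C R) (T : K -> K), A T -> phi (c *: T) = c *: phi T &
      forall S T : K -> K, A S -> A T -> phi (S \o T) = phi S \o phi T].

Definition completely_contractive : Prop :=
  forall (n : nat) (a : 'M[K -> K]_n),
    (forall i j, A (a i j)) -> opnorm (map_mx phi a) <= opnorm a.

Definition completely_isometric : Prop :=
  forall (n : nat) (a : 'M[K -> K]_n),
    (forall i j, A (a i j)) -> opnorm (map_mx phi a) = opnorm a.

Definition representation : Prop := algebra_hom /\ completely_contractive.

(* Stated through the relation "S is the adjoint of T", adjoints being unique. *)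
Definition star_hom : Prop :=
  algebra_hom /\
  forall S T : K -> K, A S -> A T -> is_adjoint S T -> is_adjoint (phi S) (phi T).

End Representations.

Definition RFD (R : realType) (K : hilbertType R) (A : set (K -> K)) : Prop :=
  forall (n : nat) (a : 'M[K -> K]_n), (forall i j, A (a i j)) ->
    opnorm a =
    sup [set r : R | exists (H : hilbertType R) (pi : (K -> K) -> (H -> H)),
           [/\ finite_dimensional H, representation A pi &
               r = opnorm (map_mx pi a)]].

Definition cstar_generated_by (R : realType) (L : hilbertType R)
    (D S : set (L -> L)) : Prop :=
  [/\ cstar_algebra D, S `<=` D &
      forall D' : set (L -> L), cstar_algebra D' -> S `<=` D' -> D `<=` D'].

(* The universal property of the maximal C*-algebra of a unital operator algebra
   A. The C*-algebra D is represented faithfully and unitally on L. *)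
Definition is_Cstar_max (R : realType) (K : hilbertType R) (A : set (K -> K))
    (L : hilbertType R) (D : set (L -> L)) : Prop :=
  exists iota : (K -> K) -> (L -> L),
    [/\ algebra_hom A iota,
        iota idfun = idfun,
        completely_isometric A iota,
        cstar_generated_by D (iota @` A) &
        forall (H : hilbertType R) (pi : (K -> K) -> (H -> H)),
          representation A pi ->
          exists sigma : (L -> L) -> (H -> H),
            star_hom D sigma /\ forall T : K -> K, A T -> sigma (iota T) = pi T].

Definition circle (R : realType) : set (C R) := [set z | `|z| = 1].
Arguments circle : clear implicits.

(* M_2(C(T)); its algebraic operations are pointwise. *)
Definition M2CT (R : realType) : set (circle R -> 'M[C R]_2) :=
  [set F : circle R -> 'M[C R]_2 | continuous F].
Arguments M2CT : clear implicits.

(* Through such a rho a subset S of M_2(C(T)) is regarded as the set rho @` S of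
   operators on K. *)
Definition faithful_unital_star_rep (R : realType) (K : hilbertType R)
    (rho : (circle R -> 'M[C R]_2) -> (K -> K)) : Prop :=
  [/\ forall F, M2CT R F -> bounded_operator (rho F),
      [/\ forall F G, M2CT R F -> M2CT R G -> rho (F + G) = rho F + rho G,
          forall (c : C R) F, M2CT R F -> rho (c *: F) = c *: rho F,
          forall F G, M2CT R F -> M2CT R G -> rho (F * G) = rho F \o rho G &
          rho 1 = idfun],
      forall F, M2CT R F ->
        is_adjoint (rho F) (rho (fun t => (map_mx Num.conj (F t))^T)) &
      forall F G, M2CT R F -> M2CT R G -> rho F = rho G -> F = G].

(* The restrictions to the circle of the members of A(D); the values of F off
   the closed disc are irrelevant. *)
Definition disc_algebra (R : realType) : set (circle R -> C R) :=
  [set f : circle R -> C R | exists F : C R -> C R,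
    [/\ {within [set z : C R | `|z| <= 1], continuous F},
        forall z : C R, `|z| < 1 -> derivable F z 1 &
        forall t : circle R, f t = F (val t)]].

Definition algB (R : realType) : set (circle R -> 'M[C R]_2) :=
  [set F : circle R -> 'M[C R]_2 | exists f g h : circle R -> C R,
    [/\ disc_algebra f, disc_algebra g, continuous h &
        forall t : circle R,
          [/\ F t 0 0 = f t, F t 0 1 = 0,
              F t 1 0 = h t & F t 1 1 = Num.conj (g t)]]].
Arguments algB : clear implicits.

(* Main.v *)
Require Import Defs.
From HB Require Import structures.
From mathcomp Require Import all_boot all_order all_algebra sesquilinear complex.
From mathcomp Require Import all_classical all_reals all_analysis.
From mathcomp Require Import ring lra zify.
Set Implicit Arguments.
Unset Strict Implicit.
Unset Printing Implicit Defensive.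
Import Order.TTheory GRing.Theory Num.Theory.
Import numFieldNormedType.Exports.
Local Open Scope classical_set_scope.
Local Open Scope ring_scope.

(** Write B for the algebra, z for the coordinate on the circle, E_kl for the
    matrix units of the 2 by 2 matrices, and T' for the adjoint of T.

    B is residually finite dimensional because the evaluations at the points of
    the circle, which are representations on C^2, already give the norm: for a
    matrix A over M_2(C(T)) and a faithful rho, the norm of rho(A) is the
    supremum of the norms of the matrices A(t).  The bound of rho(A) by the
    supremum ([star_rep_le]) holds for every unital star representation: the
    C-star identity reduces it to the powers (A' A)^(2^k), and for these a bound
    with an unspecified constant, coming from the entries, is enough after
    extraction of 2^k-th roots.  For the reverse bound ([star_rep_ge]), if A(t)
    stretches a vector v by more than the norm of rho(A), then a nonnegative
    bump function around t turns v into a column of functions that is stretched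
    too much everywhere on its support; faithfulness turns this into a nonzero
    positive operator that is also nonpositive.

    The maximal C-star-algebra D is not residually finite dimensional because it
    contains a nonzero element that all its finite-dimensional representations
    kill.  Let T and X be the images in D of z E_00 and E_10, and T' the adjoint
    of T.  For every n, E_10 = (z^-n E_10) (z E_00)^n, and z^-n E_10 is a
    contraction of B, so X = Y_n T^n for contractions Y_n.  The element is
    w = X (1 - T T').

    - In a finite-dimensional representation w vanishes ([findim_defect]).  The
      representation is completely contractive, hence preserves adjoints
      ([contractive_star]).  For a contraction T, the numbers |T^n (1 - T T') x|^2
      are dominated by |x|^2 times the differences of a nonincreasing sequence of
      traces, so they are summable; but each is at least |X (1 - T T') x|^2.
    - In D itself w does not vanish.  Let M_2(C(T)) act on L^2 + L^2 by
      multiplication.  Since the upper left entries of members of B are analytic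
      and the upper right ones are 0, the subspace H^2 + L^2 is invariant under B,
      and restricting to it gives a representation of B ([Phi_rep]).  By the
      universal property it extends to D.  There T is the unilateral shift, whose
      adjoint kills the constant function 1 in H^2, while X maps this function to
      the constant function 1 in L^2.

    The second point is carried out on the Fourier side, in the space of square
    summable families indexed by the two components and the integers: the
    multiplication by h is the limit of the Fejer means of h with the characters
    replaced by powers of the bilateral shift, and Korovkin's argument gives the
    convergence.  That H^2 + L^2 is invariant means that the Fourier coefficients of
    negative index of a function of the disc algebra vanish ([disc_fourier]), which
    is Cauchy's theorem; it is obtained from Goursat's bisection argument, with
    trapezoidal sums along dyadic grids in polar coordinates in the place of
    integrals. *)

(** * Real-valued norms and inner products *)

Section Norm.
Variable R : realType.

(** The norm of a normed module over [C R] takes values in [C R]; [nrm] is the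
    same norm seen in [R], where inequalities can be treated by [lra]. *)
Definition nrm (V : normedModType (C R)) (x : V) : R := complex.Re `|x|.

Notation rc := (real_complex R).

Lemma nrmE (V : normedModType (C R)) (x : V) : `|x| = rc (nrm x).
Proof.
rewrite /nrm RRe_real //; exact: (@normr_real (C R)).
Qed.

Lemma rc_le (a b : R) : ((rc a : C R) <= rc b) = (a <= b).
Proof. exact: lecR. Qed.
Lemma rc_lt (a b : R) : ((rc a : C R) < rc b) = (a < b).
Proof. exact: ltcR. Qed.
Lemma rc_inj (a b : R) : rc a = rc b -> a = b.
Proof. by case. Qed.

Lemma Re_rc (a : R) : complex.Re (rc a) = a. Proof. by []. Qed.

Variable V : normedModType (C R).
Implicit Types x y : V.

Lemma nrm_ge0 x : 0 <= nrm x.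
Proof. by rewrite -rc_le -nrmE; exact: normr_ge0. Qed.

Lemma nrm0 : nrm (0 : V) = 0. Proof. by apply: rc_inj; rewrite -nrmE normr0. Qed.

Lemma nrm_eq0 x : nrm x = 0 -> x = 0.
Proof. by move=> h; apply/normr0_eq0; rewrite nrmE h. Qed.

Lemma nrmD x y : nrm (x + y) <= nrm x + nrm y.
Proof.
have := ler_normD x y; by rewrite !nrmE -(rmorphD (real_complex R)) rc_le.
Qed.

Lemma nrmN x : nrm (- x) = nrm x.
Proof. by apply: rc_inj; rewrite -!nrmE normrN. Qed.

Lemma nrmB x y : nrm (x - y) <= nrm x + nrm y.
Proof. by rewrite -(nrmN y) nrmD. Qed.

Lemma nrm_distC x y : nrm (x - y) = nrm (y - x).
Proof. by rewrite -nrmN opprB. Qed.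

Lemma nrmZ (c : C R) x : nrm (c *: x) = nrm (c : C R) * nrm x.
Proof.
apply: rc_inj; have := normrZ c x; rewrite !nrmE => ->.
by rewrite [in RHS](rmorphM (real_complex R)); congr (_ * _); rewrite -nrmE.
Qed.

Lemma nrm_sum (I : Type) (s : seq I) (P : pred I) (F : I -> V) :
  nrm (\sum_(i <- s | P i) F i) <= \sum_(i <- s | P i) nrm (F i).
Proof.
elim/big_rec2: _ => [|i y x _ h]; first by rewrite nrm0.
by apply: le_trans (nrmD _ _) _; rewrite lerD2l.
Qed.

Lemma nrm_cvgP (T : Type) (F : set_system T) (FF : Filter F) (f : T -> V) x :
  f @ F --> x <-> forall e : R, 0 < e -> \forall t \near F, nrm (x - f t) < e.
Proof.
split=> [/cvgrPdist_lt h e e0|h].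
  have := h (rc e); rewrite -(rmorph0 (real_complex R)) rc_lt => /(_ e0).
  by apply: filterS => t; rewrite nrmE rc_lt.
apply/cvgrPdist_lt => e e0.
have er : e = rc (complex.Re e) by rewrite RRe_real // gtr0_real.
rewrite er; move: e0; rewrite er -{1}(rmorph0 (real_complex R)) rc_lt => /h.
by apply: filterS => t; rewrite nrmE rc_lt.
Qed.

Lemma nrm_contP (T : topologicalType) (f : T -> V) (t : T) :
  {for t, continuous f} <-> forall e : R, 0 < e -> \forall s \near t, nrm (f t - f s) < e.
Proof. exact: (@nrm_cvgP T (nbhs t) (nbhs_filter t) f (f t)). Qed.

Lemma nrm_cvgnP (u : nat -> V) x :
  u @ \oo --> x <-> forall e : R, 0 < e -> exists N, forall n, (N <= n)%N -> nrm (x - u n) < e.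
Proof.
rewrite nrm_cvgP; split=> h e /h.
  by case=> N _ hN; exists N => n; exact: hN.
by case=> N hN; exists N => // n; exact: hN.
Qed.

End Norm.

Section Scalar.
Variable R : realType.
Notation rc := (real_complex R).
Implicit Types a b : C R.

Lemma nrmM a b : nrm (a * b) = nrm a * nrm b.
Proof. exact: (@nrmZ R (C R) a b). Qed.

Lemma nrm1 : nrm (1 : C R) = 1.
Proof. by apply: rc_inj; rewrite -nrmE normr1. Qed.

Lemma nrmX a n : nrm (a ^+ n) = nrm a ^+ n.
Proof. by elim: n => [|n ih]; rewrite ?expr0 ?nrm1 // !exprS nrmM ih. Qed.

Lemma nrm_conj a : nrm (Num.conj a) = nrm a.
Proof. by apply: rc_inj; rewrite -!nrmE norm_conjC. Qed.

Lemma nrm_rc (x : R) : 0 <= x -> nrm (rc x : C R) = x.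
Proof.
move=> x0; apply: rc_inj; rewrite -nrmE ger0_norm //.
by rewrite -(rmorph0 (real_complex R)) rc_le.
Qed.

Lemma nrm_real (x : R) : nrm (rc x : C R) = `|x|.
Proof. by apply: rc_inj; rewrite -nrmE normc_def /= expr0n addr0 sqrtr_sqr. Qed.

Lemma nrm_nat n : nrm (n%:R : C R) = n%:R.
Proof. by rewrite -(rmorph_nat (real_complex R)) nrm_real ger0_norm. Qed.

Lemma nrm_imag : nrm (Complex 0 1 : C R) = 1.
Proof. by apply: rc_inj; rewrite -nrmE normc_def /= expr0n add0r expr1n sqrtr1. Qed.

Lemma nrm_sq a : rc (nrm a ^+ 2) = a * Num.conj a.
Proof. by rewrite -normCK nrmE; exact: (rmorphXn (real_complex R)). Qed.

Lemma nrmV a : nrm a^-1 = (nrm a)^-1.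
Proof.
apply: rc_inj; have := normfV a; rewrite !nrmE => ->.
by rewrite -(fmorphV (real_complex R)).
Qed.

End Scalar.

Section Hilbert.
Variable R : realType.
Notation rc := (real_complex R).
Variable H : hilbertType R.
Implicit Types x y z : H.

Lemma hdotDl x y z : hdot (x + y) z = hdot x z + hdot y z.
Proof. by rewrite linearDl. Qed.
Lemma hdotZl (c : C R) x z : hdot (c *: x) z = c * hdot x z.
Proof. by rewrite linearZl_LR. Qed.
Lemma hdotDr x y z : hdot x (y + z) = hdot x y + hdot x z.
Proof. by rewrite linearD. Qed.
Lemma hdotZr (c : C R) x z : hdot x (c *: z) = Num.conj c * hdot x z.
Proof. by rewrite linearZ. Qed.
Lemma hdotC x y : hdot x y = Num.conj (hdot y x).
Proof. by have := @hermitian_subproof _ _ _ _ (@hdot R H) x y; rewrite expr0 mul1r. Qed.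
Lemma hdotNl x z : hdot (- x) z = - hdot x z.
Proof. by rewrite -scaleN1r hdotZl mulN1r. Qed.
Lemma hdotNr x z : hdot x (- z) = - hdot x z.
Proof. by rewrite linearN. Qed.
Lemma hdotBl x y z : hdot (x - y) z = hdot x z - hdot y z.
Proof. by rewrite hdotDl hdotNl. Qed.
Lemma hdotBr x y z : hdot x (y - z) = hdot x y - hdot x z.
Proof. by rewrite hdotDr hdotNr. Qed.
Lemma hdot0l x : hdot 0 x = 0. Proof. by rewrite -(scale0r 0) hdotZl mul0r. Qed.
Lemma hdot0r x : hdot x 0 = 0. Proof. by rewrite hdotC hdot0l rmorph0. Qed.
Lemma hdot_suml (I : Type) (s : seq I) (P : pred I) (F : I -> H) z :
  hdot (\sum_(i <- s | P i) F i) z = \sum_(i <- s | P i) hdot (F i) z.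
Proof. by elim/big_rec2: _ => [|i y x _ h]; rewrite ?hdot0l // hdotDl h. Qed.
Lemma hdot_sumr (I : Type) (s : seq I) (P : pred I) (F : I -> H) z :
  hdot z (\sum_(i <- s | P i) F i) = \sum_(i <- s | P i) hdot z (F i).
Proof. by elim/big_rec2: _ => [|i y x _ h]; rewrite ?hdot0r // hdotDr h. Qed.

Lemma hdotxx x : hdot x x = rc (nrm x ^+ 2).
Proof. by rewrite hdot_norm nrmE; rewrite -(rmorphXn (real_complex R)). Qed.

Lemma nrm2E x : nrm x ^+ 2 = complex.Re (hdot x x).
Proof. by rewrite hdotxx. Qed.

Lemma adjoint_sym (T S : H -> H) : is_adjoint T S -> is_adjoint S T.
Proof. by move=> h x y; rewrite hdotC -h -hdotC. Qed.

Lemma nrmD2 x y : nrm (x + y) ^+ 2 = nrm x ^+ 2 + nrm y ^+ 2 + 2 * complex.Re (hdot x y).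
Proof.
rewrite !nrm2E hdotDl !hdotDr (hdotC y x).
by rewrite !raddfD /=; case: (hdot x y) => a b /=; ring.
Qed.

Lemma nrmB2 x y : nrm (x - y) ^+ 2 = nrm x ^+ 2 + nrm y ^+ 2 - 2 * complex.Re (hdot x y).
Proof. by rewrite nrmD2 nrmN hdotNr raddfN /= mulrN. Qed.

(** The square of the norm of |y| x - |x| y is nonnegative. *)
Lemma Re_hdot_le x y : complex.Re (hdot x y) <= nrm x * nrm y.
Proof.
have [y0|y0] := eqVneq (nrm y) 0.
  by rewrite (nrm_eq0 y0) hdot0r nrm0 mulr0.
have yp : 0 < nrm y by rewrite lt_neqAle eq_sym y0 nrm_ge0.
have xn := nrm_ge0 x.
have : 0 <= nrm (rc (nrm y) *: x - rc (nrm x) *: y) ^+ 2 by exact: sqr_ge0.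
rewrite nrmB2 !nrmZ !nrm_rc ?nrm_ge0 // hdotZl hdotZr.
have -> : complex.Re (rc (nrm y) * (Num.conj (rc (nrm x)) * hdot x y))
   = nrm x * nrm y * complex.Re (hdot x y).
  by case: (hdot x y) => a b /=; ring.
move=> h.
rewrite -subr_ge0.
have {h} : 0 <= nrm x * nrm y * (nrm x * nrm y - complex.Re (hdot x y)) by nra.
have [x0 _|x0] := eqVneq (nrm x) 0; first by rewrite (nrm_eq0 x0) hdot0l nrm0 mul0r subrr.
have xp : 0 < nrm x by rewrite lt_neqAle eq_sym x0 nrm_ge0.
by rewrite pmulr_rge0 // mulr_gt0.
Qed.

(** Multiplying x by the conjugate of (x, y) makes the inner product real. *)
Lemma hdot_le x y : nrm (hdot x y) <= nrm x * nrm y.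
Proof.
have [d0|d0] := eqVneq (hdot x y) 0.
  by rewrite d0 nrm0 mulr_ge0 // nrm_ge0.
have np : 0 < nrm (hdot x y).
  rewrite lt_neqAle nrm_ge0 andbT eq_sym; apply: contraNneq d0 => h.
  by rewrite (nrm_eq0 h).
have := Re_hdot_le (Num.conj (hdot x y) *: x) y.
rewrite hdotZl nrmZ nrm_conj.
have -> : complex.Re (Num.conj (hdot x y) * hdot x y) = nrm (hdot x y) ^+ 2.
  by rewrite mulrC -nrm_sq.
by rewrite expr2 -mulrA ler_pM2l.
Qed.

End Hilbert.

(** * Bounded operators and operator norms of matrices *)

Section Linear.
Variables (R : realType) (V W : lmodType (C R)) (T : V -> W).
Hypothesis hT : linear T.
Lemma lin0 : T 0 = 0.
Proof. by have := hT (-1) 0 0; rewrite !scaler0 add0r scaleN1r addNr. Qed.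
Lemma linD x y : T (x + y) = T x + T y.
Proof. by have := hT 1 x y; rewrite !scale1r. Qed.
Lemma linZ c x : T (c *: x) = c *: T x.
Proof. by have := hT c x 0; rewrite lin0 !addr0. Qed.
Lemma linN x : T (- x) = - T x.
Proof. by rewrite -scaleN1r linZ scaleN1r. Qed.
Lemma linB x y : T (x - y) = T x - T y.
Proof. by rewrite linD linN. Qed.
Lemma lin_sum (I : Type) (s : seq I) (P : pred I) (F : I -> V) :
  T (\sum_(i <- s | P i) F i) = \sum_(i <- s | P i) T (F i).
Proof. by elim/big_rec2: _ => [|i y x _ <-]; rewrite ?lin0 // linD. Qed.
End Linear.

Section Bounded.
Variable R : realType.
Notation rc := (real_complex R).

Definition lip (V W : normedModType (C R)) (M : R) (T : V -> W) :=
  forall x, nrm (T x) <= M * nrm x.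

Lemma bounded_opP (H : hilbertType R) (T : H -> H) :
  bounded_operator T <-> linear T /\ exists2 M, 0 <= M & lip M T.
Proof.
split=> [[lT cT]|[lT [M M0 hM]]].
  have T0 := lin0 lT.
  split=> //; have /nrm_cvgP /(_ 1 ltr01) := cT 0; rewrite T0.
  move=> /nbhs_normP [d /= d0] hd.
  have dr : d = rc (complex.Re d) by rewrite RRe_real // gtr0_real.
  set r := complex.Re d in dr.
  have r0 : 0 < r by rewrite -rc_lt -dr rmorph0.
  exists (2 / r); first by rewrite divr_ge0 // ltW.
  move=> x; have [x0|x0] := eqVneq (nrm x) 0.
    by rewrite (nrm_eq0 x0) (lin0 lT) !nrm0 mulr0.
  have xp : 0 < nrm x by rewrite lt_neqAle eq_sym x0 nrm_ge0.
  have /hd : ball_ Num.norm 0 d (rc (r / 2 / nrm x) *: x).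
    rewrite /ball_ /= sub0r normrN nrmE dr rc_lt nrmZ nrm_rc.
      by rewrite divfK ?gt_eqF // ltr_pdivrMr // ltr_pMr // ltr1n.
    by rewrite !divr_ge0 // ltW.
  rewrite /= sub0r nrmN (linZ lT) nrmZ nrm_rc; last by rewrite !divr_ge0 // ltW.
  move=> h; apply: ltW; rewrite -(ltr_pM2l (_ : 0 < r / 2 / nrm x)).
    apply: lt_le_trans h _; rewrite le_eqVlt; apply/orP; left; apply/eqP.
    by field; rewrite !gt_eqF.
  by rewrite !divr_gt0.
split=> // x; apply/nrm_cvgP => e e0.
have M1 : 0 < M + 1 by rewrite ltr_wpDl.
have : \forall t \near x, nrm (x - t) < e / (M + 1).
  by apply: (nrm_cvgP _ _ _).1; [exact: cvg_id|rewrite divr_gt0].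
apply: filterS => t ht; rewrite -(linB lT).
apply: le_lt_trans (hM _) _; apply: le_lt_trans (_ : (M + 1) * nrm (x - t) < _).
  by rewrite ler_wpM2r ?nrm_ge0 // lerDl.
by rewrite mulrC -ltr_pdivlMr.
Qed.

Variable H : hilbertType R.
Implicit Types S T : H -> H.

Lemma bop_lin T : bounded_operator T -> linear T. Proof. by case. Qed.
Lemma bop_lip T : bounded_operator T -> exists2 M, 0 <= M & lip M T.
Proof. by move=> /bounded_opP []. Qed.
Lemma lip_bop T M : linear T -> 0 <= M -> lip M T -> bounded_operator T.
Proof. by move=> lT M0 hM; apply/bounded_opP; split=> //; exists M. Qed.

Lemma bopD S T : bounded_operator S -> bounded_operator T -> bounded_operator (S + T).
Proof.
move=> /bounded_opP [lS [M M0 hM]] /bounded_opP [lT [N N0 hN]].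
apply: (@lip_bop _ (M + N)); rewrite ?addr_ge0 //.
  by move=> a x y; rewrite !fctE lS lT scalerDr addrACA.
by move=> x; apply: le_trans (nrmD _ _) _; rewrite mulrDl lerD.
Qed.
Lemma bop_comp S T : bounded_operator S -> bounded_operator T -> bounded_operator (S \o T).
Proof.
move=> /bounded_opP [lS [M M0 hM]] /bounded_opP [lT [N N0 hN]].
apply: (@lip_bop _ (M * N)); rewrite ?mulr_ge0 //.
  by move=> a x y /=; rewrite lT lS.
by move=> x /=; apply: le_trans (hM _) _; rewrite -mulrA ler_wpM2l.
Qed.

Variable n : nat.
Implicit Types x y : 'I_n -> H.

(** The inner product of H^n, whose norm is [hnorm]. *)
Definition ip x y : C R := \sum_(i < n) hdot (x i) (y i).

Lemma hnorm_ge0 x : 0 <= hnorm x. Proof. exact: sqrtr_ge0. Qed.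

Lemma hnorm2 x : hnorm x ^+ 2 = \sum_i nrm (x i) ^+ 2.
Proof. by rewrite sqr_sqrtr // sumr_ge0 // => i _; exact: sqr_ge0. Qed.

Lemma ipxx x : ip x x = rc (hnorm x ^+ 2).
Proof.
by rewrite hnorm2 [RHS](rmorph_sum (real_complex R)); apply: eq_bigr => i _; rewrite hdotxx.
Qed.

Lemma nrm_le_hnorm x i : nrm (x i) <= hnorm x.
Proof.
rewrite -(ler_pXn2r (_ : (0 < 2)%N)) ?nnegrE ?nrm_ge0 ?hnorm_ge0 //.
by rewrite hnorm2 (bigD1 i) //= lerDl sumr_ge0 // => j _; exact: sqr_ge0.
Qed.

Lemma hnorm_le_sum x : hnorm x <= \sum_i nrm (x i).
Proof.
have s0 : 0 <= \sum_i nrm (x i) by rewrite sumr_ge0 // => i _; exact: nrm_ge0.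
rewrite -(ler_pXn2r (_ : (0 < 2)%N)) ?nnegrE ?hnorm_ge0 //.
rewrite hnorm2 [X in _ <= X]expr2 mulr_suml; apply: ler_sum => i _.
rewrite expr2 ler_wpM2l ?nrm_ge0 // (bigD1 i) //= lerDl.
by apply: sumr_ge0 => j _; exact: nrm_ge0.
Qed.

Lemma hnormZ c x : hnorm (fun i => c *: x i) = nrm (c : C R) * hnorm x.
Proof.
apply/eqP; rewrite -(eqrXn2 (_ : (0 < 2)%N)) ?mulr_ge0 ?nrm_ge0 ?hnorm_ge0 //.
rewrite exprMn !hnorm2 mulr_sumr; apply/eqP; apply: eq_bigr => i _.
by rewrite nrmZ exprMn.
Qed.

Lemma hnorm_eq0 x : hnorm x = 0 -> forall i, x i = 0.
Proof.
move=> h i; apply: nrm_eq0; apply/eqP; rewrite eq_le nrm_ge0 andbT.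
by rewrite -h nrm_le_hnorm.
Qed.

Lemma Re_ip_le x y : complex.Re (ip x y) <= hnorm x * hnorm y.
Proof.
have -> : complex.Re (ip x y) = \sum_i complex.Re (hdot (x i) (y i)).
  by rewrite /ip; elim/big_rec2: _ => [//|i a b _ <-]; case: b (hdot _ _) => ? ? [].
set A := hnorm x; set B := hnorm y.
have [A0 B0] : 0 <= A /\ 0 <= B by rewrite !hnorm_ge0.
apply: (@le_trans _ _ (\sum_i nrm (x i) * nrm (y i))).
  by apply: ler_sum => i _; exact: Re_hdot_le.
have [a0|a0] := eqVneq A 0.
  rewrite a0 mul0r big1 // => i _.
  by rewrite (hnorm_eq0 a0) nrm0 mul0r.
have [b0|b0] := eqVneq B 0.
  rewrite b0 mulr0 big1 // => i _.
  by rewrite (hnorm_eq0 b0) nrm0 mulr0.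
have Ap : 0 < A by rewrite lt_neqAle eq_sym a0.
have Bp : 0 < B by rewrite lt_neqAle eq_sym b0.
have h : \sum_i (2 * (A * B)) * (nrm (x i) * nrm (y i))
    <= \sum_i (B ^+ 2 * nrm (x i) ^+ 2 + A ^+ 2 * nrm (y i) ^+ 2).
  apply: ler_sum => i _.
  have := sqr_ge0 (B * nrm (x i) - A * nrm (y i)); nra.
move: h; rewrite -mulr_sumr big_split /= -!mulr_sumr -!hnorm2 -/A -/B.
have -> : B ^+ 2 * A ^+ 2 + A ^+ 2 * B ^+ 2 = 2 * (A * B) * (A * B) by ring.
by rewrite ler_pM2l // !mulr_gt0.
Qed.

Definition app (T : 'M[H -> H]_n) x : 'I_n -> H := fun i => \sum_(j < n) T i j (x j).

Lemma app_lip (T : 'M[H -> H]_n) : (forall i j, bounded_operator (T i j)) ->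
  exists2 M, 0 <= M & forall x, hnorm (app T x) <= M * hnorm x.
Proof.
move=> hT.
have /choice [N hN] : forall ij : 'I_n * 'I_n, exists N, 0 <= N /\ lip N (T ij.1 ij.2).
  by move=> [i j]; have [N ? ?] := bop_lip (hT i j); exists N.
exists (\sum_i \sum_j N (i, j)).
  by apply: sumr_ge0 => i _; apply: sumr_ge0 => j _; case: (hN (i, j)).
move=> x; apply: le_trans (hnorm_le_sum _) _; rewrite mulr_suml; apply: ler_sum => i _.
apply: le_trans (nrm_sum _ _ _) _; rewrite mulr_suml; apply: ler_sum => j _.
have [N0 hl] := hN (i, j); apply: le_trans (hl _) _.
by rewrite ler_wpM2l // nrm_le_hnorm.
Qed.

Lemma opnormE (T : 'M[H -> H]_n) :
  opnorm T = sup [set hnorm (app T x) | x in [set x : 'I_n -> H | hnorm x <= 1]].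
Proof. by []. Qed.

Lemma appZ (T : 'M[H -> H]_n) : (forall i j, linear (T i j)) ->
  forall c x, app T (fun i => c *: x i) = fun i => c *: app T x i.
Proof.
move=> lT c x; apply/funext => i; rewrite /app scaler_sumr.
by apply: eq_bigr => j _; rewrite (linZ (lT i j)).
Qed.

Lemma hnorm_zero : @hnorm R H n (fun=> 0) = 0.
Proof.
by rewrite /hnorm big1 ?sqrtr0 // => i _; rewrite -/(nrm _) nrm0 expr0n.
Qed.

(** With [opnorm_ge]: [opnorm T] is the least bound of [T] as an operator on H^n. *)
Lemma opnorm_le (T : 'M[H -> H]_n) M : 0 <= M ->
  (forall x, hnorm (app T x) <= M * hnorm x) -> opnorm T <= M.
Proof.
move=> M0 hM; rewrite opnormE; apply: ge_sup.
  by exists (hnorm (app T (fun=> 0))); exists (fun=> 0) => //=; rewrite hnorm_zero.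
move=> _ [x /= x1 <-]; apply: le_trans (hM x) _.
by rewrite -[leRHS]mulr1 ler_wpM2l.
Qed.

(** The supremum that defines [opnorm] is finite as soon as the entries are
    bounded, and homogeneity extends the bound from the unit ball. *)
Lemma opnorm_ge (T : 'M[H -> H]_n) : (forall i j, bounded_operator (T i j)) ->
  forall x, hnorm (app T x) <= opnorm T * hnorm x.
Proof.
move=> hT x; have lT i j : linear (T i j) by exact: bop_lin.
have [M M0 hM] := app_lip hT.
have [x0|x0] := eqVneq (hnorm x) 0.
  by have := hM x; rewrite x0 !mulr0.
have xp : 0 < hnorm x by rewrite lt_neqAle eq_sym x0 hnorm_ge0.
have ip0 : 0 <= (hnorm x)^-1 by rewrite invr_ge0 ltW.
rewrite -ler_pdivrMr // mulrC.
rewrite -{1}(nrm_rc ip0) -hnormZ -appZ // opnormE.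
apply: ub_le_sup.
  exists M => _ [y /= y1 <-]; apply: le_trans (hM y) _.
  by rewrite -[leRHS]mulr1 ler_wpM2l.
exists (fun i => rc (hnorm x)^-1 *: x i) => //=.
by rewrite hnormZ nrm_rc // mulVf.
Qed.

Lemma opnorm_ge0 (T : 'M[H -> H]_n) : (forall i j, bounded_operator (T i j)) -> 0 <= opnorm T.
Proof.
move=> hT; have [M M0 hM] := app_lip hT.
apply: le_trans (hnorm_ge0 (app T (fun=> 0))) _.
rewrite opnormE; apply: ub_le_sup.
  exists M => _ [y /= y1 <-]; apply: le_trans (hM y) _.
  by rewrite -[leRHS]mulr1 ler_wpM2l.
by exists (fun=> 0) => //=; rewrite hnorm_zero.
Qed.

End Bounded.

Section Opnorm1.
Variables (R : realType) (H : hilbertType R).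

Lemma hnorm_1 (x : 'I_1 -> H) : hnorm x = nrm (x ord0).
Proof. by rewrite /hnorm big_ord1 sqrtr_sqr ger0_norm // nrm_ge0. Qed.

Lemma opnorm1_ge (T : H -> H) : bounded_operator T ->
  lip (opnorm (const_mx T : 'M[H -> H]_1)) T.
Proof.
move=> bT x.
have hb (i j : 'I_1) : bounded_operator ((const_mx T : 'M[H -> H]_1) i j) by rewrite mxE.
by have := opnorm_ge hb (fun=> x); rewrite !hnorm_1 /app big_ord1 mxE.
Qed.

Lemma opnorm1_le (T : H -> H) M : 0 <= M -> lip M T ->
  opnorm (const_mx T : 'M[H -> H]_1) <= M.
Proof.
move=> M0 hM; apply: opnorm_le => // x.
by rewrite !hnorm_1 /app big_ord1 mxE.
Qed.
End Opnorm1.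

(** * The Hilbert space of square summable families *)

Section L2.
Variables (R : realType) (I : countType).
Notation rc := (real_complex R).
Implicit Types x y : I -> C R.

Definition l2sum x (s : seq I) : R := \sum_(i <- s) nrm (x i) ^+ 2.

Lemma l2sum_ge0 x s : 0 <= l2sum x s.
Proof. by apply: sumr_ge0 => i _; exact: sqr_ge0. Qed.

(** Minkowski's inequality for a finite sum, from
    (u + v)^2 <= (1 + b/a) u^2 + (1 + a/b) v^2; the bounds a and b are first made
    positive by adding e to them. *)
Lemma l2sumD x y s (a b : R) : 0 <= a -> 0 <= b -> l2sum x s <= a ^+ 2 ->
  l2sum y s <= b ^+ 2 -> l2sum (x + y) s <= (a + b) ^+ 2.
Proof.
move=> a0 b0 hx hy.
suff h (e : R) : 0 < e -> l2sum (x + y) s <= (a + e + (b + e)) ^+ 2.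
  rewrite leNgt; apply/negP => lt.
  set c := l2sum _ _ in h lt.
  have s0 : 0 <= Num.sqrt c by exact: sqrtr_ge0.
  have ssq : Num.sqrt c ^+ 2 = c by rewrite sqr_sqrtr // /c l2sum_ge0.
  have lt' : a + b < Num.sqrt c.
    by rewrite -(ltr_pXn2r (_ : (0 < 2)%N)) ?nnegrE ?addr_ge0 // ssq.
  pose e := (Num.sqrt c - (a + b)) / 4.
  have e0 : 0 < e by rewrite divr_gt0 // subr_gt0.
  have := h e e0; rewrite -ssq ler_pXn2r ?nnegrE ?addr_ge0 // ?(ltW e0) //.
  rewrite /e; lra.
move=> e0; set A := a + e; set B := b + e.
have A0 : 0 < A by rewrite ltr_wpDl.
have B0 : 0 < B by rewrite ltr_wpDl.
have hx' : l2sum x s <= A ^+ 2.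
  by apply: le_trans hx _; rewrite ler_pXn2r ?nnegrE // ?(ltW A0) // lerDl ltW.
have hy' : l2sum y s <= B ^+ 2.
  by apply: le_trans hy _; rewrite ler_pXn2r ?nnegrE // ?(ltW B0) // lerDl ltW.
apply: (@le_trans _ _ ((1 + B / A) * l2sum x s + (1 + A / B) * l2sum y s)).
  rewrite !mulr_sumr -big_split /=; apply: ler_sum => i _.
  apply: (@le_trans _ _ ((nrm (x i) + nrm (y i)) ^+ 2)).
    by rewrite ler_pXn2r ?nnegrE ?nrm_ge0 ?addr_ge0 ?nrm_ge0 //; exact: nrmD.
  rewrite -subr_ge0.
  set u := nrm (x i); set v := nrm (y i).
  have -> : (1 + B / A) * u ^+ 2 + (1 + A / B) * v ^+ 2 - (u + v) ^+ 2
     = (B * u - A * v) ^+ 2 / (A * B) by field; rewrite !gt_eqF.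
  by rewrite divr_ge0 ?sqr_ge0 // ltW // mulr_gt0.
apply: (@le_trans _ _ ((1 + B / A) * A ^+ 2 + (1 + A / B) * B ^+ 2)).
  by apply: lerD; rewrite ler_wpM2l // addr_ge0 // divr_ge0 // ltW.
by rewrite le_eqVlt; apply/orP; left; apply/eqP; field; rewrite !gt_eqF.
Qed.

Lemma l2sumZ c x s : l2sum (c *: x) s = nrm (c : C R) ^+ 2 * l2sum x s.
Proof.
by rewrite /l2sum mulr_sumr; apply: eq_bigr => i _; rewrite fctE nrmZ exprMn.
Qed.

(** Square summability through finite partial sums over duplicate-free
    sequences of indices, so that no order on the index set is involved. *)
Definition summable2 : {pred I -> C R} :=
  fun x => `[< exists M, forall s, uniq s -> l2sum x s <= M >].

Lemma summable2P x :
  reflect (exists M, forall s, uniq s -> l2sum x s <= M) (x \in summable2).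
Proof. exact: asboolP. Qed.

Lemma summable2_submod : submod_closed summable2.
Proof.
split.
  apply/summable2P; exists 0 => s _; rewrite /l2sum big1 // => i _.
  by rewrite nrm0 expr0n.
move=> c x y /summable2P [M hM] /summable2P [N hN].
have M0 : 0 <= M by have := hM [::] isT; rewrite /l2sum big_nil.
have N0 : 0 <= N by have := hN [::] isT; rewrite /l2sum big_nil.
apply/summable2P; exists ((nrm (c : C R) * Num.sqrt M + Num.sqrt N) ^+ 2) => s us.
apply: l2sumD; rewrite ?mulr_ge0 ?nrm_ge0 ?sqrtr_ge0 //.
  by rewrite l2sumZ exprMn sqr_sqrtr // ler_wpM2l ?sqr_ge0 // hM.
by rewrite sqr_sqrtr // hN.
Qed.

Record l2 := L2 { l2f :> I -> C R; l2P : l2f \in summable2 }.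
HB.instance Definition _ := [isSub for l2f].
HB.instance Definition _ := gen_eqMixin l2.
HB.instance Definition _ := gen_choiceMixin l2.
HB.instance Definition _ := GRing.isSubmodClosed.Build (C R) (I -> C R) summable2
  summable2_submod.
HB.instance Definition _ := [SubChoice_isSubLmodule of l2 by <:].

Lemma l2D (x y : l2) i : (x + y) i = x i + y i. Proof. by []. Qed.
Definition l2N2 (x : l2) : R := sup [set l2sum x s | s in [set s | uniq s]].

Lemma l2N2_le (x : l2) M : (forall s, uniq s -> l2sum x s <= M) -> l2N2 x <= M.
Proof.
move=> hM; apply: ge_sup => [|_ [s us <-]]; last exact: hM.
by exists (l2sum x [::]); exists [::].
Qed.

Lemma l2N2_ge (x : l2) s : uniq s -> l2sum x s <= l2N2 x.
Proof.
move=> us; apply: ub_le_sup; last by exists s.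
have /summable2P [M hM] := l2P x.
by exists M => _ [t ut <-]; exact: hM.
Qed.

Lemma l2N2_ge0 (x : l2) : 0 <= l2N2 x.
Proof. by apply: le_trans (l2sum_ge0 x [::]) _; exact: l2N2_ge. Qed.

Definition l2norm (x : l2) : C R := rc (Num.sqrt (l2N2 x)).

Lemma l2norm_triangle (x y : l2) : l2norm (x + y) <= l2norm x + l2norm y.
Proof.
rewrite -[leRHS](rmorphD (real_complex R)) rc_le.
have [a0 b0] : 0 <= Num.sqrt (l2N2 x) /\ 0 <= Num.sqrt (l2N2 y) by rewrite !sqrtr_ge0.
rewrite -(ler_pXn2r (_ : (0 < 2)%N)) ?nnegrE ?addr_ge0 ?sqrtr_ge0 //.
rewrite sqr_sqrtr ?l2N2_ge0 //; apply: l2N2_le => s us.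
by apply: l2sumD => //; rewrite sqr_sqrtr ?l2N2_ge0 // l2N2_ge.
Qed.

Lemma l2N2Z c (x : l2) : l2N2 (c *: x) = nrm (c : C R) ^+ 2 * l2N2 x.
Proof.
have le a (z : l2) : l2N2 (a *: z) <= nrm (a : C R) ^+ 2 * l2N2 z.
  apply: l2N2_le => s us; rewrite (l2sumZ a z) ler_wpM2l ?sqr_ge0 //; exact: l2N2_ge.
apply/eqP; rewrite eq_le le /=.
have [->|c0] := eqVneq c 0.
  by rewrite nrm0 expr0n mul0r; exact: l2N2_ge0.
have n0 : nrm (c : C R) != 0 by apply: contraNneq c0 => /nrm_eq0 ->.
rewrite -ler_pdivlMl; last by rewrite exprn_gt0 // lt_neqAle eq_sym n0 nrm_ge0.
have := le c^-1 (c *: x); rewrite scalerA mulVf // scale1r.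
by rewrite nrmV exprVn.
Qed.

Lemma l2normZ c (x : l2) : l2norm (c *: x) = `|c| * l2norm x.
Proof.
rewrite /l2norm l2N2Z sqrtrM ?sqr_ge0 // sqrtr_sqr ger0_norm ?nrm_ge0 //.
by rewrite (nrmE (c : C R)); exact: (rmorphM (real_complex R)).
Qed.

Lemma l2norm0 (x : l2) : l2norm x = 0 -> x = 0.
Proof.
move=> /rc_inj /eqP; rewrite sqrtr_eq0 => h.
suff hi i : x i = 0 :> C R by apply: val_inj; apply/funext => i; exact: hi.
apply: (@nrm_eq0 R (C R)); apply/eqP; rewrite -sqrf_eq0 eq_le sqr_ge0 andbT.
by apply: le_trans h; have := @l2N2_ge x [:: i] isT; rewrite /l2sum big_seq1.
Qed.

HB.instance Definition _ := @Lmodule_isNormed.Build (C R) l2 l2norm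
  l2norm_triangle l2normZ l2norm0.

Lemma nrm_l2 (x : l2) : nrm x = Num.sqrt (l2N2 x). Proof. by []. Qed.

Lemma nrm2_l2 (x : l2) : nrm x ^+ 2 = l2N2 x.
Proof. by rewrite nrm_l2 sqr_sqrtr // l2N2_ge0. Qed.

Lemma l2sum_le (x : l2) s : uniq s -> l2sum x s <= nrm x ^+ 2.
Proof. by rewrite nrm2_l2; exact: l2N2_ge. Qed.

Lemma nrm_coord (x : l2) i : nrm (x i) <= nrm x.
Proof.
rewrite -(ler_pXn2r (_ : (0 < 2)%N)) ?nnegrE ?nrm_ge0 //.
by have := @l2sum_le x [:: i] isT; rewrite /l2sum big_seq1.
Qed.

Lemma l2_bound (x : I -> C R) M : (forall s, uniq s -> l2sum x s <= M ^+ 2) -> 0 <= M ->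
  exists2 y : l2, l2f y = x & nrm y <= M.
Proof.
move=> hM M0.
have hx : x \in summable2 by apply/summable2P; exists (M ^+ 2).
exists (L2 hx) => //.
rewrite -(ler_pXn2r (_ : (0 < 2)%N)) ?nnegrE ?nrm_ge0 //.
by rewrite nrm2_l2; apply: l2N2_le.
Qed.

(** Completeness of the real and imaginary parts, in a form that does not
    mention the uniform structure of [C R]. *)
Lemma C_complete (F : set_system (C R)) : ProperFilter F ->
  (forall e : R, 0 < e -> exists x : C R, F [set y | nrm (x - y) < e]) ->
  exists a : C R, forall e : R, 0 < e -> F [set y | nrm (a - y) < e].
Proof.
move=> FF hF.
have hP (p : C R -> R) : (forall a b, `|p a - p b| <= nrm (a - b)) -> exists r : R,
    forall e, 0 < e -> F [set y | `|r - p y| < e].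
  move=> hp; have /cvg_ex [r hr] : cvg (p @ F).
    apply: R_complete; apply: cauchy_exP => e e0.
    have [x hx] := hF e e0; exists (p x).
    suff : F [set y | ball (p x) e (p y)] by [].
    by apply: filterS hx => y /= h; rewrite /ball /=; apply: le_lt_trans h.
  by exists r => e e0; move/cvgrPdist_lt : hr => /(_ e e0).
have hRe (a b : C R) : `|complex.Re a - complex.Re b| <= nrm (a - b).
  by rewrite -raddfB /= -rc_le -nrmE; exact: normc_ge_Re.
have hIm (a b : C R) : `|complex.Im a - complex.Im b| <= nrm (a - b).
  rewrite -raddfB /=.
  have := normc_ge_Re ((a - b : R[i]) * 'i%C); rewrite ReiNIm normrN.
  rewrite -rc_le => /le_trans; apply.
  by rewrite normrM [X in _ * X]normc_def /= expr0n add0r expr1n sqrtr1 mulr1 -nrmE.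
have [r hr] := hP (@complex.Re R) hRe.
have [s hs] := hP (@complex.Im R) hIm.
exists (Complex r s) => e e0.
have e2 : 0 < e / 2 by rewrite divr_gt0.
apply: filterS2 (hr _ e2) (hs _ e2) => y /= h1 h2.
have -> : Complex r s - y = rc (r - complex.Re y) + Complex 0 1 * rc (s - complex.Im y).
  by case: y {h1 h2} => u v; simpc.
apply: le_lt_trans (nrmD _ _) _; rewrite nrmM !nrm_real.
rewrite nrm_imag mul1r; lra.
Qed.

(** A Cauchy filter converges in each coordinate; the family of these limits is
    within 2e, in every finite partial sum, of any point x that is within e of
    the filter. *)
Lemma l2_complete (F : set_system l2) : ProperFilter F -> cauchy F -> cvg F.
Proof.
move=> FF /cauchyP hF; apply/cvg_ex.
have hF' (e : R) : 0 < e -> exists x : l2, F [set y | nrm (x - y) < e].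
  rewrite -rc_lt rmorph0 => e0; have [x hx] := hF _ e0.
  exists x; apply: filterS hx => y.
  by rewrite -ball_normE /ball_ /= nrmE rc_lt.
have hi i : exists a : C R, forall e : R, 0 < e -> F [set y : l2 | nrm (a - y i) < e].
  apply: (@C_complete ((fun y : l2 => y i) @ F)) => e e0.
  have [x hx] := hF' e e0; exists (x i).
  suff : F [set y : l2 | nrm (x i - y i) < e] by [].
  apply: filterS hx => y /=; apply: le_lt_trans; exact: (nrm_coord (x - y)).
have {hi} [a ha] := choice hi.
have key (e : R) : 0 < e -> exists x : l2, F [set y | nrm (x - y) < e] /\
    forall s, uniq s -> l2sum (a - x) s <= (2 * e) ^+ 2.
  move=> e0; have [x hx] := hF' e e0; exists x; split=> // s us.
  (* z is in the filter set around x and close to the limit a at the finitely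
     many indices of s. *)
  have [z [/= h1 h2]] : exists z : l2, nrm (x - z) < e /\ l2sum (a - z) s <= e ^+ 2.
    have hz : F [set z : l2 | forall i, i \in s -> nrm (a i - z i) < e / (size s).+1%:R].
      elim: s {us} (size s).+1%:R (ltr0Sn R (size s)) => [|j s ih] r r0.
        by apply: filterE => z /= i; rewrite in_nil.
      have h := ha j (e / r) (divr_gt0 e0 r0).
      apply: filterS2 h (ih r r0) => y h1 h2 i; rewrite inE => /orP [/eqP -> //|]; exact: h2.
    have [z [hxz h]] := filter_ex (filterI hx hz); exists z; split=> //.
    set m := (size s).+1%:R in h.
    apply: (@le_trans _ _ (\sum_(i <- s) (e ^+ 2 / m))).
      rewrite /l2sum big_seq [X in _ <= X]big_seq; apply: ler_sum => i /h hh.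
      apply: (@le_trans _ _ ((e / m) ^+ 2)).
        by rewrite ler_pXn2r ?nnegrE ?nrm_ge0 ?divr_ge0 ?ltW.
      rewrite expr_div_n ler_wpM2l ?sqr_ge0 // lef_pV2 ?posrE ?exprn_gt0 ?ltr0Sn //.
      by rewrite expr2 ler_peMr ?ler0n // ler1n.
    rewrite big_const_seq iter_addr_0 count_predT -mulr_natr -mulrA -[leRHS]mulr1.
    by rewrite ler_wpM2l ?sqr_ge0 // mulrC ler_pdivrMr ?ltr0Sn // mul1r ler_nat.
  have -> : a - x = (a - z) + (z - x : l2) by rewrite addrA subrK.
  rewrite mulr2n mulrDl mul1r; apply: l2sumD; rewrite ?(ltW e0) //.
  apply: le_trans (@l2sum_le (z - x) _ us) _.
  by rewrite ler_pXn2r ?nnegrE ?nrm_ge0 ?ltW // nrm_distC.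
have [x0 [_ h0]] := key 1 ltr01.
have p2 : 0 <= 2 * 1 :> R by rewrite mulr1.
have [y0 y0E _] := l2_bound h0 p2.
pose l : l2 := y0 + x0.
have lE : l2f l = a by apply/funext => i; rewrite /l l2D y0E fctE subrK.
exists l; apply/nrm_cvgP => e e0.
have e4 : 0 < e / 4 by rewrite divr_gt0.
have [x [hx hs]] := key _ e4; apply: filterS hx => y /= hy.
have -> : l - y = (l - x) + (x - y) by rewrite addrA subrK.
apply: le_lt_trans (nrmD _ _) _.
have : nrm (l - x) <= 2 * (e / 4).
  have e4' : 0 <= 2 * (e / 4) by rewrite mulr_ge0 // ltW.
  have hs' s : uniq s -> l2sum (a - x) s <= (2 * (e / 4)) ^+ 2 by exact: hs.
  have [z zE hz] := l2_bound hs' e4'.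
  suff -> : l - x = z by [].
  by apply: val_inj => /=; rewrite zE -lE.
lra.
Qed.

HB.instance Definition _ := Uniform_isComplete.Build l2 l2_complete.

End L2.

Section L2dot.
Variables (R : realType) (I : countType).
Notation rc := (real_complex R).
Notation l2 := (l2 R I).
Implicit Types x y z : l2.

(** An exhaustion of the index set by finite sequences, which gives inner
    products as limits of sequences. *)
Definition enumer (N : nat) : seq I := pmap pickle_inv (iota 0 N).

Lemma enumer_uniq N : uniq (enumer N).
Proof. by apply: (pmap_uniq (@pickle_invK I)); exact: iota_uniq. Qed.

Lemma mem_enumer N i : (i \in enumer N) = (pickle i < N)%N.
Proof.
rewrite mem_pmap; apply/mapP/idP => [[n]|h].
  rewrite mem_iota => nN /esym h; have := @pickle_invK I n; rewrite h /= => ->.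
  by case/andP: nN.
by exists (pickle i); rewrite ?mem_iota ?pickleK_inv.
Qed.

Lemma enumer_sub (s : seq I) : exists N, forall n, (N <= n)%N -> {subset s <= enumer n}.
Proof.
elim: s => [|i s [N hN]]; first by exists 0%N.
exists (maxn N (pickle i).+1) => n; rewrite geq_max => /andP [h1 h2] j.
rewrite inE => /orP [/eqP ->|]; first by rewrite mem_enumer.
exact: hN.
Qed.

Lemma l2sum_sub (x : I -> C R) (s t : seq I) : uniq s -> uniq t -> {subset s <= t} ->
  l2sum x s <= l2sum x t.
Proof.
move=> us ut st; rewrite /l2sum [leRHS](bigID (mem s)) /=.
have ps : perm_eq [seq i <- t | i \in s] s.
  apply: uniq_perm; rewrite ?filter_uniq // => i; rewrite mem_filter.
  by apply/andP/idP => [[]//|h]; split=> //; exact: st.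
rewrite -[X in _ <= X + _]big_filter [X in _ <= X + _](perm_big _ ps) /=.
by rewrite lerDl sumr_ge0 // => i _; exact: sqr_ge0.
Qed.

Lemma l2sum_cvg x (e : R) : 0 < e -> exists N, forall n, (N <= n)%N ->
  nrm x ^+ 2 - e < l2sum x (enumer n) <= nrm x ^+ 2.
Proof.
move=> e0.
have [s us hs] : exists2 s, uniq s & nrm x ^+ 2 - e < l2sum x s.
  apply/not_exists2P => h; suff : l2N2 x <= nrm x ^+ 2 - e by rewrite nrm2_l2; lra.
  apply: l2N2_le => s us; rewrite leNgt; apply/negP => lt.
  by case: (h s).
have [N hN] := enumer_sub s; exists N => n /hN sub.
rewrite (lt_le_trans hs) ?l2sum_sub ?enumer_uniq //=.
by apply: l2sum_le; exact: enumer_uniq.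
Qed.

Lemma sum_sq_cvg x :
  (fun n => \sum_(i <- enumer n) x i * Num.conj (x i)) @ \oo --> (rc (nrm x ^+ 2) : C R).
Proof.
apply/nrm_cvgnP => e e0; have [N hN] := l2sum_cvg x e0; exists N => n /hN /andP [h1 h2].
have -> : \sum_(i <- enumer n) x i * Num.conj (x i) = rc (l2sum x (enumer n)).
  by rewrite [RHS](rmorph_sum (real_complex R)); apply: eq_bigr => i _; exact: esym (nrm_sq _).
rewrite -[X in nrm X](rmorphB (real_complex R)) nrm_rc; lra.
Qed.

Definition l2part x y n : C R := \sum_(i <- enumer n) x i * Num.conj (y i).
Definition l2dot x y : C R := lim (l2part x y @ \oo).

(** Polarization, which reduces the convergence of the sums of x_i y_i^* to that
    of sums of squares. *)
Lemma polar (a b : C R) : a * Num.conj b = 4^-1 * ((a + b) * Num.conj (a + b)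
   - (a - b) * Num.conj (a - b)
   + 'i * ((a + 'i * b) * Num.conj (a + 'i * b))
   - 'i * ((a - 'i * b) * Num.conj (a - 'i * b))).
Proof.
rewrite !(rmorphD, rmorphN, rmorphM) /= conjCi.
set c := Num.conj a; set d := Num.conj b.
have i2 : 'i * 'i = -1 :> C R by rewrite -expr2 sqrCi.
have n4 : (4 : C R) != 0 by rewrite pnatr_eq0.
apply: (mulfI n4); rewrite [RHS]mulrA divff // mul1r.
transitivity (4 * (a * d) + (2 * (1 + 'i * 'i)) * (b * c - a * d)); last by ring.
by rewrite i2; ring.
Qed.

Lemma l2dot_cvg x y : l2part x y @ \oo --> l2dot x y.
Proof.
suff : cvg (l2part x y @ \oo) by [].
have -> : l2part x y = fun n => 4^-1 * (l2part (x + y) (x + y) n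
   - l2part (x - y) (x - y) n
   + 'i * l2part (x + 'i *: y) (x + 'i *: y) n
   - 'i * l2part (x - 'i *: y) (x - 'i *: y) n).
  apply/funext => n; rewrite /l2part !mulr_sumr -!(big_split, sumrB) /= mulr_sumr.
  apply: eq_bigr => i _; exact: polar.
apply/cvg_ex; eexists; apply: cvgM; first exact: cvg_cst.
apply: cvgB; last by apply: cvgM; [exact: cvg_cst|exact: sum_sq_cvg].
apply: cvgD; last by apply: cvgM; [exact: cvg_cst|exact: sum_sq_cvg].
by apply: cvgB; exact: sum_sq_cvg.
Qed.

Lemma l2dot_eq x y a : l2part x y @ \oo --> a -> l2dot x y = a.
Proof. by move=> h; apply: (cvg_unique (@norm_hausdorff _ _) _ h); exact: l2dot_cvg. Qed.

Lemma l2dotxx x : l2dot x x = rc (nrm x ^+ 2).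
Proof. by apply: l2dot_eq; exact: sum_sq_cvg. Qed.

Lemma l2dotC x y : l2dot x y = Num.conj (l2dot y x).
Proof.
apply: l2dot_eq; apply/nrm_cvgnP => e e0.
have /nrm_cvgnP /(_ e e0) [N hN] := @l2dot_cvg y x; exists N => n /hN.
suff -> : l2part x y n = Num.conj (l2part y x n) by rewrite -rmorphB nrm_conj.
rewrite /l2part rmorph_sum; apply: eq_bigr => i _.
by rewrite rmorphM /= conjCK mulrC.
Qed.

Lemma l2dotPl c x y z : l2dot (c *: x + y) z = c * l2dot x z + l2dot y z.
Proof.
apply: l2dot_eq.
have -> : l2part (c *: x + y) z = fun n => c * l2part x z n + l2part y z n.
  apply/funext => n; rewrite /l2part mulr_sumr -big_split /=.
  by apply: eq_bigr => i _; rewrite mulrDl mulrA.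
by apply: cvgD; [apply: cvgM; [exact: cvg_cst|]|]; exact: l2dot_cvg.
Qed.

Lemma l2dotPr c x y z : l2dot z (c *: x + y) = Num.conj c * l2dot z x + l2dot z y.
Proof.
by rewrite l2dotC l2dotPl rmorphD rmorphM /= -!l2dotC.
Qed.

Lemma l2dot_zmodl y : zmod_morphism (l2dot^~ y).
Proof.
move=> a b; have := l2dotPl (-1) b a y.
by rewrite scaleN1r addrC mulN1r addrC => ->; rewrite addrC.
Qed.
Lemma l2dot_zmodr y : zmod_morphism (l2dot y).
Proof.
move=> a b; have := l2dotPr (-1) b a y.
by rewrite scaleN1r addrC rmorphN1 mulN1r addrC => ->; rewrite addrC.
Qed.
Lemma l2dot_scall y : scalable_for *%R (l2dot^~ y).
Proof.
move=> c a; have := l2dotPl c a 0 y; rewrite addr0.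
by have := l2dot_zmodl y 0 0; rewrite subrr /= subrr => ->; rewrite addr0.
Qed.
Lemma l2dot_scalr y : scalable_for (Num.conj \; *%R) (l2dot y).
Proof.
move=> c a; have := l2dotPr c a 0 y; rewrite addr0.
by have := l2dot_zmodr y 0 0; rewrite subrr /= subrr => ->; rewrite addr0.
Qed.

HB.instance Definition _ := isBilinear.Build (C R) l2 l2 (C R) ( *%R ) (Num.conj \; *%R)
  l2dot l2dot_zmodl l2dot_zmodr l2dot_scall l2dot_scalr.

Lemma l2dot_herm x y : l2dot x y = (-1) ^+ false * Num.conj (l2dot y x).
Proof. by rewrite expr0 mul1r l2dotC. Qed.

HB.instance Definition _ := isHermitianSesquilinear.Build (C R) l2 false Num.conj l2dot l2dot_herm.

Lemma l2dot_gt0 x : x != 0 -> 0 < l2dot x x.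
Proof.
move=> x0; rewrite l2dotxx -(rmorph0 (real_complex R)) rc_lt exprn_gt0 //.
rewrite lt_neqAle nrm_ge0 andbT eq_sym; apply: contraNneq x0 => h.
by rewrite (nrm_eq0 h).
Qed.

HB.instance Definition _ := isDotProduct.Build (C R) l2 l2dot l2dot_gt0.

Lemma l2dot_norm x : l2dot x x = `|x| ^+ 2.
Proof. by rewrite l2dotxx nrmE; exact: (rmorphXn (real_complex R)). Qed.

(** The space of square summable families on [I] as a Hilbert space. *)
Definition L2H : hilbertType R := @HilbertType R l2 l2dot l2dot_norm.

Definition dlt (i : I) : I -> C R := fun j => (j == i)%:R.

Lemma dlt_sum2 i : dlt i \in @summable2 R I.
Proof.
apply/summable2P; exists 1 => s us; rewrite /l2sum.
apply: (@le_trans _ _ (\sum_(j <- s) (j == i)%:R)).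
  apply: ler_sum => j _; rewrite /dlt; case: eqP => _ /=.
    by rewrite mulr1n nrm1 expr1n.
  by rewrite nrm0 expr0n.
have [is_|is_] := boolP (i \in s).
  rewrite (bigD1_seq i) //= eqxx big1 ?addr0 // => j /negbTE -> //.
rewrite big_seq big1 ?ler01 // => j js; case: eqP => // ji.
by move: is_; rewrite -ji js.
Qed.

Definition ebas i : L2H := L2 (dlt_sum2 i).

Lemma ebasE i j : l2f (ebas i) j = (j == i)%:R. Proof. by []. Qed.

Lemma hdot_ebas (x : L2H) i : hdot x (ebas i) = l2f x i.
Proof.
apply: l2dot_eq; apply/nrm_cvgnP => e e0.
have [N hN] := enumer_sub [:: i]; exists N => n /hN sub.
suff -> : l2part x (ebas i) n = l2f x i by rewrite subrr nrm0.
rewrite /l2part (bigD1_seq i) /= ?enumer_uniq ?sub ?mem_head //.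
rewrite /dlt eqxx rmorph1 mulr1 big1 ?addr0 // => j /negbTE h.
by rewrite h rmorph0 mulr0.
Qed.

Lemma nrm_ebas i : nrm (ebas i) = 1.
Proof.
apply/eqP; rewrite -(eqrXn2 (_ : (0 < 2)%N)) ?nrm_ge0 // (@nrm2E _ L2H) hdot_ebas ebasE eqxx.
by rewrite expr1n.
Qed.

Lemma hdot_disjoint (x y : L2H) : (forall i, l2f x i = 0 \/ l2f y i = 0) -> hdot x y = 0.
Proof.
move=> h; apply: l2dot_eq.
suff -> : l2part x y = fun=> 0 by exact: cvg_cst.
apply/funext => n; rewrite /l2part big1 // => i _.
by case: (h i) => ->; rewrite ?mul0r // rmorph0 mulr0.
Qed.

Lemma l2_ext (x y : L2H) : (forall i, l2f x i = l2f y i) -> x = y.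
Proof. by move=> h; apply: val_inj; apply/funext. Qed.

Lemma l2fD (x y : L2H) i : l2f (x + y) i = l2f x i + l2f y i. Proof. by []. Qed.
Lemma l2fZ a (x : L2H) i : l2f (a *: x) i = a * l2f x i. Proof. by []. Qed.

(** An induction principle expressing that the basis vectors span a dense
    subspace: the truncations of x to finite sets of indices converge to x. *)
Lemma l2_ind (P : L2H -> Prop) :
  (forall i, P (ebas i)) -> P 0 -> (forall x y : L2H, P x -> P y -> P (x + y)) ->
  (forall c (x : L2H), P x -> P (c *: x)) ->
  (forall x : L2H, (forall e : R, 0 < e -> exists2 y, P y & nrm (x - y) < e) -> P x) ->
  forall x, P x.
Proof.
move=> Pe P0 PD PZ Pc x; apply: Pc => e e0.
have [N hN] := l2sum_cvg x (exprn_gt0 2 e0); have {hN} /andP [h _] := hN N (leqnn N).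
pose y : L2H := \sum_(i <- enumer N) l2f x i *: ebas i.
have yE j : l2f y j = if j \in enumer N then l2f x j else 0.
  have -> : l2f y j = \sum_(i <- enumer N) l2f x i * (j == i)%:R.
    rewrite /y; elim: (enumer N) => [|i s ih]; first by rewrite !big_nil.
    by rewrite !big_cons -ih.
  case: ifP => hj.
    rewrite (bigD1_seq j) ?enumer_uniq //= eqxx mulr1 big1 ?addr0 // => i /negbTE ij.
    by rewrite eq_sym ij mulr0.
  rewrite big_seq big1 // => i hi; case: eqP => [ji|]; last by rewrite mulr0.
  by move: hj; rewrite ji hi.
exists y.
  by rewrite /y; elim/big_rec: _ => [//|i z _ hz]; apply: PD => //; exact: PZ.
have xy0 : hdot (x - y : L2H) y = 0.
  apply: hdot_disjoint => i.
  have -> : l2f (x - y) i = l2f x i - l2f y i by [].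
  by rewrite !yE; case: ifP => _; rewrite ?subrr; [left|right].
have n2 : nrm x ^+ 2 = nrm (x - y) ^+ 2 + nrm y ^+ 2.
  by rewrite -{1}(subrK y x) (@nrmD2 _ L2H) xy0 /= mulr0 addr0.
have : l2sum x (enumer N) <= nrm y ^+ 2.
  apply: le_trans (l2sum_le y (enumer_uniq N)).
  rewrite le_eqVlt; apply/orP; left; apply/eqP; rewrite /l2sum !big_seq.
  by apply: eq_bigr => i hi; rewrite yE hi.
move=> h'; rewrite -(ltr_pXn2r (_ : (0 < 2)%N)) ?nnegrE ?nrm_ge0 ?ltW //.
by move: h h'; rewrite n2; lra.
Qed.

End L2dot.

(** * Matrices of continuous functions on the circle *)

Section ContCircle.
Variable R : realType.
Notation rc := (real_complex R).
Notation cfun := (circle R -> 'M[C R]_2).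

(** For nonnegative numbers, |a - b|^2 <= |a - b| (a + b) = |a^2 - b^2|. *)
Lemma cont_sqrtC (T : topologicalType) (p : T -> C R) : continuous p -> (forall t, 0 <= p t) ->
  continuous (fun t => sqrtC (p t)).
Proof.
move=> cp p0 t; apply/nrm_contP => e e0.
have /nrm_contP /(_ _ (exprn_gt0 2 e0)) := cp t.
apply: filterS => s hs.
rewrite -(ltr_pXn2r (_ : (0 < 2)%N)) ?nnegrE ?nrm_ge0 ?ltW //.
apply: le_lt_trans hs.
have sE (u : T) : sqrtC (p u) = rc (nrm (sqrtC (p u))).
  by rewrite -nrmE ger0_norm // sqrtC_ge0.
have pE (u : T) : p u = rc (nrm (sqrtC (p u)) ^+ 2).
  by rewrite -{1}(sqrtCK (p u)) {1}sE; rewrite -(rmorphXn (real_complex R)).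
rewrite {1}(sE t) {1}(sE s).
have := pE t; have := pE s.
set a := nrm (sqrtC (p t)); set b := nrm (sqrtC (p s)) => -> ->.
rewrite -!(rmorphB (real_complex R)) !nrm_real.
have a0 : 0 <= a := nrm_ge0 _.
have b0 : 0 <= b := nrm_ge0 _.
rewrite subr_sqr normrM expr2 ler_wpM2l // (ger0_norm (addr_ge0 a0 b0)).
by rewrite ler_norml; apply/andP; split; lra.
Qed.

Lemma conj_continuous : continuous (Num.conj : C R -> C R).
Proof.
move=> z; apply/nrm_contP => e e0.
have /nrm_contP /(_ e e0) : {for z, continuous (fun t : C R => t)} by exact: cvg_id.
by apply: (@filterS _ (nbhs z) (nbhs_filter z)) => t; rewrite -rmorphB nrm_conj.
Qed.

Lemma cont_conj (T : topologicalType) (f : T -> C R) :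
  continuous f -> continuous (fun t => Num.conj (f t)).
Proof. by move=> cf t; apply: continuous_comp (cf t) _; exact: conj_continuous. Qed.

Lemma cont_norm (T : topologicalType) (f : T -> C R) :
  continuous f -> continuous (fun t => `|f t|).
Proof. by move=> cf t; apply: continuous_comp (cf t) _; exact: norm_continuous. Qed.

Lemma cont_add (T : topologicalType) (f g : T -> C R) :
  continuous f -> continuous g -> continuous (fun t => f t + g t).
Proof. by move=> cf cg t; apply: cvgD; [exact: cf|exact: cg]. Qed.

Lemma cont_mul (T : topologicalType) (f g : T -> C R) :
  continuous f -> continuous g -> continuous (fun t => f t * g t).
Proof. by move=> cf cg t; apply: cvgM; [exact: cf|exact: cg]. Qed.

Lemma cont_sub (T : topologicalType) (f g : T -> C R) :
  continuous f -> continuous g -> continuous (fun t => f t - g t).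
Proof. by move=> cf cg t; apply: cvgB; [exact: cf|exact: cg]. Qed.

Lemma cont_cst (T : topologicalType) (c : C R) : continuous (fun _ : T => c).
Proof. by move=> t; exact: cvg_cst. Qed.

Lemma cont_sum (T : topologicalType) (J : Type) (s : seq J) (f : J -> T -> C R) :
  (forall j, continuous (f j)) -> continuous (fun t => \sum_(j <- s) f j t).
Proof.
move=> cf; elim: s => [|j s ih] t.
  by under eq_fun do rewrite big_nil; exact: cvg_cst.
under eq_fun do rewrite big_cons; apply: cvgD; [exact: cf|exact: ih].
Qed.

Lemma M2CTP (F : cfun) : M2CT R F <-> forall i j, continuous (fun t => F t i j).
Proof.
split=> [cF i j t A /= hA|cF t].
  have /cF : nbhs (F t) [set M : 'M[C R]_2 | A (M i j)].
    exists (fun k l => if (k == i) && (l == j) then A else setT) => [k l|M /=].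
      by case: ifP => [/andP [/eqP -> /eqP ->] //|_]; exact: filterT.
    by move/(_ i j); rewrite !eqxx.
  by [].
move=> A /= [P hP hA]; apply: (@filterS _ (nbhs t) _
   [set s | forall k l, P k l (F s k l)]) => [s hs|].
  by apply: hA.
have : forall k l, \forall s \near t, P k l (F s k l).
  by move=> k l; exact: (cF k l t _ (hP k l)).
move=> h.
have : \forall s \near t, forall kl : 'I_2 * 'I_2, P kl.1 kl.2 (F s kl.1 kl.2).
  pose Q (kl : 'I_2 * 'I_2) s := P kl.1 kl.2 (F s kl.1 kl.2).
  have hQ kl : nbhs t (Q kl) by exact: h.
  refine (@filter_forall _ _ Q (nbhs t) (nbhs_filter t) hQ).
by apply: filterS => s hs k l; exact: (hs (k, l)).
Qed.

Definition cadj (F : cfun) : cfun := fun t => (map_mx Num.conj (F t))^T.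
Definition scal (f : circle R -> C R) : cfun := fun t => (f t)%:M.

Lemma M2CT_D F G : M2CT R F -> M2CT R G -> M2CT R (F + G).
Proof.
move=> /M2CTP hF /M2CTP hG; apply/M2CTP => i j.
under eq_fun do rewrite fctE mxE.
by apply: cont_add; [exact: (hF i j)|exact: (hG i j)].
Qed.
Lemma M2CT_Z c F : M2CT R F -> M2CT R (c *: F).
Proof.
move=> /M2CTP hF; apply/M2CTP => i j; under eq_fun do rewrite fctE mxE.
by apply: cont_mul; [exact: cont_cst|exact: (hF i j)].
Qed.
Lemma M2CT_M F G : M2CT R F -> M2CT R G -> M2CT R (F * G).
Proof.
move=> /M2CTP hF /M2CTP hG; apply/M2CTP => i j.
under eq_fun do rewrite fctE mxE.
by apply: cont_sum => k; apply: (@cont_mul _ (fun t => F t i k) (fun t => G t k j)); [exact: (hF i k)|exact: (hG k j)].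
Qed.
Lemma M2CT_adj F : M2CT R F -> M2CT R (cadj F).
Proof.
move=> /M2CTP hF; apply/M2CTP => i j; under eq_fun do rewrite !mxE.
exact: (cont_conj (hF j i)).
Qed.
Lemma M2CT_cst A : M2CT R (fun=> A).
Proof. by apply/M2CTP => i j; exact: cont_cst. Qed.
Lemma M2CT_0 : M2CT R 0.
Proof. have -> : 0 = (fun=> 0) :> cfun by []; exact: M2CT_cst. Qed.
Lemma M2CT_1 : M2CT R 1.
Proof. have -> : 1 = (fun=> 1) :> cfun by []; exact: M2CT_cst. Qed.
Lemma M2CT_scal f : continuous f -> M2CT R (scal f).
Proof.
move=> cf; apply/M2CTP => i j; under eq_fun do rewrite mxE mulrb.
by case: (i == j); [exact: cf|exact: cont_cst].
Qed.
Lemma M2CT_sum (J : Type) (s : seq J) (F : J -> cfun) :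
  (forall j, M2CT R (F j)) -> M2CT R (\sum_(j <- s) F j).
Proof.
move=> hF; elim/big_rec: _ => [|j G _]; first exact: M2CT_0.
exact: M2CT_D.
Qed.
End ContCircle.
(* Unification would otherwise unfold membership in M_2(C(T)) to inclusions of
   neighbourhood filters. *)
Opaque M2CT.

(** * Star representations of M_2(C(T)) *)

Section StarRep.
Variable R : realType.
Notation rc := (real_complex R).
Notation cfun := (circle R -> 'M[C R]_2).

(** Injectivity is left out so that the evaluations at points of the circle are
    covered. *)
Definition star_rep (H : hilbertType R) (pi : cfun -> (H -> H)) : Prop :=
  [/\ forall F, M2CT R F -> bounded_operator (pi F),
      [/\ forall F G, M2CT R F -> M2CT R G -> pi (F + G) = pi F + pi G,
          forall (c : C R) F, M2CT R F -> pi (c *: F) = c *: pi F,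
          forall F G, M2CT R F -> M2CT R G -> pi (F * G) = pi F \o pi G &
          pi 1 = idfun] &
      forall F, M2CT R F -> is_adjoint (pi F) (pi (cadj F))].

Section One.
Variables (H : hilbertType R) (pi : cfun -> (H -> H)).
Hypothesis hpi : star_rep pi.

Let piD F G x : M2CT R F -> M2CT R G -> pi (F + G) x = pi F x + pi G x.
Proof. by move=> hF hG; have [_ [-> //]] := hpi. Qed.
Let piM F G x : M2CT R F -> M2CT R G -> pi (F * G) x = pi F (pi G x).
Proof. by move=> hF hG; have [_ [_ _ -> //]] := hpi. Qed.
Let pi_adj F x y : M2CT R F -> hdot (pi F x) y = hdot x (pi (cadj F) y).
Proof. by move=> hF; have [_ _ ->] := hpi. Qed.

Lemma star_rep0 x : pi 0 x = 0.
Proof.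
have [_ [_ /(_ 0 0) h _ _] _] := hpi; have := h (@M2CT_0 R).
by rewrite !scale0r => ->.
Qed.

Lemma star_rep_sum (J : Type) (s : seq J) (F : J -> cfun) x : (forall j, M2CT R (F j)) ->
  pi (\sum_(j <- s) F j) x = \sum_(j <- s) pi (F j) x.
Proof.
move=> hF; elim: s => [|j s ih]; first by rewrite !big_nil star_rep0.
by rewrite !big_cons piD ?ih //; exact: M2CT_sum.
Qed.

Lemma star_rep_sq F x : M2CT R F -> hdot (pi (cadj F * F) x) x = rc (nrm (pi F x) ^+ 2).
Proof.
move=> hF; have mF := M2CT_adj hF.
have E := pi_adj x (pi F x) hF.
by rewrite (piM x mF hF) [LHS]hdotC -E -hdotC hdotxx.
Qed.

(** M^2 - |f|^2 is the square of the continuous function g, so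
    M^2 |x|^2 - |pi(f) x|^2 = |pi(g) x|^2 is nonnegative. *)
Lemma star_rep_scal f M x : continuous f -> 0 <= M -> (forall t, nrm (f t) <= M) ->
  nrm (pi (scal f) x) <= M * nrm x.
Proof.
move=> cf M0 hM.
pose g t : C R := sqrtC (rc (M ^+ 2) - f t * Num.conj (f t)).
have p0 t : 0 <= rc (M ^+ 2) - f t * Num.conj (f t).
  rewrite -nrm_sq -(rmorphB (real_complex R)) -(rmorph0 (real_complex R)) rc_le.
  by rewrite subr_ge0 ler_pXn2r ?nnegrE ?nrm_ge0.
have cg : continuous g.
  apply: cont_sqrtC; last exact: p0.
  have c1 := cont_mul cf (cont_conj cf : continuous _).
  have c0 : continuous (fun _ : circle R => rc (M ^+ 2) : C R) by exact: cont_cst.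
  by have c2 := cont_sub c0 c1; exact: c2.
have E : cadj (scal g) * scal g + cadj (scal f) * scal f = (rc (M ^+ 2) : C R) *: (1 : cfun).
  apply/funext => t; rewrite !fctE /cadj /scal !map_scalar_mx !tr_scalar_mx.
  rewrite -!mulmxE -!scalar_mxM -raddfD /= scale_scalar_mx mulr1; congr (_%:M).
  have -> : Num.conj (g t) = g t by rewrite conj_Creal // ger0_real // sqrtC_ge0.
  by rewrite -expr2 sqrtCK mulrC [Num.conj _ * _]mulrC subrK.
have mg := M2CT_scal cg; have mf := M2CT_scal cf.
have := congr1 (fun F => hdot (pi F x) x) E.
rewrite (piD _ (M2CT_M (M2CT_adj mg) mg) (M2CT_M (M2CT_adj mf) mf)) hdotDl.
rewrite (star_rep_sq _ mg) (star_rep_sq _ mf).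
have [_ [_ /(_ (rc (M ^+ 2)) _ (@M2CT_1 R)) -> _ ->] _] := hpi.
rewrite fctE /= hdotZl hdotxx -(rmorphD (real_complex R)).
rewrite -[X in _ = X -> _](rmorphM (real_complex R)) => /rc_inj h.
rewrite -(ler_pXn2r (_ : (0 < 2)%N)) ?nnegrE ?mulr_ge0 ?nrm_ge0 //.
by rewrite exprMn -h lerDr sqr_ge0.
Qed.

Variable n : nat.
Implicit Types A B : 'M[cfun]_n.

Definition entries_cont A := forall i j, M2CT R (A i j).
(** The action on H^n of an n by n matrix over M_2(C(T)), through [pi]. *)
Definition mapp A (x : 'I_n -> H) := app (map_mx pi A) x.
Definition madj A : 'M[cfun]_n := \matrix_(i, j) cadj (A j i).

Lemma entries_adj A : entries_cont A -> entries_cont (madj A).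
Proof. by move=> hA i j; rewrite mxE; exact: M2CT_adj. Qed.
Lemma entries_mul A B : entries_cont A -> entries_cont B -> entries_cont (A *m B).
Proof. by move=> hA hB i j; rewrite mxE; apply: M2CT_sum => k; exact: M2CT_M. Qed.

Lemma mapp_bop A : entries_cont A -> forall i j, bounded_operator (map_mx pi A i j).
Proof. by move=> hA i j; rewrite mxE; have [h _ _] := hpi; exact: h. Qed.

Lemma mapp_mul A B x : entries_cont A -> entries_cont B ->
  mapp (A *m B) x = mapp A (mapp B x).
Proof.
move=> hA hB; apply/funext => i; rewrite /mapp /app.
under eq_bigr => j _.
  rewrite mxE mxE star_rep_sum; last by move=> k; exact: M2CT_M.
  over.
rewrite exchange_big /=; apply: eq_bigr => k _; rewrite mxE.
have lA : linear (pi (A i k)) by have [h _ _] := hpi; exact: bop_lin (h _ (hA i k)).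
rewrite (lin_sum lA); apply: eq_bigr => j _.
by rewrite mxE piM.
Qed.

Lemma mapp_adj A x y : entries_cont A -> ip (mapp A x) y = ip x (mapp (madj A) y).
Proof.
move=> hA; rewrite /ip /mapp /app.
under eq_bigr do rewrite hdot_suml.
rewrite exchange_big /=; apply: eq_bigr => j _; rewrite hdot_sumr.
by apply: eq_bigr => i _; rewrite !mxE pi_adj.
Qed.

(** Half of the C-star identity: |A x|^2 = (x, A' A x). *)
Lemma mapp_sq A x : entries_cont A ->
  hnorm (mapp A x) ^+ 2 <= hnorm x * hnorm (mapp (madj A *m A) x).
Proof.
move=> hA; have E := mapp_adj x (mapp A x) hA.
rewrite -[leLHS]Re_rc -ipxx E -(mapp_mul x (entries_adj hA) hA).
exact: Re_ip_le.
Qed.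

Lemma mapp_adj_le A M : entries_cont A -> 0 <= M ->
  (forall x, hnorm (mapp A x) <= M * hnorm x) ->
  forall x, hnorm (mapp (madj A) x) <= M * hnorm x.
Proof.
move=> hA M0 hM x; set y := mapp (madj A) x.
have E := mapp_adj y x hA; rewrite -/y in E.
have : hnorm y ^+ 2 <= M * hnorm y * hnorm x.
  rewrite -[leLHS]Re_rc -ipxx -E; apply: le_trans (Re_ip_le _ _) _.
  by rewrite ler_wpM2r ?hnorm_ge0.
have [-> _|hn] := eqVneq (hnorm y) 0; first by rewrite mulr_ge0 // hnorm_ge0.
rewrite expr2 [M * _]mulrC -mulrA ler_pM2l //.
by rewrite lt_neqAle eq_sym hn hnorm_ge0.
Qed.

(** A bound with a constant that depends on the representation.  Each entry is a
    sum of four products of a scalar function with a constant matrix unit; the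
    scalar functions are controlled by [star_rep_scal]. *)
Lemma mapp_le_entries : exists2 K : R, 0 <= K & forall A N, entries_cont A -> 0 <= N ->
  (forall i j t a b, nrm (A i j t a b) <= N) ->
  forall x, hnorm (mapp A x) <= K * N * hnorm x.
Proof.
have hE (ab : 'I_2 * 'I_2) : exists K, 0 <= K /\ lip K (pi (fun=> delta_mx ab.1 ab.2)).
  have [h _ _] := hpi; have [K ? ?] := bop_lip (h _ (M2CT_cst (A := delta_mx ab.1 ab.2))).
  by exists K.
have [K hK] := choice hE.
pose K1 := \sum_a \sum_b K (a, b).
have K10 : 0 <= K1 by apply: sumr_ge0 => a _; apply: sumr_ge0 => b _; have [] := hK (a, b).
exists (n%:R * n%:R * K1); first by rewrite !mulr_ge0.
move=> A N hA N0 hN x.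
have hF (F : cfun) y : M2CT R F -> (forall t a b, nrm (F t a b) <= N) ->
    nrm (pi F y) <= K1 * N * nrm y.
  move=> cF bF; have /M2CTP eF := cF.
  have -> : F = \sum_a \sum_b scal (fun t => F t a b) * (fun=> delta_mx a b).
    apply/funext => t; rewrite [LHS]matrix_sum_delta fct_sumE; apply: eq_bigr => a _.
    rewrite fct_sumE; apply: eq_bigr => b _; rewrite fctE /scal.
    by rewrite -mulmxE mul_scalar_mx.
  rewrite star_rep_sum => [|a]; last first.
    by apply: M2CT_sum => b; apply: M2CT_M; [exact: M2CT_scal|exact: M2CT_cst].
  apply: le_trans (nrm_sum _ _ _) _; rewrite /K1 !mulr_suml; apply: ler_sum => a _.
  rewrite star_rep_sum => [|b]; last first.
    by apply: M2CT_M; [exact: M2CT_scal|exact: M2CT_cst].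
  apply: le_trans (nrm_sum _ _ _) _; rewrite !mulr_suml; apply: ler_sum => b _.
  rewrite piM; [|exact: M2CT_scal|exact: M2CT_cst].
  apply: le_trans (star_rep_scal _ (eF a b) N0 (fun t => bF t a b)) _.
  by rewrite mulrAC [leLHS]mulrC ler_wpM2r //; have [_ hl] := hK (a, b); exact: hl.
apply: le_trans (hnorm_le_sum _) _.
apply: (@le_trans _ _ (\sum_(i < n) \sum_(j < n) K1 * N * hnorm x)).
  apply: ler_sum => i _; apply: le_trans (nrm_sum _ _ _) _; apply: ler_sum => j _.
  rewrite mxE; apply: le_trans (hF _ _ (hA i j) _) _; first by move=> *; exact: hN.
  by rewrite ler_wpM2l ?mulr_ge0 // nrm_le_hnorm.
rewrite !sumr_const !card_ord -[X in X *+ n]mulr_natr -mulr_natr.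
by rewrite le_eqVlt; apply/orP; left; apply/eqP; ring.
Qed.

End One.

End StarRep.

(** * Comparison of norms through point evaluations *)

Section Fin.
Variables (R : realType) (I : finType).
Lemma fin_summable (x : I -> C R) : x \in @summable2 R I.
Proof.
apply/summable2P; exists (\sum_i nrm (x i) ^+ 2) => s us.
rewrite /l2sum [leRHS](bigID (mem s)) /= -(big_uniq _ us) /=.
by rewrite lerDl sumr_ge0 // => i _; exact: sqr_ge0.
Qed.
(** C^I as an instance of the space of square summable families. *)
Definition finl2 (x : I -> C R) : L2H R I := L2 (fin_summable x).

Lemma fin_expand (x : L2H R I) : x = \sum_i l2f x i *: ebas R i.
Proof.
apply: l2_ext => j.
have -> : l2f (\sum_i l2f x i *: ebas R i) j = \sum_i l2f x i * (j == i)%:R.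
  by elim/big_rec2: _ => [//|i a b _ <-].
by rewrite (bigD1 j) //= eqxx mulr1 big1 ?addr0 // => i /negbTE h; rewrite eq_sym h mulr0.
Qed.

Lemma fin_hdot (x y : L2H R I) : hdot x y = \sum_i l2f x i * Num.conj (l2f y i).
Proof.
rewrite {1}(fin_expand x) hdot_suml; apply: eq_bigr => i _.
by rewrite hdotZl [hdot (ebas R i) y]hdotC hdot_ebas.
Qed.

Lemma fin_dim : finite_dimensional (L2H R I).
Proof.
exists #|I|, (fun k => ebas R (enum_val k)) => x.
exists (fun k => l2f x (enum_val k)).
rewrite {1}(fin_expand x).
rewrite -(big_enum_val (fun i => l2f x i *: ebas R i)) /=.
by apply: eq_bigl => i; rewrite inE.
Qed.
End Fin.

Section Ev.
Variable R : realType.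
Notation rc := (real_complex R).
Notation cfun := (circle R -> 'M[C R]_2).
Notation C2 := (L2H R 'I_2).

(** Evaluation at the point t, as an operator on C^2. *)
Definition ev (t : circle R) (F : cfun) (x : C2) : C2 :=
  finl2 (fun k => \sum_l F t k l * l2f x l).

Lemma evE t F x k : l2f (ev t F x) k = \sum_l F t k l * l2f x l.
Proof. by []. Qed.

Lemma ev_bounded t F : bounded_operator (ev t F).
Proof.
pose K : R := \sum_k \sum_l nrm (F t k l).
apply: (@lip_bop _ _ _ K).
- move=> a x y; apply: l2_ext => k.
  rewrite l2fD l2fZ !evE mulr_sumr -big_split; apply: eq_bigr => l _.
  by rewrite l2fD l2fZ mulrDr mulrCA.
- by do 2 (apply: sumr_ge0 => ? _); exact: nrm_ge0.
move=> x; rewrite [in leLHS](fin_expand (ev t F x)).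
apply: le_trans (nrm_sum _ _ _) _; rewrite /K mulr_suml; apply: ler_sum => k _.
rewrite nrmZ.
have -> : nrm (ebas R k) = 1.
  exact: nrm_ebas.
rewrite mulr1 /=; apply: le_trans (nrm_sum _ _ _) _.
rewrite mulr_suml; apply: ler_sum => l _.
rewrite nrmM ler_wpM2l ?nrm_ge0 //; exact: nrm_coord.
Qed.

Lemma ev_star t : star_rep (ev t).
Proof.
split=> [F _||F _ x y]; first exact: ev_bounded.
- split=> [F G _ _|c F _|F G _ _|].
  + apply/funext => x; apply: l2_ext => k.
    rewrite [in RHS]fctE l2fD !evE -big_split; apply: eq_bigr => l _.
    by rewrite fctE mxE mulrDl.
  + apply/funext => x; apply: l2_ext => k.
    rewrite [in RHS]fctE l2fZ !evE mulr_sumr; apply: eq_bigr => l _.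
    by rewrite fctE mxE mulrA.
  + apply/funext => x; apply: l2_ext => k; rewrite [in RHS]/comp !evE.
    under eq_bigr do rewrite fctE mxE mulr_suml.
    rewrite exchange_big; apply: eq_bigr => l _.
    by rewrite evE mulr_sumr; apply: eq_bigr => m _; rewrite mulrA.
  + apply/funext => x; apply: l2_ext => k /=.
    rewrite (bigD1 k) //= mxE eqxx mul1r big1 ?addr0 // => l /negbTE h.
    by rewrite mxE eq_sym h mul0r.
rewrite !fin_hdot /=.
under eq_bigr do rewrite mulr_suml.
rewrite exchange_big; apply: eq_bigr => l _ /=.
rewrite rmorph_sum mulr_sumr; apply: eq_bigr => k _.
by rewrite !mxE rmorphM /= conjCK mulrAC mulrC mulrA.
Qed.

(** A constant factor disappears in the limit of 2^k-th roots; by Bernoulli's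
    inequality a / b > 1 would make the quotient of the powers unbounded. *)
Lemma le_of_pow2_le (a b K : R) : 0 <= a -> 0 <= b -> 0 <= K ->
  (forall k, a ^+ (2 ^ k) <= K * b ^+ (2 ^ k)) -> a <= b.
Proof.
move=> a0 b0 K0 h; rewrite leNgt; apply/negP => ba.
have ap : 0 < a by apply: le_lt_trans ba.
have [bz|bn] := eqVneq b 0.
  by have := h 0%N; rewrite expn0 !expr1 bz mulr0 leNgt ap.
have bp : 0 < b by rewrite lt_neqAle eq_sym bn.
pose d := a / b - 1.
have d0 : 0 < d by rewrite subr_gt0 ltr_pdivlMr // mul1r.
have hk k : (2 ^ k)%:R * d <= K.
  have hp : (1 + d) ^+ (2 ^ k) <= K.
    have -> : 1 + d = a / b by rewrite /d addrC subrK.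
    by rewrite expr_div_n ler_pdivrMr ?exprn_gt0.
  apply: le_trans hp.
  suff hb m : 1 + m%:R * d <= (1 + d) ^+ m by apply: le_trans (hb _); rewrite lerDr.
  elim: m => [|m ih]; first by rewrite mul0r addr0 expr0.
  rewrite exprS; apply: (@le_trans _ _ ((1 + d) * (1 + m%:R * d))).
    rewrite -natr1; have := mulr_ge0 (ler0n R m) (sqr_ge0 d); nra.
  by rewrite ler_wpM2l // addr_ge0 // ltW.
have [m hm] : exists m : nat, K / d < m%:R by exists (Num.bound (K / d)); rewrite archi_boundP // divr_ge0 // ltW.
have := hk m; rewrite leNgt => /negP; apply.
rewrite -ltr_pdivrMr //; apply: lt_trans hm _.
by rewrite ltr_nat; exact: ltn_expl.
Qed.

Section Upper.
Variables (H : hilbertType R) (pi : cfun -> (H -> H)).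
Hypothesis hpi : star_rep pi.
Variable n : nat.

(** An entry is a coefficient of A(t) between unit vectors. *)
Lemma mapp_entry_le (A : 'M[cfun]_n) M : 0 <= M -> (forall t v, hnorm (mapp (ev t) A v) <= M * hnorm v) ->
  forall i j t a b, nrm (A i j t a b) <= M.
Proof.
move=> M0 hM i j t a b.
pose v k : C2 := if k == j then ebas R b else 0.
have hv : hnorm v = 1.
  apply/eqP; rewrite -(eqrXn2 (_ : (0 < 2)%N)) ?hnorm_ge0 // hnorm2.
  rewrite (bigD1 j) //= big1 ?addr0.
    have -> : nrm (v j) = 1 by rewrite /v eqxx; exact: nrm_ebas.
    by rewrite expr1n.
  by move=> k /negbTE kj; rewrite /v kj nrm0 expr0n.
have := hM t v; rewrite hv mulr1; apply: le_trans.
have E : l2f (mapp (ev t) A v i) a = A i j t a b.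
  rewrite /mapp /app (bigD1 j) //= big1 ?addr0.
    rewrite mxE /v eqxx /= (bigD1 b) //= /dlt eqxx mulr1 big1 ?addr0 // => l /negbTE h.
    by rewrite h mulr0.
  by move=> k /negbTE kj; rewrite mxE /v kj (lin0 (bop_lin (ev_bounded _ _))).
rewrite -E; apply: le_trans (nrm_le_hnorm _ i); exact: nrm_coord.
Qed.

(** With B_0 = A and B_(k+1) = B_k' B_k, the numbers q_k = |B_k x| satisfy
    q_k^2 <= |x| q_(k+1), while B_k is bounded by M^(2^k) at every point, hence
    q_k <= K M^(2^k) |x| with K independent of k. *)
Theorem star_rep_le (A : 'M[cfun]_n) M : entries_cont A -> 0 <= M ->
  (forall t v, hnorm (mapp (ev t) A v) <= M * hnorm v) ->
  forall x, hnorm (mapp pi A x) <= M * hnorm x.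
Proof.
move=> hA M0 hM x.
pose B := fix B k : 'M[cfun]_n := if k is k'.+1 then madj (B k') *m B k' else A.
have cB k : entries_cont (B k).
  elim: k => [|k ih]; first exact: hA.
  exact: (entries_mul (entries_adj ih) ih).
have bB k : forall t v, hnorm (mapp (ev t) (B k) v) <= M ^+ (2 ^ k) * hnorm v.
  elim: k => [|k ih] t v; first by rewrite expn0 expr1; exact: hM.
  rewrite /= (mapp_mul (ev_star t) v (entries_adj (cB k)) (cB k)).
  have Mk : 0 <= M ^+ (2 ^ k) by exact: exprn_ge0.
  apply: le_trans (mapp_adj_le (ev_star t) (cB k) Mk (ih t) _) _.
  by rewrite expnS mul2n -addnn exprD -mulrA ler_wpM2l.
have [K K0 hK] := mapp_le_entries hpi n.
pose q k := hnorm (mapp pi (B k) x).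
have q0 k : 0 <= q k by exact: hnorm_ge0.
have qK k : q k <= K * M ^+ (2 ^ k) * hnorm x.
  have Mk : 0 <= M ^+ (2 ^ k) by exact: exprn_ge0.
  exact: (hK _ _ (cB k) Mk (mapp_entry_le Mk (bB k)) x).
have qS k : q k ^+ 2 <= hnorm x * q k.+1 by exact: (mapp_sq hpi x (cB k)).
rewrite -/(q 0%N).
have h0 : 0 <= hnorm x := hnorm_ge0 x.
have [hx|hx] := eqVneq (hnorm x) 0.
  by have := qK 0%N; rewrite hx !mulr0.
have hp : 0 < hnorm x by rewrite lt_neqAle eq_sym hx.
rewrite -ler_pdivrMr //.
apply: (@le_of_pow2_le _ _ K) => // [|k]; first by rewrite divr_ge0.
apply: (@le_trans _ _ (q k / hnorm x)); last by rewrite ler_pdivrMr.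
elim: k => [|k ih]; first by rewrite expn0 expr1.
rewrite expnS mulnC exprM.
apply: (@le_trans _ _ ((q k / hnorm x) ^+ 2)).
  by rewrite ler_pXn2r ?nnegrE ?exprn_ge0 ?divr_ge0.
rewrite expr_div_n ler_pdivrMr ?exprn_gt0 // mulrAC ler_pdivlMr //.
by rewrite [hnorm x ^+ 2]expr2 mulrA ler_pM2r // mulrC; exact: qS.
Qed.
End Upper.
End Ev.

Section Lower.
Variable R : realType.
Notation rc := (real_complex R).
Notation cfun := (circle R -> 'M[C R]_2).
Notation C2 := (L2H R 'I_2).
Variables (K : hilbertType R) (rho : cfun -> (K -> K)).
Hypothesis hrho : star_rep rho.
Hypothesis rho_inj : forall F G, M2CT R F -> M2CT R G -> rho F = rho G -> F = G.

(** The matrix with first column w and second column 0, which embeds the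
    vectors of C^2 in the algebra of matrices. *)
Definition col0 (w : 'I_2 -> C R) : 'M[C R]_2 := \matrix_(a, b) (w a *+ (b == 0)).

Lemma mul_col0 (M : 'M[C R]_2) w : M * col0 w = col0 (fun a => \sum_b M a b * w b).
Proof.
apply/matrixP => a b; rewrite !mxE -sumrMnl; apply: eq_bigr => c _.
by rewrite mxE mulrnAr.
Qed.

Lemma col0_sq w : (map_mx Num.conj (col0 w))^T * col0 w
  = (\sum_a w a * Num.conj (w a)) *: delta_mx 0 0.
Proof.
apply/matrixP => a b; rewrite !mxE.
under eq_bigr => c _ do rewrite !mxE.
case: (a == 0); case: (b == 0); rewrite ?mulr1 ?mulr0.
- by apply: eq_bigr => c _; rewrite mulrC.
- by rewrite big1 // => c _; rewrite mulr0.
- by rewrite big1 // => c _; rewrite mulr0n rmorph0 mul0r.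
- by rewrite big1 // => c _; rewrite mulr0.
Qed.

Lemma M2CT_mul (p : circle R -> C R) (M : 'M[C R]_2) :
  continuous p -> M2CT R (fun t => p t *: M).
Proof.
move=> cp; apply/M2CTP => i j; under eq_fun do rewrite mxE.
by apply: cont_mul; [exact: cp|exact: cont_cst].
Qed.

Variable n : nat.

(** Suppose that c is the norm of rho(A) and |A(t0) v| > c |v|.  Let p be the
    positive part of |A v|^2 - c^2 |v|^2, let X be the column of matrices with
    entries p v_j in the first column, and Y = A X.  Then
    Y' Y = p^3 E_00 + c^2 X' X, and |rho(Y) x| <= c |rho(X) x| forces
    rho(p^(3/2) E_00) = 0, which contradicts p(t0) > 0 by faithfulness. *)
Lemma star_rep_ge (A : 'M[cfun]_n) : entries_cont A ->
  forall t v, hnorm (mapp (ev t) A v) <= opnorm (map_mx rho A) * hnorm v.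
Proof.
move=> hA t0 v.
have hb := mapp_bop hrho hA.
set c := opnorm _.
have c0 : 0 <= c := opnorm_ge0 hb.
set h := hnorm v; have h0 : 0 <= h := hnorm_ge0 v.
rewrite leNgt; apply/negP => lt.
(* U t is the vector A(t) v. *)
pose U t i a := \sum_j \sum_b A i j t a b * l2f (v j) b.
have UE t i a : l2f (mapp (ev t) A v i) a = U t i a.
  rewrite /mapp /app /U; under eq_bigr do rewrite mxE.
  by elim/big_rec2: _ => [//|j x y _ <-]; rewrite l2fD evE.
have USE t : \sum_i \sum_a U t i a * Num.conj (U t i a) = rc (hnorm (mapp (ev t) A v) ^+ 2).
  rewrite -ipxx; apply: eq_bigr => i _; rewrite fin_hdot; apply: eq_bigr => a _.
  by rewrite UE.
have cU i a : continuous (fun t => U t i a).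
  apply: cont_sum => j; apply: cont_sum => b; apply: cont_mul; last exact: cont_cst.
  by have /M2CTP := hA i j; apply.
pose q t : C R := \sum_i \sum_a U t i a * Num.conj (U t i a) - rc (c ^+ 2 * h ^+ 2).
have cq : continuous q.
  apply: cont_sub; last exact: cont_cst.
  apply: cont_sum => i; apply: cont_sum => a; apply: cont_mul; first exact: cU.
  by apply: cont_conj; exact: cU.
(* q, p and s take real values; qr and pr are q and p in R, where the
   maximum and the final inequalities live. *)
pose qr t : R := hnorm (mapp (ev t) A v) ^+ 2 - c ^+ 2 * h ^+ 2.
have qE t : q t = rc (qr t) by rewrite /q USE -(rmorphB (real_complex R)).
pose p t : C R := 2^-1 * (`|q t| + q t).
have cp : continuous p.
  apply: cont_mul; first exact: cont_cst.
  by apply: cont_add; [exact: cont_norm|exact: cq].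
pose pr t : R := Num.max 0 (qr t).
have pE t : p t = rc (pr t).
  rewrite /p qE.
  have -> : `|rc (qr t) : C R| = rc `|qr t|.
    by rewrite normc_def /= expr0n addr0 sqrtr_sqr.
  have -> : (2^-1 : C R) = rc 2^-1 by rewrite fmorphV rmorphMn rmorph1.
  rewrite -(rmorphD (real_complex R)) -(rmorphM (real_complex R)); congr rc.
  rewrite /pr maxEle; case: ifP => hq; first by rewrite ger0_norm // -mulr2n -(mulr_natl (qr t)) mulKf.
  by rewrite ltr0_norm ?addNr ?mulr0 // ltNge hq.
have pr0 t : 0 <= pr t by rewrite le_max lexx.
have p0 t : 0 <= p t by rewrite pE -(rmorph0 (real_complex R)) rc_le.
clearbody p.
pose s t : C R := p t * sqrtC (p t).
have cs : continuous s.
  by apply: cont_mul; [exact: cp|apply: cont_sqrtC; [exact: cp|exact: p0]].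
pose X j : cfun := fun t => p t *: col0 (l2f (v j)).
have mX j : M2CT R (X j) by exact: M2CT_mul.
pose G : cfun := fun t => s t *: delta_mx 0 0.
have mG : M2CT R G by exact: M2CT_mul.
pose Y i : cfun := \sum_j A i j * X j.
have mY i : M2CT R (Y i) by apply: M2CT_sum => j; exact: (M2CT_M (hA i j) (mX j)).
have YE i t : Y i t = p t *: col0 (U t i).
  rewrite /Y fct_sumE.
  have -> : col0 (U t i) = \sum_j A i j t * col0 (l2f (v j)).
    under eq_bigr do rewrite mul_col0.
    by apply/matrixP => a b; rewrite summxE mxE /U -sumrMnl; apply: eq_bigr => j _; rewrite mxE.
  rewrite scaler_sumr; apply: eq_bigr => j _.
  by rewrite fctE /X -!mulmxE scalemxAr.
have adjZ (a : C R) w : (map_mx Num.conj (a *: col0 w))^T * (a *: col0 w)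
    = (a * Num.conj a * \sum_b w b * Num.conj (w b)) *: delta_mx 0 0.
  rewrite map_mxZ linearZ /= -!mulmxE -scalemxAl -scalemxAr mulmxE col0_sq.
  by rewrite !scalerA; congr (_ *: _); ring.
(* s^2 = p^3 and p^2 (q - p) = 0 give the identity pointwise. *)
have id : \sum_i cadj (Y i) * Y i
    = cadj G * G + (rc (c ^+ 2) : C R) *: \sum_j cadj (X j) * X j.
  apply/funext => t.
  transitivity (cadj G t * G t + (rc (c ^+ 2) : C R) *: (\sum_j cadj (X j) * X j) t); last by [].
  rewrite !fct_sumE.
  under eq_bigr => i _ do rewrite fctE /cadj YE adjZ.
  under [in RHS]eq_bigr => j _ do rewrite fctE /cadj /X adjZ.
  rewrite -!scaler_suml -!mulr_sumr USE /cadj /G.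
  have -> : delta_mx 0 0 = col0 (fun a => (a == 0)%:R).
    by apply/matrixP => a b; rewrite !mxE -mulrnA mulnb.
  rewrite [in RHS]adjZ.
  have -> : col0 (fun a => (a == 0)%:R) = delta_mx 0 0.
    by apply/matrixP => a b; rewrite !mxE -mulrnA mulnb.
  have -> : \sum_(b < 2) (b == 0)%:R * (Num.conj (b == 0)%:R) = 1 :> C R.
    rewrite (bigD1 0) //= rmorph_nat mulr1n mulr1 big1 ?addr0 // => b /negbTE ->.
    by rewrite mul0r.
  rewrite scalerA -scalerDl; congr (_ *: _).
  have -> : \sum_j \sum_b l2f (v j) b * Num.conj (l2f (v j) b) = rc (h ^+ 2).
    by rewrite -ipxx; apply: eq_bigr => j _; rewrite fin_hdot.
  have cpE : Num.conj (p t) = p t by rewrite conj_Creal // ger0_real.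
  have s0 : 0 <= s t by rewrite mulr_ge0 // sqrtC_ge0.
  have csE : Num.conj (s t) = s t by rewrite conj_Creal // ger0_real.
  rewrite csE cpE mulr1 /s mulrACA -[sqrtC _ * _]expr2 sqrtCK -!expr2.
  rewrite pE; rewrite -!(rmorphXn (real_complex R)) -!(rmorphM (real_complex R)).
  rewrite -(rmorphD (real_complex R)); congr rc.
  have : pr t ^+ 2 * (qr t - pr t) = 0.
    rewrite /pr maxEle; case: ifP => _; first by rewrite subrr mulr0.
    by rewrite expr0n mul0r.
  rewrite /qr; set z := hnorm _; set w := pr t; lra.
have key x : nrm (rho G x) = 0.
  have := congr1 (fun F => hdot (rho F x) x) id.
  have mYY i : M2CT R (cadj (Y i) * Y i) by exact: (M2CT_M (M2CT_adj (mY i)) (mY i)).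
  have mXX j : M2CT R (cadj (X j) * X j) by exact: (M2CT_M (M2CT_adj (mX j)) (mX j)).
  have mGG : M2CT R (cadj G * G) by exact: (M2CT_M (M2CT_adj mG) mG).
  have mS : M2CT R (\sum_j cadj (X j) * X j) by exact: M2CT_sum.
  have [_ [rD rZ rM _] _] := hrho.
  rewrite (star_rep_sum hrho _ _ mYY) (rD _ _ mGG (M2CT_Z mS)) (rZ _ _ mS).
  rewrite hdot_suml fctE hdotDl fctE hdotZl (star_rep_sum hrho _ _ mXX) hdot_suml.
  under eq_bigr => i _ do rewrite (star_rep_sq hrho x (mY i)).
  under [in RHS]eq_bigr => i _ do rewrite (star_rep_sq hrho x (mX i)).
  rewrite (star_rep_sq hrho x mG) -!(rmorph_sum (real_complex R)).
  rewrite -(rmorphM (real_complex R)) -(rmorphD (real_complex R)) => /rc_inj.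
  have := opnorm_ge hb (fun j => rho (X j) x); rewrite -/c.
  have -> : app (map_mx rho A) (fun j => rho (X j) x) = fun i => rho (Y i) x.
    apply/funext => i; rewrite /app (star_rep_sum hrho); last first.
      by move=> j; exact: (M2CT_M (hA i j) (mX j)).
    by apply: eq_bigr => j _; rewrite mxE (rM _ _ (hA i j) (mX j)).
  rewrite -(ler_pXn2r (_ : (0 < 2)%N)) ?nnegrE ?mulr_ge0 ?hnorm_ge0 //.
  rewrite exprMn !hnorm2 => h1 h2; apply/eqP; rewrite -sqrf_eq0 eq_le sqr_ge0 andbT.
  move: h1; rewrite h2; lra.
have G0 : G = 0.
  apply: rho_inj; [exact: mG|exact: M2CT_0|].
  by apply/funext => x; rewrite (star_rep0 hrho); exact: nrm_eq0.
have E1 : G t0 0 0 = s t0 by rewrite /G !mxE mulr1.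
have E2 : (0 : cfun) t0 0 0 = 0 by rewrite -[(0 : cfun) t0]/0 mxE.
move: E1; rewrite G0 E2 /s => /esym/eqP.
rewrite mulf_eq0 sqrtC_eq0 orbb pE => /eqP /rc_inj.
rewrite /pr maxEle => hq.
have qpos : 0 < qr t0.
  by rewrite subr_gt0 -exprMn ltr_pXn2r ?nnegrE ?mulr_ge0 ?hnorm_ge0.
by move: hq; rewrite ltW // => hq; move: qpos; rewrite hq ltxx.
Qed.

Lemma star_rep_compare (H : hilbertType R) (pi : cfun -> (H -> H)) (A : 'M[cfun]_n) :
  star_rep pi -> entries_cont A -> opnorm (map_mx pi A) <= opnorm (map_mx rho A).
Proof.
move=> hpi hA; have c0 := opnorm_ge0 (mapp_bop hrho hA).
by apply: opnorm_le => //; apply: star_rep_le => //; exact: star_rep_ge.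
Qed.

End Lower.

(** * The algebra B and its residual finite dimensionality *)

Section DiscAlgebra.
Variable R : realType.
Notation rc := (real_complex R).
Notation cfun := (circle R -> 'M[C R]_2).

Lemma disc_cont f : @disc_algebra R f -> continuous f.
Proof.
move=> [F [cF _ hF]].
have -> : f = sigL (circle R) F by apply/funext => t; rewrite hF.
apply/subspace_sigL_continuousP.
by apply: continuous_subspaceW cF => z /= ->.
Qed.

Lemma discD f g : @disc_algebra R f -> @disc_algebra R g -> disc_algebra (fun t => f t + g t).
Proof.
move=> [F [cF dF hF]] [G [cG dG hG]]; exists (fun z => F z + G z); split.
- exact: (@cont_add R (subspace _) F G cF cG).
- by move=> z hz; apply: derivableD; [exact: dF|exact: dG].
- by move=> t; rewrite hF hG.
Qed.

Lemma discM f g : @disc_algebra R f -> @disc_algebra R g -> disc_algebra (fun t => f t * g t).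
Proof.
move=> [F [cF dF hF]] [G [cG dG hG]]; exists (fun z => F z * G z); split.
- exact: (@cont_mul R (subspace _) F G cF cG).
- by move=> z hz; apply: derivableM; [exact: dF|exact: dG].
- by move=> t; rewrite hF hG.
Qed.

Lemma disc_cst c : @disc_algebra R (fun=> c).
Proof.
exists (fun=> c); split => //; first exact: (@cont_cst R (subspace _) c).
Qed.

Lemma disc_id : @disc_algebra R (fun t => val t).
Proof.
exists idfun; split => //.
by apply: continuous_subspaceT => z; exact: cvg_id.
Qed.

Lemma sum2 (V : zmodType) (f : 'I_2 -> V) : \sum_i f i = f 0 + f 1.
Proof. by rewrite big_ord_recl big_ord1; congr (_ + f _); apply: val_inj. Qed.

Lemma ord2P (i : 'I_2) : i = 0 \/ i = 1.
Proof. by case: i => -[|[|]] // h; [left|right]; apply: val_inj. Qed.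

Lemma algB_M2CT F : algB R F -> M2CT R F.
Proof.
move=> [f [g [h [df dg ch hF]]]]; apply/M2CTP => i j.
have [h00 h01 h10 h11] : [/\ forall t, F t 0 0 = f t, forall t, F t 0 1 = 0,
   forall t, F t 1 0 = h t & forall t, F t 1 1 = Num.conj (g t)].
  by split=> t; case: (hF t).
have [->|->] := ord2P i; have [->|->] := ord2P j.
- rewrite (_ : (fun t => _) = f); [exact: disc_cont|exact/funext].
- rewrite (_ : (fun t => _) = fun=> 0); [exact: cont_cst|exact/funext].
- rewrite (_ : (fun t => _) = h); [exact: ch|exact/funext].
- rewrite (_ : (fun t => _) = fun t => Num.conj (g t)); [|exact/funext].
  by apply: cont_conj; exact: disc_cont.
Qed.

Lemma algB_D F G : algB R F -> algB R G -> algB R (F + G).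
Proof.
move=> [f [g [h [df dg ch hF]]]] [f' [g' [h' [df' dg' ch' hG]]]].
exists (fun t => f t + f' t), (fun t => g t + g' t), (fun t => h t + h' t); split.
- exact: discD.
- exact: discD.
- exact: (@cont_add R _ h h' ch ch').
move=> t; have [a1 a2 a3 a4] := hF t; have [b1 b2 b3 b4] := hG t.
by rewrite !fctE !mxE a1 a2 a3 a4 b1 b2 b3 b4 addr0 rmorphD.
Qed.

Lemma algB_Z c F : algB R F -> algB R (c *: F).
Proof.
move=> [f [g [h [df dg ch hF]]]].
exists (fun t => c * f t), (fun t => Num.conj c * g t), (fun t => c * h t); split.
- by apply: discM; [exact: disc_cst|].
- by apply: discM; [exact: disc_cst|].
- by apply: cont_mul; [exact: cont_cst|exact: ch].
move=> t; have [a1 a2 a3 a4] := hF t.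
by rewrite !fctE !mxE a1 a2 a3 a4 mulr0 rmorphM /= conjCK.
Qed.

Lemma algB_M F G : algB R F -> algB R G -> algB R (F * G).
Proof.
move=> [f [g [h [df dg ch hF]]]] [f' [g' [h' [df' dg' ch' hG]]]].
exists (fun t => f t * f' t), (fun t => g t * g' t),
  (fun t => h t * f' t + Num.conj (g t) * h' t); split.
- exact: discM.
- exact: discM.
- apply: cont_add; first by apply: cont_mul; [exact: ch|exact: disc_cont].
  by apply: cont_mul; [apply: cont_conj; exact: disc_cont|exact: ch'].
move=> t; have [a1 a2 a3 a4] := hF t; have [b1 b2 b3 b4] := hG t.
rewrite !fctE !mxE !sum2 a1 a2 a3 a4 b1 b2 b3 b4.
by rewrite !(mul0r, mulr0, addr0, add0r) rmorphM.
Qed.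

Lemma algB_const (M : 'M[C R]_2) : M 0 1 = 0 -> algB R (fun=> M).
Proof.
move=> h; exists (fun=> M 0 0), (fun=> Num.conj (M 1 1)), (fun=> M 1 0); split.
- exact: disc_cst.
- exact: disc_cst.
- exact: cont_cst.
by move=> t; rewrite conjCK.
Qed.

Section Rep.
Variables (K : hilbertType R) (rho : cfun -> (K -> K)).
Hypothesis hrho : faithful_unital_star_rep rho.

Lemma faithful_star_rep : star_rep rho. Proof. by case: hrho. Qed.
Lemma faithful_inj F G : M2CT R F -> M2CT R G -> rho F = rho G -> F = G.
Proof. by case: hrho => _ _ _; apply. Qed.

(** The functions come from operators in [rho @` algB R]; [rinv] recovers the
    function from the operator, so that maps defined on B become maps defined on
    its concrete image. *)
Definition rinv (T : K -> K) : cfun := xget 0 [set F | algB R F /\ rho F = T].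

Lemma rinvP T : (rho @` algB R) T -> algB R (rinv T) /\ rho (rinv T) = T.
Proof. by move=> [F hF FT]; apply: (@xgetPex _ 0 [set F | algB R F /\ rho F = T]); exists F. Qed.

Lemma rinvK F : algB R F -> rinv (rho F) = F.
Proof.
move=> hF; have [h1 h2] : algB R (rinv (rho F)) /\ rho (rinv (rho F)) = rho F.
  by apply: rinvP; exists F.
by apply: faithful_inj => //; exact: algB_M2CT.
Qed.

(** A completely contractive homomorphism of B gives a representation of the
    operator algebra [rho @` algB R]. *)
Lemma algB_rep (H : hilbertType R) (Phi : cfun -> (H -> H)) :
  (forall F, algB R F -> bounded_operator (Phi F)) ->
  (forall F G, algB R F -> algB R G -> Phi (F + G) = Phi F + Phi G) ->
  (forall c F, algB R F -> Phi (c *: F) = c *: Phi F) ->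
  (forall F G, algB R F -> algB R G -> Phi (F * G) = Phi F \o Phi G) ->
  (forall n (A : 'M[cfun]_n), (forall i j, algB R (A i j)) ->
     opnorm (map_mx Phi A) <= opnorm (map_mx rho A)) ->
  representation (rho @` algB R) (fun T => Phi (rinv T)).
Proof.
move=> bPhi DPhi ZPhi MPhi cPhi.
have [_ [rD rZ rM _] _] := faithful_star_rep.
split; first split.
- by move=> T /rinvP [h _]; exact: bPhi.
- move=> _ _ [F hF <-] [G hG <-].
  rewrite -(rD _ _ (algB_M2CT hF) (algB_M2CT hG)) !rinvK //; first exact: DPhi.
  exact: algB_D.
- move=> c _ [F hF <-].
  rewrite -(rZ c _ (algB_M2CT hF)) !rinvK //; first exact: ZPhi.
  exact: algB_Z.
- move=> _ _ [F hF <-] [G hG <-].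
  rewrite -(rM _ _ (algB_M2CT hF) (algB_M2CT hG)) !rinvK //; first exact: MPhi.
  exact: algB_M.
move=> n a ha.
have -> : a = map_mx rho (map_mx rinv a).
  by apply/matrixP => i j; rewrite !mxE; have [] := rinvP (ha i j).
have -> : map_mx (fun T => Phi (rinv T)) (map_mx rho (map_mx rinv a)) = map_mx Phi (map_mx rinv a).
  by apply/matrixP => i j; rewrite !mxE; have [_ ->] := rinvP (ha i j).
by apply: cPhi => i j; rewrite mxE; have [] := rinvP (ha i j).
Qed.

Lemma star_rep_algB (H : hilbertType R) (Phi : cfun -> (H -> H)) : star_rep Phi ->
  representation (rho @` algB R) (fun T => Phi (rinv T)).
Proof.
move=> hPhi; have [pB [pD pZ pM _] _] := hPhi; apply: algB_rep.
- by move=> F hF; exact: (pB _ (algB_M2CT hF)).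
- by move=> F G hF hG; exact: (pD _ _ (algB_M2CT hF) (algB_M2CT hG)).
- by move=> c F hF; exact: (pZ c _ (algB_M2CT hF)).
- by move=> F G hF hG; exact: (pM _ _ (algB_M2CT hF) (algB_M2CT hG)).
move=> n A hA.
exact: (star_rep_compare faithful_star_rep faithful_inj hPhi (fun i j => algB_M2CT (hA i j))).
Qed.

Lemma circle1 : (1 : C R) \in circle R.
Proof. by apply/mem_set; exact: normr1. Qed.

(** The evaluations are finite-dimensional representations, so the supremum is
    at least the supremum of the norms of A(t), which bounds the norm of [rho] by
    [star_rep_le]; the other inequality is the contractivity of
    representations. *)
Theorem algB_RFD : RFD (rho @` algB R).
Proof.
move=> n a ha; set S := [set r | _].
pose A := map_mx rinv a.
have aE : a = map_mx rho A.
  by apply/matrixP => i j; rewrite !mxE; have [] := rinvP (ha i j).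
have hA : entries_cont A.
  by move=> i j; rewrite mxE; apply: algB_M2CT; have [] := rinvP (ha i j).
have evS t : S (opnorm (map_mx (ev t) A)).
  exists (L2H R 'I_2), (fun T => ev t (rinv T)); split.
  - exact: fin_dim.
  - by apply: star_rep_algB; exact: ev_star.
  - by congr opnorm; apply/matrixP => i j; rewrite !mxE.
pose t0 : circle R := SigSub circle1.
have bS r : S r -> r <= opnorm a.
  by move=> [H [pi [_ [_ cc] ->]]]; exact: cc.
have hS t : opnorm (map_mx (ev t) A) <= sup S.
  by apply: ub_le_sup; [exists (opnorm a) => r; exact: bS|exact: evS].
have bev t := mapp_bop (ev_star t) hA.
have S0 : 0 <= sup S by apply: le_trans (hS t0); exact: opnorm_ge0.
apply/eqP; rewrite eq_le; apply/andP; split; last first.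
  by apply: ge_sup => [|r]; [exists (opnorm (map_mx (ev t0) A))|exact: bS].
rewrite {1}aE; apply: opnorm_le => // x.
apply: (star_rep_le faithful_star_rep hA S0) => t v.
apply: le_trans (opnorm_ge (bev t) v) _.
by rewrite ler_wpM2r ?hnorm_ge0.
Qed.
End Rep.
End DiscAlgebra.

(** * Contractive homomorphisms of C-star-algebras preserve adjoints *)

Section ContractiveHom.
Variable R : realType.
Notation rc := (real_complex R).

(** If x has minimal norm on the line x + C y then x and y are orthogonal: the
    test value is c = - t (x, y) with t small. *)
Lemma orth_of_min (H : hilbertType R) (x y : H) :
  (forall c : C R, nrm x <= nrm (x + c *: y)) -> hdot x y = 0.
Proof.
move=> h; set d := hdot x y; apply: nrm_eq0.
pose t : R := (1 + nrm y ^+ 2)^-1.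
have t0 : 0 < t by rewrite invr_gt0 ltr_pwDl // sqr_ge0.
have := h (- (rc t * d)).
rewrite -(ler_pXn2r (_ : (0 < 2)%N)) ?nnegrE ?nrm_ge0 //.
rewrite nrmD2 nrmZ nrmN nrmM nrm_rc ?(ltW t0) // hdotZr -/d.
have -> : complex.Re (Num.conj (- (rc t * d)) * d) = - (t * nrm d ^+ 2).
  rewrite rmorphN rmorphM /= mulNr -mulrA [Num.conj d * d]mulrC -nrm_sq.
  have -> : Num.conj (rc t) = rc t by rewrite conj_Creal // complex_real.
  by rewrite -(rmorphM (real_complex R)) raddfN.
have ty : t * nrm y ^+ 2 <= 1.
  by rewrite mulrC ler_pdivrMr ?mul1r ?lerDr // ltr_pwDl // sqr_ge0.
move=> hh; apply/eqP; rewrite -sqrf_eq0 eq_le sqr_ge0 andbT.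
have d0 : 0 <= nrm d ^+ 2 by exact: sqr_ge0.
have : 0 <= t * nrm d ^+ 2 * (t * nrm y ^+ 2 - 2) by move: hh; rewrite !exprMn; nra.
rewrite leNgt => /negP hn; rewrite leNgt; apply/negP => dp; apply: hn.
rewrite pmulr_rlt0; last exact: mulr_gt0.
by apply: le_lt_trans (_ : _ <= 1 - 2) _; rewrite ?lerD2r //; lra.
Qed.

(** An operator with real quadratic form is self-adjoint, by polarization with
    x + y and x + i y. *)
Lemma real_form_sym (H : hilbertType R) (Q : H -> H) : linear Q ->
  (forall x, complex.Im (hdot x (Q x)) = 0) -> is_adjoint Q Q.
Proof.
move=> lQ hQ x y.
have h1 := hQ (x + y); have h2 := hQ (x + 'i%C *: y).
have hx := hQ x; have hy := hQ y.
rewrite (linD lQ) hdotDl !hdotDr !raddfD /= hx hy add0r addr0 in h1.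
have hiy := hQ ('i%C *: y).
rewrite (linD lQ) hdotDl !hdotDr !raddfD /= hx hiy add0r addr0 in h2.
rewrite (linZ lQ) hdotZl hdotZr in h2.
rewrite hdotC.
move: h1 h2; case: (hdot x (Q y)) => a b; case: (hdot y (Q x)) => c d /= h1 h2.
by congr Complex; lra.
Qed.

Variables (L H : hilbertType R) (D : set (L -> L)) (phi : (L -> L) -> (H -> H)).
Hypotheses (hD : cstar_algebra D) (D1 : D idfun) (hphi : representation D phi).

Lemma rep_contr T M : D T -> 0 <= M -> lip M T -> lip M (phi T).
Proof.
move=> DT M0 hM x.
have [[bphi _ _ _] cc] := hphi.
apply: le_trans (opnorm1_ge (bphi _ DT) x) _; rewrite ler_wpM2r ?nrm_ge0 //.
apply: le_trans (opnorm1_le M0 hM).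
by rewrite -(map_const_mx phi); apply: cc => i j; rewrite mxE.
Qed.

Let DD S T : D S -> D T -> D (S + T). Proof. by have [[_ [_ h _ _] _] _] := hD; exact: h. Qed.
Let DZ c T : D T -> D (c *: T). Proof. by have [[_ [_ _ h _] _] _] := hD; exact: h. Qed.
Let Dbnd T : D T -> bounded_operator T. Proof. by have [[h _ _] _] := hD; exact: h. Qed.
Let pD S T x : D S -> D T -> phi (S + T) x = phi S x + phi T x.
Proof. by move=> hS hT; have [[_ h _ _] _] := hphi; rewrite h. Qed.
Let pZ c T x : D T -> phi (c *: T) x = c *: phi T x.
Proof. by move=> hT; have [[_ _ h _] _] := hphi; rewrite h. Qed.
Let pM S T x : D S -> D T -> phi (S \o T) x = phi S (phi T x).
Proof. by move=> hS hT; have [[_ _ _ h] _] := hphi; rewrite h. Qed.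
(* [phi] need not be unital; p is a contractive idempotent, hence an orthogonal
   projection, and [phi] lives on its range. *)
Let p := phi idfun.

Let pl T x : D T -> p (phi T x) = phi T x.
Proof. by move=> DT; rewrite /p -pM. Qed.
Let pr T x : D T -> phi T (p x) = phi T x.
Proof. by move=> DT; rewrite /p -pM. Qed.

Let linphi T : D T -> linear (phi T).
Proof. by move=> DT; have [[h _ _ _] _] := hphi; exact: bop_lin (h _ DT). Qed.

(** p is a contraction that fixes its range, so p x has minimal norm on
    p x + C (y - p y). *)
Lemma unit_orthogonal x y : hdot (p x) (y - p y) = 0.
Proof.
apply: orth_of_min => c.
have c1 : lip 1 p by apply: rep_contr => // z; rewrite mul1r.
have := c1 (p x + c *: (y - p y)).
have lp : linear p := linphi D1.
rewrite mul1r (linD lp) (linZ lp) (linB lp) !pl //.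
by rewrite subrr scaler0 addr0.
Qed.

(** For S self-adjoint, |1 + i t S|^2 <= 1 + t^2 |S|^2, so phi(S) satisfies
    |x + i t phi(S) x|^2 <= (1 + t^2 |S|^2) |x|^2 for x fixed by p.  The term of
    first order in t, which is the imaginary part of (x, phi(S) x), must vanish. *)
Lemma phi_selfadj S : D S -> is_adjoint S S -> is_adjoint (phi S) (phi S).
Proof.
move=> DS aS; apply: real_form_sym; first exact: linphi.
move=> x0.
have -> : hdot x0 (phi S x0) = hdot (p x0) (phi S (p x0)).
  rewrite pr //; apply/eqP; rewrite -subr_eq0 -hdotBl hdotC -(pl _ DS) unit_orthogonal rmorph0 //.
have : p (p x0) = p x0 by rewrite pl.
move: (p x0) => x px.
have [M M0 hM] := bop_lip (Dbnd DS).
have key (t : R) : 2 * (t * complex.Im (hdot x (phi S x))) <= t ^+ 2 * (M ^+ 2 * nrm x ^+ 2).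
  have lipt : lip (Num.sqrt (1 + t ^+ 2 * M ^+ 2)) (idfun + Complex 0 t *: S).
    move=> y; rewrite fctE /= fctE.
    have p1 : 0 <= 1 + t ^+ 2 * M ^+ 2 by rewrite addr_ge0 // mulr_ge0 // sqr_ge0.
    rewrite -(ler_pXn2r (_ : (0 < 2)%N)) ?nnegrE ?mulr_ge0 ?nrm_ge0 ?sqrtr_ge0 //.
    rewrite exprMn sqr_sqrtr // nrmD2 hdotZr nrmZ exprMn.
    have -> : nrm (Complex 0 t : C R) ^+ 2 = t ^+ 2.
      by apply: rc_inj; rewrite nrm_sq; congr Complex; rewrite /=; ring.
    have : complex.Im (hdot y (S y)) = 0.
      have := hdotC y (S y); rewrite aS; case: (hdot y (S y)) => a b [] /=; lra.
    case: (hdot y (S y)) => a b /= ->.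
    have h1 : nrm (S y) ^+ 2 <= (M * nrm y) ^+ 2.
      by rewrite ler_pXn2r ?nnegrE ?mulr_ge0 ?nrm_ge0.
    rewrite exprMn in h1; have t2 := sqr_ge0 t.
    have := ler_wpM2l t2 h1; lra.
  have DT : D (idfun + Complex 0 t *: S) by apply: DD => //; exact: DZ.
  have := rep_contr DT (sqrtr_ge0 _) lipt x.
  rewrite (pD _ D1 (DZ _ DS)) pZ // -/p px.
  rewrite -(ler_pXn2r (_ : (0 < 2)%N)) ?nnegrE ?mulr_ge0 ?nrm_ge0 ?sqrtr_ge0 //.
  rewrite exprMn sqr_sqrtr; last by rewrite addr_ge0 // mulr_ge0 // sqr_ge0.
  rewrite nrmD2 hdotZr nrmZ.
  have -> : complex.Re (Num.conj (Complex 0 t) * hdot x (phi S x)) = t * complex.Im (hdot x (phi S x)).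
    by case: (hdot x (phi S x)) => a b /=; ring.
  have := sqr_ge0 (nrm (Complex 0 t : C R) * nrm (phi S x)); lra.
set I := complex.Im _ in key *; set B := M ^+ 2 * nrm x ^+ 2 in key.
have B0 : 0 <= B by rewrite mulr_ge0 // sqr_ge0.
(* t = e I is small enough for the linear term to dominate. *)
pose e : R := (1 + B)^-1.
have e0 : 0 < e by rewrite invr_gt0 ltr_pwDl.
have eB : e * B <= 1 by rewrite mulrC ler_pdivrMr ?mul1r ?lerDr // ltr_pwDl.
have := key (e * I).
have -> : 2 * (e * I * I) = e * I ^+ 2 * 2 by ring.
have -> : (e * I) ^+ 2 * B = e * I ^+ 2 * (e * B) by ring.
move=> hk; apply/eqP; rewrite -sqrf_eq0 eq_le sqr_ge0 andbT leNgt; apply/negP => I2.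
move: hk; rewrite ler_pM2l; last exact: mulr_gt0.
by move=> /le_trans /(_ eB); rewrite leNgt ltr1n.
Qed.

(** Split V into the self-adjoint parts V + W and i (V - W). *)
Theorem contractive_star V W : D V -> D W -> is_adjoint V W -> is_adjoint (phi V) (phi W).
Proof.
move=> DV DW aVW x y.
have aWV := adjoint_sym aVW.
have s1 : is_adjoint (V + W) (V + W).
  by move=> a b; rewrite !fctE hdotDl hdotDr aVW aWV addrC.
have s2 : is_adjoint ('i *: (V - W)) ('i *: (V - W)).
  move=> a b; rewrite !fctE hdotZl hdotZr hdotBl hdotBr aVW aWV conjCi.
  by rewrite mulNr -mulrN opprB.
have DNW : D (- W) by rewrite -scaleN1r; exact: DZ.
have D2 : D (V - W) by exact: DD.
have pB a : phi (V - W) a = phi V a - phi W a.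
  by rewrite pD // -scaleN1r pZ // scaleN1r.
have := phi_selfadj (DZ 'i D2) s2 x y.
rewrite !pZ // !pB hdotZl hdotZr conjCi mulNr -mulrN => /(mulfI (neq0Ci _)).
have := phi_selfadj (DD DV DW) s1 x y.
rewrite !pD // hdotDl hdotDr hdotBl hdotBr.
move=> h1 h2; have n2 : (2 : C R) != 0 by rewrite pnatr_eq0.
apply: (mulfI n2).
transitivity ((hdot (phi V x) y + hdot (phi W x) y) + (hdot (phi V x) y - hdot (phi W x) y)).
  by ring.
by rewrite h1 h2; ring.
Qed.

End ContractiveHom.

(** * Contractions on a finite-dimensional space *)

Section FiniteDim.
Variables (R : realType) (H : hilbertType R).
Notation rc := (real_complex R).

(** The projection on the span of [us] when [us] is orthonormal. *)
Definition proj (us : seq H) (y : H) : H := \sum_(u <- us) hdot y u *: u.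

(** Gram-Schmidt.  The property kept along the induction is that [us] reproduces
    its own members and the vectors e_i treated so far. *)
Lemma frame_exists : finite_dimensional H -> exists us : seq H, forall y, y = proj us y.
Proof.
move=> [n [e he]].
have lproj us : linear (proj us).
  move=> a x y; rewrite /proj scaler_sumr -big_split; apply: eq_bigr => u _.
  by rewrite hdotDl hdotZl scalerDl scalerA.
suff [us [h1 h2]] : exists us, (forall i, i \in enum 'I_n -> proj us (e i) = e i) /\
   (forall u, u \in us -> proj us u = u).
  exists us => y; have [c ->] := he y.
  rewrite (lin_sum (lproj us)); apply: eq_bigr => i _.
  by rewrite (linZ (lproj us)) h1 // mem_enum.
elim: (enum 'I_n) => [|k ks [us [h1 h2]]]; first by exists [::].
pose w := e k - proj us (e k).
have pp y : proj us (proj us y) = proj us y.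
  rewrite [X in proj us X]/proj (lin_sum (lproj us)) [RHS]/proj big_seq [RHS]big_seq.
  apply: eq_bigr => u hu; rewrite (linZ (lproj us)); congr (_ *: _); exact: h2.
have padj x y : hdot (proj us x) y = hdot x (proj us y).
  rewrite /proj hdot_suml hdot_sumr; apply: eq_bigr => u _.
  by rewrite hdotZl hdotZr -hdotC mulrC.
have pw : proj us w = 0 by rewrite (linB (lproj us)) pp subrr.
have [w0|w0] := eqVneq (nrm w) 0.
  exists us; split=> // i; rewrite inE => /orP [/eqP ->|]; last exact: h1.
  by apply/esym/eqP; rewrite -subr_eq0; apply/eqP/nrm_eq0.
have wp : 0 < nrm w by rewrite lt_neqAle eq_sym w0 nrm_ge0.
pose v := rc (nrm w)^-1 *: w.
have pv : proj us v = 0 by rewrite (linZ (lproj us)) pw scaler0.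
have vv : hdot v v = 1.
  rewrite hdotxx nrmZ nrm_rc; last by rewrite invr_ge0 ltW.
  by rewrite mulVf // expr1n.
have pE y : proj (v :: us) y = hdot y v *: v + proj us y by rewrite /proj big_cons.
have pfix y : proj us y = y -> hdot y v = 0.
  by move=> <-; rewrite padj pv hdot0r.
exists (v :: us); split=> [i|u]; rewrite inE => /orP [/eqP ->|hi]; rewrite pE.
- have ek : e k = w + proj us (e k) by rewrite subrK.
  have -> : hdot (e k) v = rc (nrm w).
    rewrite ek hdotDl (pfix _ (pp _)) addr0 /v hdotZr hdotxx.
    have -> : Num.conj (rc (nrm w)^-1) = rc (nrm w)^-1 by rewrite conj_Creal // complex_real.
    by rewrite -(rmorphM (real_complex R)) expr2 mulrA mulVf // mul1r.
  by rewrite /v scalerA -(rmorphM (real_complex R)) mulfV // rmorph1 scale1r -ek.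
- by rewrite pfix ?h1 // scale0r add0r.
- by rewrite vv scale1r pv addr0.
- by rewrite pfix ?h2 // scale0r add0r.
Qed.

(** Let d = 1 - T T' and let (u) be a family as in [frame_exists].  By Parseval's
    identity |T^n d x|^2 is the sum over u of |(x, d T'^n u)|^2, which is at most
    |x|^2 (a_n - a_(n+1)), where a_n is the sum over u of |T'^n u|^2.  Since
    |X d x| <= |T^n d x| for every n, summing over n bounds n |X d x|^2 by
    |x|^2 a_0, independently of n. *)
Theorem findim_defect (T T' X : H -> H) (Y : nat -> H -> H) :
  finite_dimensional H -> is_adjoint T T' -> linear T -> lip 1 T -> lip 1 T' ->
  (forall n, lip 1 (Y n)) -> (forall n x, X x = Y n (iter n T x)) ->
  forall x, X (x - T (T' x)) = 0.
Proof.
move=> fd aT lT cT cT' cY hX x.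
have [us hus] := frame_exists fd.
pose d y := y - T (T' y).
have dadj y z : hdot (d y) z = hdot y (d z).
  rewrite /d hdotBl hdotBr; congr (_ - _).
  by rewrite aT [RHS]hdotC aT -hdotC.
have aTn n y z : hdot (iter n T y) z = hdot y (iter n T' z).
  elim: n y z => [//|n ih] y z.
  by rewrite iterS aT ih -iterSr.
have sq y : nrm y ^+ 2 = \sum_(u <- us) nrm (hdot y u) ^+ 2.
  apply: rc_inj; rewrite -hdotxx {2}(hus y) /proj hdot_sumr [RHS](rmorph_sum (real_complex R)).
  by apply: eq_bigr => u _; rewrite hdotZr mulrC; exact: esym (nrm_sq _).
have dsq y : nrm (d y) ^+ 2 <= nrm y ^+ 2 - nrm (T' y) ^+ 2.
  rewrite /d nrmB2 [hdot y _]hdotC aT hdotxx /=.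
  have : nrm (T (T' y)) ^+ 2 <= nrm (T' y) ^+ 2.
    by rewrite ler_pXn2r ?nnegrE ?nrm_ge0 // -[leRHS]mul1r.
  lra.
pose a n := \sum_(u <- us) nrm (iter n T' u) ^+ 2.
have a0 n : 0 <= a n by apply: sumr_ge0 => u _; exact: sqr_ge0.
pose z := nrm (X (d x)) ^+ 2.
have zn n : z <= nrm x ^+ 2 * (a n - a n.+1).
  rewrite /z (hX n).
  apply: (@le_trans _ _ (nrm (iter n T (d x)) ^+ 2)).
    rewrite ler_pXn2r ?nnegrE ?nrm_ge0 //.
    by apply: le_trans (cY n _) _; rewrite mul1r.
  rewrite sq -sumrB mulr_sumr; apply: ler_sum => u _.
  rewrite aTn dadj.
  apply: (@le_trans _ _ ((nrm x * nrm (d (iter n T' u))) ^+ 2)).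
    by rewrite ler_pXn2r ?nnegrE ?mulr_ge0 ?nrm_ge0 // hdot_le.
  by rewrite exprMn ler_wpM2l ?sqr_ge0 // dsq.
have zN n : n%:R * z <= nrm x ^+ 2 * (a 0%N - a n).
  elim: n => [|n ih]; first by rewrite mul0r subrr mulr0.
  rewrite -natr1 mulrDl mul1r; have := zn n; lra.
apply: nrm_eq0; apply/eqP; rewrite -sqrf_eq0 eq_le sqr_ge0 andbT -/(d x) -/z.
rewrite leNgt; apply/negP => zp.
pose B := nrm x ^+ 2 * a 0%N.
have B0 : 0 <= B by rewrite mulr_ge0 // sqr_ge0.
have hn := archi_boundP (divr_ge0 B0 (ltW zp)); set n := Num.bound _ in hn.
move: hn; rewrite ltr_pdivrMr // ltNge => /negP; apply.
apply: le_trans (zN n) _; rewrite /B ler_wpM2l ?sqr_ge0 // lerBlDr lerDl; exact: a0.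
Qed.
End FiniteDim.

(** * The exponential map of the circle and dyadic bisection *)

Section Circle.
Variable R : realType.
Notation rc := (real_complex R).
Implicit Types x y : R.

(** e^(2 pi i y). *)
Definition cis (y : R) : C R := Complex (cos (pi *+ 2 * y)) (sin (pi *+ 2 * y)).

Lemma cisD x y : cis (x + y) = cis x * cis y.
Proof. by rewrite /cis mulrDr cosD sinD; congr Complex; ring. Qed.

Lemma cis0 : cis 0 = 1.
Proof. by rewrite /cis mulr0 cos0 sin0. Qed.

Lemma cis1 : cis 1 = 1.
Proof. by rewrite /cis mulr1 cos2pi sin2pi. Qed.

Lemma cis_half : cis (2^-1) = -1.
Proof.
have -> : cis 2^-1 = Complex (cos pi) (sin pi) by rewrite /cis -(mulr_natr pi) mulfK.
rewrite cospi sinpi.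
by congr Complex; rewrite oppr0.
Qed.

Lemma cisX y n : cis y ^+ n = cis (n%:R * y).
Proof.
elim: n => [|n ih]; first by rewrite mul0r cis0.
by rewrite exprS ih -cisD -natr1 mulrDl mul1r addrC.
Qed.

Lemma cis_conj y : Num.conj (cis y) = cis (- y).
Proof. by rewrite /cis mulrN cosN sinN. Qed.

Lemma nrm_cis y : nrm (cis y) = 1.
Proof.
apply/eqP; rewrite -(eqrXn2 (_ : (0 < 2)%N)) ?nrm_ge0 //; apply/eqP; apply: rc_inj.
by rewrite nrm_sq cis_conj -cisD subrr cis0 expr1n.
Qed.

Lemma cis_neq0 y : cis y != 0.
Proof. by apply/eqP => h; have := nrm_cis y; rewrite h nrm0 => /eqP; rewrite eq_sym oner_eq0. Qed.

Lemma cisV y : (cis y)^-1 = cis (- y).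
Proof.
apply: (mulfI (cis_neq0 y)); rewrite -cisD subrr cis0 divff //; exact: cis_neq0.
Qed.

Lemma nrm_Complex (a b : R) : nrm (Complex a b : C R) <= `|a| + `|b|.
Proof.
have -> : Complex a b = rc a + Complex 0 1 * rc b by simpc.
apply: le_trans (nrmD _ _) _; rewrite nrmM !nrm_real.
by rewrite nrm_imag mul1r.
Qed.

(** The mean value inequality. *)
Lemma lip_of_derive (f df : R -> R) : (forall x, is_derive x 1 f (df x)) ->
  (forall x, `|df x| <= 1) -> forall x y, `|f x - f y| <= `|x - y|.
Proof.
move=> hf hdf x y.
wlog xy : x y / x <= y.
  move=> h; have [/h //|/ltW /h] := leP x y.
  by rewrite distrC [X in _ <= X]distrC.
have [c _ E] : exists2 c, c \in `[x, y]%R & f y - f x = df c * (y - x).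
  apply: MVT_segment => //; apply: continuous_subspaceT => z.
  by apply: differentiable_continuous; apply/derivable1_diffP; apply: ex_derive.
by rewrite distrC E normrM [X in _ <= X]distrC ler_piMl.
Qed.

(** The constant 16 is twice the bound 8 of 2 pi. *)
Lemma cis_lip x y : nrm (cis x - cis y) <= 16 * `|x - y|.
Proof.
have hp (a b : R) : `|pi *+ 2 * a - pi *+ 2 * b| <= 8 * `|a - b|.
  rewrite -mulrBr normrM ler_wpM2r // ger0_norm; last by rewrite mulrn_wge0 // pi_ge0.
  have := @pihalf_lt2 R; rewrite ltr_pdivrMr // => h.
  by rewrite -mulr_natl; lra.
have -> : cis x - cis y = Complex (cos (pi *+ 2 * x) - cos (pi *+ 2 * y))
    (sin (pi *+ 2 * x) - sin (pi *+ 2 * y)) by [].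
apply: le_trans (nrm_Complex _ _) _.
have h1 := @lip_of_derive cos (fun x => - sin x) (@is_derive_cos R)
  (fun x => eq_ind_r (fun a => a <= 1) (sin_max x) (normrN (sin x))) (pi *+ 2 * x) (pi *+ 2 * y).
have h2 := @lip_of_derive sin cos (@is_derive_sin R) (@cos_max R) (pi *+ 2 * x) (pi *+ 2 * y).
have h3 := hp x y; lra.
Qed.

Lemma cis_surj (z : C R) : nrm z = 1 -> exists2 y : R, 0 <= y <= 1 & z = cis y.
Proof.
move=> z1.
have h : (complex.Re z) ^+ 2 + (complex.Im z) ^+ 2 = 1.
  apply: rc_inj; have := add_Re2_Im2 z; rewrite -[`|z : R[i]|]/(`|z : C R|) nrmE z1 => ->.
  by rewrite rmorph1 expr1n.
case: z z1 h => a b z1 /= h.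
have a1 : -1 <= a <= 1.
  rewrite -ler_norml -(ler_pXn2r (_ : (0 < 2)%N)) ?nnegrE // expr1n real_normK ?num_real //.
  by rewrite -h lerDl sqr_ge0.
have p2 : 0 < pi *+ 2 :> R by rewrite mulrn_wgt0 // pi_gt0.
have pn : pi *+ 2 != 0 :> R by rewrite gt_eqF.
have sb : sin (acos a) = `|b|.
  rewrite sin_acos //; have -> : 1 - a ^+ 2 = b ^+ 2 by rewrite -h; ring.
  by rewrite sqrtr_sqr.
have ca : cos (acos a) = a by apply: acosK.
have t0 := acos_ge0 a1; have t1 := acos_lepi a1.
have tt : 0 <= acos a / (pi *+ 2) <= 1.
  apply/andP; split; first by rewrite divr_ge0 // (ltW p2).
  rewrite ler_pdivrMr // mul1r mulr2n.
  by apply: le_trans t1 _; rewrite lerDl pi_ge0.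
have [b0|b0] := leP 0 b.
  exists (acos a / (pi *+ 2)) => //.
  rewrite /cis mulrCA divff // mulr1 ca sb ger0_norm //.
exists (1 - acos a / (pi *+ 2)); first by move: tt; lra.
rewrite cisD cis1 mul1r -cis_conj /cis mulrCA divff // mulr1 ca sb ltr0_norm //.
by congr Complex; rewrite opprK.
Qed.

(** The closed dyadic intervals of order j. *)
Definition dyad j p (x : R) := p%:R / 2 ^+ j <= x <= p.+1%:R / 2 ^+ j.

(** The compactness argument behind all uniform statements below.  A property of
    dyadic squares that passes from the four quarters of a square to the square,
    and that holds for the small squares around each point, holds for the unit
    square: otherwise there is a nested sequence of bad squares, which shrinks
    to a point.  Properties of intervals are treated as properties of squares that
    ignore one coordinate. *)
Lemma bisect (P : nat -> nat -> nat -> Prop) :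
  (forall j p q, (forall s t : bool, P j.+1 (p.*2 + s)%N (q.*2 + t)%N) -> P j p q) ->
  (forall x y, 0 <= x <= 1 -> 0 <= y <= 1 ->
     exists J, forall j p q, (J <= j)%N -> dyad j p x -> dyad j q y -> P j p q) ->
  P 0%N 0%N 0%N.
Proof.
move=> Pup Ploc; apply: contrapT => nP.
pose bad (Q : nat * nat * nat) := ~ P Q.1.1 Q.1.2 Q.2.
have step Q : exists st : bool * bool, bad Q ->
    bad (Q.1.1.+1, Q.1.2.*2 + st.1, Q.2.*2 + st.2)%N.
  have [[s [t h]]|h] := pselect (exists s t : bool, bad (Q.1.1.+1, Q.1.2.*2 + s, Q.2.*2 + t)%N).
    by exists (s, t).
  exists (false, false) => bQ; exfalso; apply: bQ; apply: Pup => s t.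
  by apply: contrapT => h'; apply: h; exists s, t.
have [f hf] := choice step.
pose nxt Q := (Q.1.1.+1, Q.1.2.*2 + (f Q).1, Q.2.*2 + (f Q).2)%N.
pose Q n := iter n nxt (0, 0, 0)%N.
have Qbad n : bad (Q n).
  by elim: n => [//|n ih]; rewrite /Q iterS; apply: hf.
have Qj n : (Q n).1.1 = n by elim: n => [//|n ih]; rewrite /Q iterS /= -/(Q n) ih.
(* The left ends increase, the right ends decrease, and the supremum of the
   left ends lies in all the intervals. *)
have lim_of (a : nat -> nat) : a 0%N = 0%N -> (forall n, exists s : bool, a n.+1 = ((a n).*2 + s)%N) ->
    exists2 x : R, 0 <= x <= 1 & forall n, dyad n (a n) x.
  move=> a0 aS.
  have p2 n : 0 < 2 ^+ n :> R by rewrite exprn_gt0.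
  have lo n m : (a n)%:R / 2 ^+ n <= (a (n + m)%N)%:R / 2 ^+ (n + m) :> R.
    elim: m => [|m ih]; first by rewrite addn0.
    apply: le_trans ih _; rewrite addnS; have [s ->] := aS (n + m)%N.
    rewrite exprS ler_pdivlMr ?mulr_gt0 // mulrC -mulrA [2 ^+ _ * (_ / _)]mulrC divfK ?gt_eqF //.
    by rewrite natrD -muln2 natrM mulrC lerDl.
  have hi n m : (a (n + m)%N).+1%:R / 2 ^+ (n + m) <= (a n).+1%:R / 2 ^+ n :> R.
    elim: m => [|m ih]; first by rewrite addn0.
    apply: le_trans ih; rewrite addnS; have [s ->] := aS (n + m)%N.
    rewrite exprS ler_pdivrMr ?mulr_gt0 // mulrC -mulrA [2 ^+ _ * (_ / _)]mulrC divfK ?gt_eqF //.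
    rewrite -natrM ler_nat -addn1 -[X in (_ <= 2 * X)%N]addn1 mulnDr mul2n.
    by rewrite -addnA leq_add2l; case: (s).
  have lohi n m : (a n)%:R / 2 ^+ n <= (a m).+1%:R / 2 ^+ m :> R.
    apply: le_trans (lo n m) _; rewrite addnC; apply: le_trans (hi m n).
    by rewrite ler_pM2r ?invr_gt0 // ler_nat.
  pose E := range (fun n => (a n)%:R / 2 ^+ n : R).
  have supE : has_sup E.
    split; first by exists ((a 0%N)%:R / 2 ^+ 0); exists 0%N.
    by exists ((a 0%N).+1%:R / 2 ^+ 0) => _ [n _ <-].
  have hx n : dyad n (a n) (sup E).
    apply/andP; split.
      by apply: ub_le_sup; [case: supE|exists n].
    by apply: ge_sup => [|_ [m _ <-]]; [case: supE|exact: lohi].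
  exists (sup E) => //; have := hx 0%N; rewrite /dyad a0 expr0 !divr1 //.
have [x x01 hx] := lim_of (fun n => (Q n).1.2) erefl (fun n => ex_intro _ (f (Q n)).1 erefl).
have [y y01 hy] := lim_of (fun n => (Q n).2) erefl (fun n => ex_intro _ (f (Q n)).2 erefl).
have [J hJ] := Ploc x y x01 y01.
by have := Qbad J; rewrite /bad Qj; apply; apply: hJ.
Qed.

Lemma dyad_dist j p x y : dyad j p x -> dyad j p y -> `|x - y| <= (2 ^+ j)^-1.
Proof.
have E : p.+1%:R / 2 ^+ j = p%:R / 2 ^+ j + (2 ^+ j)^-1 :> R by rewrite -natr1 mulrDl mul1r.
by rewrite /dyad E => /andP [h1 h2] /andP [h3 h4]; rewrite ler_norml; apply/andP; split; lra.
Qed.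

Lemma dyad_split j q y : dyad j q y = dyad j.+1 q.*2 y || dyad j.+1 q.*2.+1 y.
Proof.
have E u : u%:R / 2 ^+ j = u.*2%:R / 2 ^+ j.+1 :> R.
  by rewrite exprS -muln2 natrM; field; rewrite expf_neq0.
rewrite /dyad !E doubleS.
have : q.*2%:R / 2 ^+ j.+1 <= q.*2.+1%:R / 2 ^+ j.+1 :> R.
  by rewrite ler_pM2r ?invr_gt0 ?exprn_gt0 // ler_nat.
have : q.*2.+1%:R / 2 ^+ j.+1 <= q.*2.+2%:R / 2 ^+ j.+1 :> R.
  by rewrite ler_pM2r ?invr_gt0 ?exprn_gt0 // ler_nat.
set a := q.*2%:R / _; set b := q.*2.+1%:R / _; set c := q.*2.+2%:R / _.
move=> h1 h2; apply/andP/orP => [[h3 h4]|[/andP [h3 h4]|/andP [h3 h4]]].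
- have [h5|h5] := leP y b; [left|right]; by rewrite ?h3 ?h4 ?h5 ?(ltW h5).
- by split=> //; apply: le_trans h4 _.
- by split=> //; apply: le_trans h3.
Qed.

Lemma pow2_small (d : R) : 0 < d -> exists J, forall j, (J <= j)%N -> (2 ^+ j)^-1 < d.
Proof.
move=> d0; have h := archi_boundP (ltW (_ : 0 < d^-1)); rewrite invr_gt0 in h.
have {}h := h d0; set n := Num.bound _ in h; exists n => j nj.
have p2 : 0 < 2 ^+ j :> R by rewrite exprn_gt0.
rewrite -(invrK d) ltf_pV2 ?posrE ?invr_gt0 //; apply: lt_trans h _.
rewrite -natrX ltr_nat; apply: leq_ltn_trans nj _; exact: ltn_expl.
Qed.

End Circle.

(** * Cauchy's theorem for sums over dyadic grids *)

Section Goursat.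
Variable R : realType.
Notation rc := (real_complex R).

(** Differentiability at c as approximation by an affine function. *)
Lemma deriv_local (G : C R -> C R) (c : C R) : derivable G c 1 -> exists beta : C R,
  forall e : R, 0 < e -> exists2 d : R, 0 < d & forall w, nrm (w - c) < d ->
    nrm (G w - (G c + beta * (w - c))) <= e * nrm (w - c).
Proof.
move=> /cvg_ex [beta hb]; exists beta => e e0.
have /nbhs_normP [d /= d0 hd] : nbhs (0 : C R) [set h : C R | h != 0 ->
    nrm (beta - h^-1 *: ((G \o shift c) (h *: 1) - G c)) < e].
  by move/(nrm_cvgP _ _ _).1 : hb => /(_ e e0).
have dr : d = rc (complex.Re d) by rewrite RRe_real // gtr0_real.
exists (complex.Re d); first by rewrite -rc_lt -dr rmorph0.
move=> w hw; have [->|wc] := eqVneq w c.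
  by rewrite subrr mulr0 addr0 subrr nrm0 mulr0.
have h0 : w - c != 0 by rewrite subr_eq0.
have := hd (w - c); rewrite /ball_ /= sub0r normrN nrmE dr rc_lt => /(_ hw h0).
have -> : (w - c) *: 1 + c = w by rewrite /= [_ *: _]mulr1 subrK.
move=> /ltW h.
have -> : G w - (G c + beta * (w - c)) = - ((beta - (w - c)^-1 *: (G w - G c)) * (w - c)).
  by rewrite mulrBl [_ *: _]mulrC mulfVK // opprB opprD addrA.
by rewrite nrmN nrmM ler_wpM2r ?nrm_ge0.
Qed.

Variable r : R.
Hypotheses (r0 : 0 <= r) (r1 : r < 1).

(** Polar coordinates on the disc of radius r, with both coordinates running
    through the unit interval; [gp k] is the image of the dyadic grid of order
    k. *)
Definition Gam (x y : R) : C R := rc (r * x) * cis y.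
Definition gp k a b : C R := Gam (a%:R / 2 ^+ k) (b%:R / 2 ^+ k).
(** The trapezoidal approximation of the integral of G along the segment from u
    to v.  It is exact for affine functions and antisymmetric in u and v. *)
Definition trap (G : C R -> C R) u v : C R := 2^-1 * (G u + G v) * (v - u).
Definition hedge G k a b := trap G (gp k a b) (gp k a.+1 b).
Definition vedge G k a b := trap G (gp k a b) (gp k a b.+1).
(** The sum of the four edges of a small quadrilateral of the grid, traversed
    once. *)
Definition cell G k a b := hedge G k a b - hedge G k a b.+1 + (vedge G k a.+1 b - vedge G k a b).

Lemma cellB F G k a b : cell (fun w => F w - G w) k a b = cell F k a b - cell G k a b.
Proof. by rewrite /cell /hedge /vedge /trap; ring. Qed.

Lemma cell_affine al be k a b : cell (fun w => al + be * w) k a b = 0.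
Proof.
have n2 : (2 : C R) != 0 by rewrite pnatr_eq0.
by rewrite /cell /hedge /vedge /trap; field.
Qed.

(** Interior edges cancel. *)
Lemma cell_boundary G k a0 a1 b0 b1 : (a0 <= a1)%N -> (b0 <= b1)%N ->
  \sum_(a0 <= a < a1) \sum_(b0 <= b < b1) cell G k a b =
  \sum_(a0 <= a < a1) (hedge G k a b0 - hedge G k a b1)
  + \sum_(b0 <= b < b1) (vedge G k a1 b - vedge G k a0 b).
Proof.
move=> ha hb.
under eq_bigr do rewrite big_split /=.
rewrite big_split /=; congr (_ + _).
  apply: eq_bigr => a _; rewrite -[RHS]opprB -(telescope_sumr (hedge G k a) hb) -sumrN.
  by apply: eq_bigr => b _; rewrite opprB.
rewrite exchange_big /=; apply: eq_bigr => b _.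
by rewrite (telescope_sumr (vedge G k ^~ b) ha).
Qed.

(** The total of the cells of order k that lie in the dyadic square (p, q) of
    order j, that is, a sum over the boundary of this square. *)
Definition cellsum G k j p q := \sum_(p * 2 ^ (k - j) <= a < p.+1 * 2 ^ (k - j))
  \sum_(q * 2 ^ (k - j) <= b < q.+1 * 2 ^ (k - j)) cell G k a b.

Lemma cellsum_split G k j p q : (j < k)%N -> cellsum G k j p q =
  \sum_(s : bool) \sum_(t : bool) cellsum G k j.+1 (p.*2 + s) (q.*2 + t).
Proof.
move=> jk.
have E : (2 ^ (k - j) = 2 * 2 ^ (k - j.+1))%N by rewrite -expnS subnSK.
have sp (V : zmodType) u (f : nat -> V) : \sum_(u * 2 ^ (k - j) <= a < u.+1 * 2 ^ (k - j)) f a =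
   \sum_(s : bool) \sum_((u.*2 + s) * 2 ^ (k - j.+1) <= a < (u.*2 + s).+1 * 2 ^ (k - j.+1)) f a.
  rewrite big_bool /= E !mulnA !muln2 addn0 addn1 doubleS addrC -big_cat_nat //=;
    by rewrite leq_mul2r leqnSn orbT.
rewrite /cellsum sp; apply: eq_bigr => s _.
under eq_bigr do rewrite sp.
by rewrite exchange_big.
Qed.

Lemma Gam_dist x y x' y' : 0 <= x <= 1 ->
  nrm (Gam x y - Gam x' y') <= `|x - x'| + 16 * `|y - y'|.
Proof.
move=> /andP [x0 x1].
have -> : Gam x y - Gam x' y' = rc (r * x) * (cis y - cis y') + rc (r * (x - x')) * cis y'.
  have -> : rc (r * (x - x')) = rc (r * x) - rc (r * x') by rewrite mulrBr; exact: rmorphB.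
  by rewrite /Gam; ring.
apply: le_trans (nrmD _ _) _; rewrite addrC; apply: lerD.
  rewrite nrmM nrm_cis mulr1.
  have -> : nrm (rc (r * (x - x')) : C R) = r * `|x - x'|.
    by rewrite nrm_real normrM ger0_norm.
  by rewrite ler_piMl // ltW.
rewrite nrmM nrm_rc ?mulr_ge0 //.
apply: le_trans (cis_lip y y'); rewrite ler_piMl ?nrm_ge0 //.
by rewrite mulr_ile1 // ltW.
Qed.

Lemma nrm_Gam x y : 0 <= x <= 1 -> nrm (Gam x y) < 1.
Proof.
move=> /andP [x0 x1]; rewrite nrmM nrm_cis mulr1 nrm_rc ?mulr_ge0 //.
by apply: le_lt_trans r1; rewrite ler_piMr.
Qed.

Lemma grid01 k a : (a <= 2 ^ k)%N -> 0 <= (a%:R / 2 ^+ k : R) <= 1.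
Proof.
move=> h; have p2 : 0 < 2 ^+ k :> R by rewrite exprn_gt0.
by rewrite divr_ge0 ?(ltW p2) //= ler_pdivrMr // mul1r -natrX ler_nat.
Qed.

Lemma grid_dyad k j p a : (j <= k)%N -> (p * 2 ^ (k - j) <= a <= p.+1 * 2 ^ (k - j))%N ->
  dyad j p (a%:R / 2 ^+ k : R).
Proof.
move=> jk /andP [h1 h2].
have p2 i : 0 < 2 ^+ i :> R by rewrite exprn_gt0.
have E : 2 ^+ k = 2 ^+ (k - j) * 2 ^+ j :> R by rewrite -exprD subnK.
have sc (u : nat) : u%:R / 2 ^+ j = (u * 2 ^ (k - j))%:R / 2 ^+ k :> R.
  by rewrite E natrM natrX; field; rewrite !gt_eqF.
by rewrite /dyad !sc !ler_pM2r ?invr_gt0 // !ler_nat h1.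
Qed.

Lemma edge_h k a b : (a < 2 ^ k)%N -> nrm (gp k a.+1 b - gp k a b) <= 17 / 2 ^+ k.
Proof.
move=> h; have p2 : 0 < 2 ^+ k :> R by rewrite exprn_gt0.
apply: le_trans (Gam_dist _ _ _ (grid01 h)) _.
rewrite subrr normr0 mulr0 addr0 -mulrBl -natr1 addrC addKr ger0_norm ?divr_ge0 ?(ltW p2) //.
by rewrite ler_pM2r ?invr_gt0 // ler1n.
Qed.

Lemma edge_v k a b : (a <= 2 ^ k)%N -> nrm (gp k a b.+1 - gp k a b) <= 17 / 2 ^+ k.
Proof.
move=> h; have p2 : 0 < 2 ^+ k :> R by rewrite exprn_gt0.
apply: le_trans (Gam_dist _ _ _ (grid01 h)) _.
have -> : b.+1%:R / 2 ^+ k - b%:R / 2 ^+ k = 1 / 2 ^+ k :> R.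
  by rewrite -mulrBl -natr1 addrAC subrr add0r.
rewrite subrr normr0 add0r ger0_norm ?divr_ge0 ?(ltW p2) // mulrA.
by rewrite ler_pM2r ?invr_gt0 // mulr1 ler_nat.
Qed.

Lemma trap_le G u v (e d : R) : nrm (G u) <= e -> nrm (G v) <= e -> nrm (v - u) <= d ->
  nrm (trap G u v) <= e * d.
Proof.
move=> hu hv hd; rewrite /trap !nrmM.
have -> : nrm (2^-1 : C R) = 2^-1 by rewrite nrmV nrm_nat.
apply: ler_pM; rewrite ?mulr_ge0 ?nrm_ge0 //.
by have := nrmD (G u) (G v); lra.
Qed.

(** Four sides, each of length at most 17 / 2^j, with values at most 17 e / 2^j;
    17 = 1 + 16 bounds the Lipschitz constant of the polar coordinates. *)
Definition goursat_cst : R := 4 * (17 * 17).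
Lemma goursat_cst_gt0 : 0 < goursat_cst. Proof. by rewrite !mulr_gt0 // ltr0n. Qed.

Variable G : C R -> C R.
Hypothesis hG : forall z, nrm z < 1 -> derivable G z 1.

(** Goursat's estimate: near the point c the function differs from an affine one
    by at most e |w - c|, the affine function contributes 0 to each cell, and both
    the difference and the perimeter are of the order of 2^-j. *)
Lemma cellsum_local (e x y : R) : 0 < e -> 0 <= x <= 1 -> 0 <= y <= 1 ->
  exists J, forall j p q, (J <= j)%N -> dyad j p x -> dyad j q y -> (p < 2 ^ j)%N -> (q < 2 ^ j)%N ->
    forall k, (j <= k)%N -> nrm (cellsum G k j p q) <= goursat_cst * e / 4 ^+ j.
Proof.
move=> e0 x01 y01.
have [be hbe] := deriv_local (hG (nrm_Gam y x01)).
set c := Gam x y in hbe.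
have [d d0 hd] := hbe e e0.
have d17 : 0 < d / 17 by rewrite divr_gt0.
have [J hJ] := pow2_small d17.
exists J => j p q /hJ hj px qy pj qj k jk.
have p2 i : 0 < 2 ^+ i :> R by rewrite exprn_gt0.
pose E w := G w - (G c + be * (w - c)).
have SE : cellsum G k j p q = cellsum E k j p q.
  rewrite /cellsum; apply: eq_bigr => a _; apply: eq_bigr => b _.
  have -> : E = fun w => G w - ((G c - be * c) + be * w).
    by apply/funext => w; rewrite /E; ring.
  by rewrite cellB cell_affine subr0.
set m := (2 ^ (k - j))%N.
have m0 : (0 < m)%N by rewrite expn_gt0.
have km : (2 ^ k = 2 ^ j * m)%N by rewrite -expnD subnKC.
have hP a b : (p * m <= a <= p.+1 * m)%N -> (q * m <= b <= q.+1 * m)%N ->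
    nrm (E (gp k a b)) <= e * (17 / 2 ^+ j).
  move=> ha hb.
  have ha' : (a <= 2 ^ k)%N.
    by case/andP: ha => _ /leq_trans; apply; rewrite km leq_pmul2r.
  have dist : nrm (gp k a b - c) <= 17 / 2 ^+ j.
    apply: le_trans (Gam_dist _ _ _ (grid01 ha')) _.
    have := dyad_dist (grid_dyad jk ha) px; have := dyad_dist (grid_dyad jk hb) qy; lra.
  apply: le_trans (hd _ _) _; last by rewrite ler_wpM2l // ltW.
  by apply: le_lt_trans dist _; rewrite mulrC -ltr_pdivlMr.
have hmm u : (u * m <= u.+1 * m)%N by rewrite leq_mul2r leqnSn orbT.
rewrite SE /cellsum cell_boundary //.
have bnd : e * (17 / 2 ^+ j) * (17 / 2 ^+ k) *+ (4 * m) = goursat_cst * e / 4 ^+ j.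
  have -> : 4 ^+ j = 2 ^+ j * 2 ^+ j :> R by rewrite -exprMn; congr (_ ^+ _); ring.
  rewrite -mulr_natr natrM.
  have -> : 2 ^+ k = 2 ^+ j * m%:R :> R by rewrite natrX -exprD subnKC.
  by rewrite /goursat_cst; field; rewrite !gt_eqF // ltr0n.
rewrite -bnd; set B := e * _ * _.
apply: le_trans (nrmD _ _) _.
have nn u : (\sum_(u * m <= i < u.+1 * m) B = B *+ m)%R.
  by rewrite sumr_const_nat mulSn addnK.
have -> : B *+ (4 * m) = (B + B) *+ m + (B + B) *+ m.
  by rewrite -[LHS]mulr_natr -![(B + B) *+ m]mulr_natr natrM; ring.
have two u : (\sum_(u * m <= i < u.+1 * m) (B + B) = (B + B) *+ m)%R.
  by rewrite sumr_const_nat mulSn addnK.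
apply: lerD.
  rewrite -(two p); apply: le_trans (nrm_sum _ _ _) _.
  rewrite big_nat [leRHS]big_nat; apply: ler_sum => a /andP [a1 a2].
  have a3 : (a < 2 ^ k)%N by apply: leq_trans a2 _; rewrite km leq_pmul2r.
  apply: le_trans (nrmB _ _) _; apply: lerD; apply: trap_le; rewrite ?edge_h //; apply: hP;
    by rewrite ?a1 ?(ltnW a2) ?leqnn ?hmm ?(leq_trans a1) ?leqnSn.
rewrite -(two q); apply: le_trans (nrm_sum _ _ _) _.
rewrite big_nat [leRHS]big_nat; apply: ler_sum => b /andP [b1 b2].
have p3 : (p.+1 * m <= 2 ^ k)%N by rewrite km leq_pmul2r.
apply: le_trans (nrmB _ _) _; apply: lerD; apply: trap_le; rewrite ?edge_v //; try apply: hP;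
  by rewrite ?b1 ?(ltnW b2) ?leqnn ?hmm ?(leq_trans b1) ?leqnSn ?(leq_trans (hmm p)).
Qed.

(** The quarter squares have a quarter of the allowed error, so the bound
    e / 4^j passes from the quarters to the square. *)
Lemma goursat (e : R) : 0 < e -> exists k0, forall k, (k0 <= k)%N -> nrm (cellsum G k 0 0 0) <= e.
Proof.
move=> e0; pose e1 := e / goursat_cst.
have e10 : 0 < e1 by rewrite divr_gt0 // goursat_cst_gt0.
pose P j p q := (p < 2 ^ j)%N -> (q < 2 ^ j)%N ->
   exists k0, forall k, (k0 <= k)%N -> (j <= k)%N -> nrm (cellsum G k j p q) <= goursat_cst * e1 / 4 ^+ j.
suff /(_ isT isT) [k0 hk0] : P 0%N 0%N 0%N.
  exists k0 => k kk; have := hk0 k kk isT.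
  by rewrite expr0 divr1 /e1 mulrCA divff ?mulr1 // gt_eqF // goursat_cst_gt0.
apply: bisect.
- move=> j p q h pj qj.
  have hh (st : bool * bool) : exists k0, forall k, (k0 <= k)%N -> (j.+1 <= k)%N ->
     nrm (cellsum G k j.+1 (p.*2 + st.1) (q.*2 + st.2)) <= goursat_cst * e1 / 4 ^+ j.+1.
    have lt u (s : bool) : (u < 2 ^ j -> u.*2 + s < 2 ^ j.+1)%N.
      move=> uj; rewrite expnS mul2n; apply: leq_trans (_ : u.+1.*2 <= _)%N; last by rewrite leq_double.
      by rewrite doubleS; case: s; rewrite ?addn1 ?addn0.
    by apply: h; exact: lt.
  have [f hf] := choice hh.
  exists (maxn j.+1 (\max_(st : bool * bool) f st)) => k; rewrite geq_max => /andP [h1 h2] _.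
  rewrite cellsum_split //.
  have fk st : (f st <= k)%N by apply: leq_trans h2; exact: leq_bigmax.
  apply: le_trans (_ : \sum_(s : bool) \sum_(t : bool) goursat_cst * e1 / 4 ^+ j.+1 <= _).
    apply: le_trans (nrm_sum _ _ _) _; apply: ler_sum => s _.
    apply: le_trans (nrm_sum _ _ _) _; apply: ler_sum => t _.
    exact: (hf (s, t)).
  rewrite !big_bool /= exprS le_eqVlt; apply/orP; left; apply/eqP; field.
  by rewrite gt_eqF // exprn_gt0.
- move=> x y x01 y01; have [J hJ] := cellsum_local e10 x01 y01; exists J => j p q Jj px qy pj qj.
  by exists 0%N => k _ jk; exact: (hJ j p q).
Qed.

(** The side of radius 0 is a point, and the two sides of angles 0 and 2 pi
    coincide; only the circle of radius r remains. *)
Lemma cellsum_whole k : cellsum G k 0 0 0 = \sum_(0 <= b < 2 ^ k) vedge G k (2 ^ k) b.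
Proof.
rewrite /cellsum subn0 !mul0n !mul1n cell_boundary //.
have p2 : 2 ^+ k != 0 :> R by rewrite expf_neq0.
rewrite big1 ?add0r => [|a _].
  apply: eq_bigr => b _; have z b' : gp k 0 b' = 0.
    by rewrite /gp /Gam mul0r mulr0 mul0r.
  by rewrite /vedge [X in _ - trap _ X _]z [X in _ - trap _ _ X]z /trap subrr mulr0 subr0.
rewrite /hedge.
have w a' : gp k a' (2 ^ k) = gp k a' 0.
  by rewrite /gp /Gam mul0r natrX divff // cis1 cis0.
by rewrite !w subrr.
Qed.

(** On the circle of radius r the trapezoidal sum is a multiple of the mean of
    G(r u) u over the 2^k-th roots of unity u.  The factor om - om^-1 is of exact
    order 2^-k because om^2 has the power -1 with exponent 2^(k-2). *)
Lemma cauchy_mean (e : R) : 0 < r -> 0 < e -> exists k0, forall k, (k0 <= k)%N ->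
  nrm ((2 ^+ k)^-1 * \sum_(b < 2 ^ k) G (rc r * cis (b%:R / 2 ^+ k)) * cis (b%:R / 2 ^+ k)) <= e.
Proof.
move=> rp e0.
have er : 0 < e * (r * 4) by rewrite !mulr_gt0.
have [k0 hk0] := goursat er.
exists (maxn k0 2) => k; rewrite geq_max => /andP [kk k2].
have p2 : 0 < 2 ^+ k :> R by rewrite exprn_gt0.
have p2c : 2 ^+ k != 0 :> C R by rewrite expf_neq0 // pnatr_eq0.
pose om : C R := cis ((2 ^+ k)^-1).
pose g b := G (rc r * cis (b%:R / 2 ^+ k)).
pose z b : C R := cis (b%:R / 2 ^+ k).
have zS b : z b.+1 = z b * om.
  by rewrite /z -natr1 mulrDl mul1r cisD.
have gN : g (2 ^ k)%N = g 0%N by rewrite /g natrX divff ?gt_eqF // mul0r cis1 cis0.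
have zN : z (2 ^ k)%N = z 0%N by rewrite /z natrX divff ?gt_eqF // mul0r cis1 cis0.
have E : cellsum G k 0 0 0 = rc r * ((om - om^-1) / 2) * \sum_(b < 2 ^ k) g b * z b.
  rewrite cellsum_whole.
  have omn : om != 0 by exact: cis_neq0.
  have -> : \sum_(0 <= b < 2 ^ k) vedge G k (2 ^ k) b
     = \sum_(0 <= b < 2 ^ k) (rc r / 2 * (g b * z b * (om - 1)) + rc r / 2 * (g b.+1 * z b.+1 * (1 - om^-1))).
    apply: eq_bigr => b _; rewrite /vedge /trap.
    have gpE b' : gp k (2 ^ k) b' = rc r * z b'.
      by rewrite /gp /Gam natrX divff ?gt_eqF // mulr1.
    rewrite !gpE.
    have gE b' : G (rc r * z b') = g b' by [].
    rewrite !gE zS; field.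
    by rewrite ?omn ?pnatr_eq0.
  rewrite big_split /=.
  have -> : \sum_(0 <= b < 2 ^ k) (rc r / 2 * (g b.+1 * z b.+1 * (1 - om^-1)))
      = \sum_(0 <= b < 2 ^ k) (rc r / 2 * (g b * z b * (1 - om^-1))).
    apply/eqP; rewrite -subr_eq0 -sumrB.
    rewrite (telescope_sumr (fun b => rc r / 2 * (g b * z b * (1 - om^-1)))) //.
    by rewrite gN zN subrr.
  rewrite -big_split /= big_mkord mulr_sumr; apply: eq_bigr => b _.
  by field; rewrite ?omn ?pnatr_eq0.
(* 2 = |om^(2M) - 1| <= M |om^2 - 1| with 4 M = 2^k. *)
have om2 : 8 <= 2 ^+ k * nrm (om - om^-1).
  have -> : nrm (om - om^-1) = nrm (om ^+ 2 - 1).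
    have -> : om ^+ 2 - 1 = om * (om - om^-1).
      by rewrite mulrBr divff ?cis_neq0.
    by rewrite nrmM nrm_cis mul1r.
  pose M := (2 ^ (k - 2))%N.
  have hM : (om ^+ 2) ^+ M = -1.
    rewrite -exprM cisX -cis_half; congr cis.
    have -> : 2 ^+ k = 4 * M%:R :> R.
      by rewrite natrX -[in LHS](subnKC k2) exprD; congr (_ * _); ring.
    rewrite natrM; field; rewrite pnatr_eq0 -lt0n expn_gt0 //.
  have hle n : nrm ((om ^+ 2) ^+ n - 1) <= n%:R * nrm (om ^+ 2 - 1).
    elim: n => [|n ih]; first by rewrite expr0 subrr nrm0 mul0r.
    have -> : (om ^+ 2) ^+ n.+1 - 1 = (om ^+ 2) ^+ n * (om ^+ 2 - 1) + ((om ^+ 2) ^+ n - 1).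
      by rewrite exprSr; ring.
    apply: le_trans (nrmD _ _) _; rewrite nrmM !nrmX nrm_cis !expr1n mul1r.
    by rewrite -natr1 mulrDl mul1r addrC lerD2r.
  have := hle M; rewrite hM.
  have -> : nrm (-1 - 1 : C R) = 2.
    have -> : -1 - 1 = - 2 :> C R by ring.
    by rewrite nrmN nrm_nat.
  have -> : 2 ^+ k = 4 * M%:R :> R.
    by rewrite natrX -[in LHS](subnKC k2) exprD; congr (_ * _); ring.
  lra.
have := hk0 k kk; rewrite E nrmM nrmM nrm_rc // nrmM.
have -> : nrm (2^-1 : C R) = 2^-1 by rewrite nrmV nrm_nat.
rewrite nrmM nrmV nrmX.
have -> : nrm (2 : C R) = 2 by rewrite nrm_nat.
set s := nrm (\sum_(b < _) _); set d := nrm (om - _) in om2 *.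
have s0 : 0 <= s := nrm_ge0 _.
move=> h; rewrite mulrC ler_pdivrMr //.
have h1 : r * (d / 2) * s = (r * s) * (d / 2) by ring.
have rs : 0 <= r * s by rewrite mulr_ge0.
have h2 : (r * s) * 8 <= (r * s) * (2 ^+ k * d) by rewrite ler_wpM2l.
have h3 : (r * s) * (2 ^+ k * d) <= 2 ^+ k * 2 * (e * (r * 4)).
  have -> : (r * s) * (2 ^+ k * d) = 2 ^+ k * 2 * (r * (d / 2) * s) by field.
  by rewrite ler_wpM2l // mulr_ge0 // ltW.
have h4 : r * 8 * s <= r * 8 * (e * 2 ^+ k).
  by move: (le_trans h2 h3); lra.
by move: h4; rewrite ler_pM2l ?mulr_gt0.
Qed.

End Goursat.

(** * Uniform estimates on the circle and the disc *)

Section Uniform.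
Variable R : realType.
Notation rc := (real_complex R).

Lemma within_eps (A : set (C R)) (F : C R -> C R) : {within A, continuous F} ->
  forall z, A z -> forall e : R, 0 < e -> exists2 d : R, 0 < d &
    forall w, A w -> nrm (w - z) < d -> nrm (F w - F z) < e.
Proof.
move=> cF z Az e e0.
have /nrm_cvgP /(_ e e0) : F @ within A (nbhs z) --> F z.
  by move: z Az; apply/subspace_continuousP.
move=> /nbhs_normP [d /= d0 hd].
have dr : d = rc (complex.Re d) by rewrite RRe_real // gtr0_real.
exists (complex.Re d); first by rewrite -rc_lt -dr rmorph0.
move=> w Aw hw; rewrite nrm_distC; apply: (hd w) => //.
by rewrite /ball_ /= nrmE dr rc_lt nrm_distC.
Qed.

Lemma circle_cis y : (cis y : C R) \in circle R.
Proof. by apply/mem_set; rewrite /circle /= nrmE nrm_cis rmorph1. Qed.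

(** The point of the circle with angle 2 pi y. *)
Definition cpt (y : R) : circle R := SigSub (circle_cis y).

Lemma nrm_circle (t : circle R) : nrm (val t : C R) = 1.
Proof. by apply: rc_inj; rewrite -nrmE rmorph1; exact: (set_mem (valP t)). Qed.

Lemma cpt_surj (t : circle R) : exists2 y : R, 0 <= y <= 1 & t = cpt y.
Proof.
have [y hy E] := cis_surj (nrm_circle t); exists y => //.
by apply: val_inj.
Qed.

Lemma circle_eps (h : circle R -> C R) : continuous h ->
  forall t (e : R), 0 < e -> exists2 d : R, 0 < d &
    forall s, nrm (val s - val t : C R) < d -> nrm (h s - h t) < e.
Proof.
move=> ch t e e0.
pose F (z : C R) : C R := if insub z is Some u then h (u : circle R) else 0.
have Fh (s : circle R) : F (val s) = h s by rewrite /F valK.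
have cF : {within circle R, continuous F}.
  apply/subspace_sigL_continuousP.
  have -> : sigL (circle R) F = h by apply/funext => s; exact: Fh.
  exact: ch.
have [d d0 hd] := within_eps cF (set_mem (valP t)) e0.
exists d => // s hs; rewrite -!Fh; apply: hd => //; exact: (set_mem (valP s)).
Qed.

(** The form of uniform continuity that Korovkin's argument uses: where s and t
    are far apart, the bound 2 B of the oscillation is absorbed by the quadratic
    term. *)
Lemma circle_quad (h : circle R -> C R) (e : R) : continuous h -> 0 < e ->
  exists2 K : R, 0 <= K & forall s t, nrm (h s - h t) <= e + K * nrm (val s - val t : C R) ^+ 2.
Proof.
move=> ch e0.
(* Boundedness and the estimate itself are both proved by bisection of the
   interval of angles. *)
have [B B0 hB] : exists2 B : R, 0 <= B & forall t, nrm (h t) <= B.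
  pose P (j p q : nat) := exists2 B : R, 0 <= B & forall y, dyad j q y -> nrm (h (cpt y)) <= B.
  suff [B B0 hB] : P 0%N 0%N 0%N.
    exists B => // t; have [y y01 ->] := cpt_surj t; apply: hB.
    by rewrite /dyad expr0 !divr1.
  apply: (@bisect R).
    move=> j p q hPst.
    have [B1 B10 h1] := hPst false false; have [B2 B20 h2] := hPst false true.
    exists (B1 + B2); rewrite ?addr_ge0 // => y; rewrite (dyad_split j q y) => /orP [hy|hy].
      by apply: le_trans (h1 y _) _; rewrite ?lerDl ?addn0.
    by apply: le_trans (h2 y _) _; rewrite ?lerDr ?addn1.
  move=> x y _ y01.
  have [d d0 hd] := circle_eps ch (cpt y) ltr01.
  have [J hJ] := pow2_small (divr_gt0 d0 (ltr0n R 16)).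
  exists J => j p q /hJ hj _ hq; exists (nrm (h (cpt y)) + 1).
    by rewrite addr_ge0 ?nrm_ge0.
  move=> y' hy'.
  have : nrm (h (cpt y') - h (cpt y)) < 1.
    apply: hd; apply: le_lt_trans (cis_lip _ _) _.
    rewrite mulrC -ltr_pdivlMr //; apply: le_lt_trans hj; exact: dyad_dist hy' hq.
  by have := nrmD (h (cpt y') - h (cpt y)) (h (cpt y)); rewrite subrK; lra.
pose P (j p q : nat) := exists2 K : R, 0 <= K & forall y, dyad j q y -> forall t,
  nrm (h (cpt y) - h t) <= e + K * nrm (cis y - val t : C R) ^+ 2.
suff [K K0 hK] : P 0%N 0%N 0%N.
  exists K => // s t; have [y y01 ->] := cpt_surj s; apply: hK.
  by rewrite /dyad expr0 !divr1.
apply: (@bisect R).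
  move=> j p q hPst.
  have [B1 B10 h1] := hPst false false; have [B2 B20 h2] := hPst false true.
  exists (B1 + B2); rewrite ?addr_ge0 // => y; rewrite (dyad_split j q y) => /orP [hy|hy] t.
    apply: le_trans (h1 y _ t) _; rewrite ?addn0 //.
    by rewrite lerD2l ler_wpM2r ?sqr_ge0 // lerDl.
  apply: le_trans (h2 y _ t) _; rewrite ?addn1 //.
  by rewrite lerD2l ler_wpM2r ?sqr_ge0 // lerDr.
move=> x y _ y01.
have e2 : 0 < e / 2 by rewrite divr_gt0.
have [d d0 hd] := circle_eps ch (cpt y) e2.
have d2 : 0 < d / 2 by rewrite divr_gt0.
have [J hJ] := pow2_small (divr_gt0 d2 (ltr0n R 16)).
exists J => j p q /hJ hj _ hq; exists (2 * B / (d / 2) ^+ 2).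
  by rewrite divr_ge0 ?sqr_ge0 // mulr_ge0.
move=> y' hy' t.
have yy : nrm (cis y' - cis y) < d / 2.
  apply: le_lt_trans (cis_lip _ _) _.
  rewrite mulrC -ltr_pdivlMr //; apply: le_lt_trans hj; exact: dyad_dist hy' hq.
have [lt|ge] := ltP (nrm (cis y' - val t : C R)) (d / 2).
  have h1 : nrm (h (cpt y') - h (cpt y)) < e / 2 by apply: hd => /=; lra.
  have h2 : nrm (h t - h (cpt y)) < e / 2.
    apply: hd => /=; have := nrmD (val t - cis y') (cis y' - cis y); rewrite addrA subrK.
    by rewrite (nrm_distC (val t) (cis y')); move: lt yy; lra.
  apply: (@le_trans _ _ e).
    have := nrmB (h (cpt y') - h (cpt y)) (h t - h (cpt y)).
    by rewrite opprB addrA subrK; lra.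
  rewrite lerDl; apply: mulr_ge0; last exact: sqr_ge0.
  by rewrite divr_ge0 ?sqr_ge0 // mulr_ge0.
apply: (@le_trans _ _ (2 * B)).
  by have := nrmB (h (cpt y')) (h t); have := hB (cpt y'); have := hB t; lra.
apply: (@le_trans _ _ (2 * B / (d / 2) ^+ 2 * (d / 2) ^+ 2)).
  by rewrite divfK // expf_neq0 // gt_eqF.
apply: ler_wpDl; first exact: ltW.
rewrite ler_wpM2l ?divr_ge0 ?sqr_ge0 ?mulr_ge0 //.
by rewrite ler_pXn2r ?nnegrE ?nrm_ge0 // ltW.
Qed.

Lemma radial_unif (F : C R -> C R) (e : R) : {within [set z : C R | `|z| <= 1], continuous F} ->
  0 < e -> exists2 d : R, 0 < d & forall rho y : R, 1 - d < rho -> 0 <= rho <= 1 -> 0 <= y <= 1 ->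
    nrm (F (rc rho * cis y) - F (cis y)) <= e.
Proof.
move=> cF e0.
pose P (j p q : nat) := exists2 d : R, 0 < d & forall rho y : R, 1 - d < rho -> 0 <= rho <= 1 ->
  dyad j q y -> nrm (F (rc rho * cis y) - F (cis y)) <= e.
suff [d d0 hd] : P 0%N 0%N 0%N.
  exists d => // rho y h1 h2 y01; apply: hd => //.
  by rewrite /dyad expr0 !divr1.
apply: (@bisect R).
  move=> j p q hPst.
  have [d1 d10 h1] := hPst false false; have [d2 d20 h2] := hPst false true.
  exists (Num.min d1 d2); first by rewrite lt_min d10.
  move=> rho y hr r01; rewrite (dyad_split j q y) => /orP [hy|hy].
    apply: h1 => //; rewrite ?addn0 //; apply: le_lt_trans hr.
    by rewrite lerD2l lerN2 ge_min lexx.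
  apply: h2 => //; rewrite ?addn1 //; apply: le_lt_trans hr.
  by rewrite lerD2l lerN2 ge_min lexx orbT.
move=> x y _ y01.
have e2 : 0 < e / 2 by rewrite divr_gt0.
have inA rho y' : 0 <= rho <= 1 -> [set z : C R | `|z| <= 1] (rc rho * cis y').
  move=> /andP [r0 r1]; rewrite /= nrmE nrmM nrm_cis mulr1 nrm_rc //.
  by rewrite -(rmorph1 (real_complex R)) rc_le.
have one : 0 <= (1 : R) <= 1 by rewrite ler01 lexx.
have [d d0 hd] := within_eps cF (inA 1 y one) e2.
rewrite rmorph1 mul1r in hd.
have d2 : 0 < d / 2 by rewrite divr_gt0.
have [J hJ] := pow2_small (divr_gt0 d2 (ltr0n R 16)).
exists J => j p q /hJ hj _ hq; exists (d / 2) => // rho y' hr r01 hy'.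
have yy : nrm (cis y' - cis y) < d / 2.
  apply: le_lt_trans (cis_lip _ _) _.
  rewrite mulrC -ltr_pdivlMr //; apply: le_lt_trans hj; exact: dyad_dist hy' hq.
have h1 : nrm (F (cis y') - F (cis y)) < e / 2.
  apply: hd; last by lra.
  by have := inA 1 y' one; rewrite rmorph1 mul1r.
have h2 : nrm (F (rc rho * cis y') - F (cis y)) < e / 2.
  apply: hd; first exact: inA.
  have -> : rc rho * cis y' - cis y = (cis y' - cis y) - rc (1 - rho) * cis y'.
    have -> : rc (1 - rho) = 1 - rc rho by rewrite -(rmorph1 (real_complex R)); exact: rmorphB.
    by ring.
  apply: le_lt_trans (nrmB _ _) _; rewrite nrmM nrm_cis mulr1 nrm_rc; lra.
have := nrmB (F (rc rho * cis y') - F (cis y)) (F (cis y') - F (cis y)).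
by rewrite opprB addrA subrK; lra.
Qed.

(** The Fourier coefficients of f with negative index vanish, with Riemann sums
    in the place of the integrals.  Cauchy's theorem is applied to z^m F on a
    circle of radius rho < 1, and rho tends to 1. *)
Lemma disc_fourier f m (e : R) : @disc_algebra R f -> 0 < e -> exists k0, forall k, (k0 <= k)%N ->
  nrm ((2 ^+ k)^-1 * \sum_(b < 2 ^ k) f (cpt (b%:R / 2 ^+ k)) * cis (b%:R / 2 ^+ k) ^+ m.+1) <= e.
Proof.
move=> [F [cF dF hF]] e0.
have e2 : 0 < e / 2 by rewrite divr_gt0.
have [d d0 hd] := radial_unif cF e2.
pose rho : R := Num.max (1 / 2) (1 - d / 2).
have rho0 : 0 < rho by rewrite lt_max divr_gt0.
have rho1 : rho < 1 by rewrite gt_max; apply/andP; split; lra.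
have rhod : 1 - d < rho by rewrite lt_max; apply/orP; right; lra.
pose G z := z ^+ m * F z.
have hG z : nrm z < 1 -> derivable G z 1.
  move=> hz; apply: derivableM; first exact: exprn_derivable.
  by apply: dF; rewrite nrmE -(rmorph1 (real_complex R)) rc_lt.
have er : 0 < e / 2 * rho ^+ m by rewrite mulr_gt0 // exprn_gt0.
have [k0 hk0] := cauchy_mean (ltW rho0) rho1 hG rho0 er.
exists k0 => k /hk0 {}hk0.
have p2 : 0 < 2 ^+ k :> R by rewrite exprn_gt0.
have nv : nrm ((2 ^+ k)^-1 : C R) = (2 ^+ k)^-1.
  by rewrite nrmV nrmX nrm_nat.
pose y (b : nat) : R := b%:R / 2 ^+ k.
have y01 (b : 'I_(2 ^ k)) : 0 <= y b <= 1.
  by rewrite divr_ge0 ?(ltW p2) //= ler_pdivrMr // mul1r -natrX ler_nat ltnW.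
have E1 : \sum_(b < 2 ^ k) G (rc rho * cis (y b)) * cis (y b)
   = rc rho ^+ m * \sum_(b < 2 ^ k) F (rc rho * cis (y b)) * cis (y b) ^+ m.+1.
  by rewrite mulr_sumr; apply: eq_bigr => b _; rewrite /G exprMn exprS; ring.
move: hk0; rewrite E1 mulrCA nrmM nrmX nrm_rc ?(ltW rho0) // mulrC ler_pM2r ?exprn_gt0 //.
set s1 := \sum_b _ => h1.
rewrite -/(y _); set s2 := \sum_b _.
have h2 : nrm ((2 ^+ k)^-1 * (s1 - s2)) <= e / 2.
  rewrite nrmM nv mulrC ler_pdivrMr // -sumrB.
  apply: le_trans (nrm_sum _ _ _) _.
  apply: (@le_trans _ _ (\sum_(b < 2 ^ k) e / 2)); last first.
    by rewrite sumr_const card_ord -natrX mulr_natr.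
  apply: ler_sum => b _; rewrite hF /= -mulrBl nrmM nrmX nrm_cis expr1n mulr1.
  by apply: hd => //; rewrite (ltW rho0) (ltW rho1).
have -> : (2 ^+ k)^-1 * s2 = (2 ^+ k)^-1 * s1 - (2 ^+ k)^-1 * (s1 - s2).
  by rewrite -mulrBr opprB addrC subrK.
by apply: le_trans (nrmB _ _) _; lra.
Qed.

End Uniform.

(** * Fejer means and Korovkin's theorem *)

Section Fejer.
Variable R : realType.
Notation rc := (real_complex R).

(** The characters of the circle. *)
Definition zc (m : int) (t : circle R) : C R := val t ^ m.

Lemma cisz y (m : int) : (cis y : C R) ^ m = cis (m%:~R * y).
Proof.
case: m => n; first by rewrite -exprnP cisX.
by rewrite NegzE -exprnN cisX cisV // -mulNr mulrNz.
Qed.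

Lemma zc_cpt m y : zc m (cpt y) = cis (m%:~R * y).
Proof. exact: cisz. Qed.

Lemma nrm_zc m t : nrm (zc m t) = 1.
Proof. by have [y _ ->] := cpt_surj t; rewrite zc_cpt nrm_cis. Qed.

Lemma zcD m k t : zc (m + k) t = zc m t * zc k t.
Proof. by have [y _ ->] := cpt_surj t; rewrite !zc_cpt intrD mulrDl cisD. Qed.

Lemma zc0 t : zc 0 t = 1. Proof. by rewrite /zc expr0z. Qed.

Lemma zc_conj m t : Num.conj (zc m t) = zc (- m) t.
Proof. by have [y _ ->] := cpt_surj t; rewrite !zc_cpt cis_conj mulrNz mulNr. Qed.

Lemma cont_val : continuous (fun t : circle R => val t : C R).
Proof. by have := @initial_continuous (circle R) (C R) set_val; exact. Qed.

Lemma cont_zc m : continuous (zc m).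
Proof.
have cX n : continuous (fun t : circle R => (val t : C R) ^+ n).
  elim: n => [|n ih].
    have -> : (fun t : circle R => (val t : C R) ^+ 0) = fun=> 1 by [].
    exact: cont_cst.
  have -> : (fun t : circle R => (val t : C R) ^+ n.+1) = fun t => val t * val t ^+ n.
    by apply/funext => t; rewrite exprS.
  by have h := cont_mul cont_val ih; exact: h.
case: m => n; first exact: (cX n).
have -> : zc (Negz n) = fun t => Num.conj (val t ^+ n.+1).
  apply/funext => t; rewrite NegzE -[zc _ t]zc_conj; congr (Num.conj _).
by have h := cont_conj (cX n.+1); exact: h.
Qed.

(** The real part is 1 - 2 sin^2 (pi y), and this sine does not vanish. *)
Lemma cis_ne1 (y : R) : 0 < y < 1 -> cis y != 1.
Proof.
move=> /andP [y0 y1]; apply/eqP => /(congr1 (@complex.Re R)) /=.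
have -> : pi *+ 2 * y = (pi * y) *+ 2 by rewrite mulrnAl.
rewrite cos_mulr2n => h.
have s0 : 0 < sin (pi * y).
  by apply: sin_gt0_pi; rewrite mulr_gt0 ?pi_gt0 //= gtr_pMr // pi_gt0.
have := cos2Dsin2 (pi * y); have : 0 < sin (pi * y) ^+ 2 by rewrite exprn_gt0.
by rewrite mulr2n in h; lra.
Qed.

Lemma cis_int (m : int) : cis m%:~R = 1 :> C R.
Proof. by rewrite -[m%:~R]mulr1 -cisz cis1 exp1rz. Qed.

(** Orthogonality of the characters of the cyclic group of order N. *)
Lemma cis_sum0 N (d : int) : (0 < N)%N -> d != 0 -> (`|d| < N)%N ->
  \sum_(b < N) cis (d%:~R * (b%:R / N%:R)) = 0 :> C R.
Proof.
move=> N0 d0 dN; set w : C R := cis (d%:~R / N%:R).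
have Nn : N%:R != 0 :> R by rewrite pnatr_eq0 -lt0n.
have -> : \sum_(b < N) cis (d%:~R * (b%:R / N%:R)) = \sum_(b < N) w ^+ b.
  by apply: eq_bigr => b _; rewrite cisX mulrCA.
have wN : w ^+ N = 1.
  by rewrite cisX mulrCA divff // mulr1 cis_int.
have w1 : w != 1.
  have pos n : (0 < n < N)%N -> cis (n%:R / N%:R : R) != 1.
    move=> /andP [n0 nN]; apply: cis_ne1.
    by rewrite divr_gt0 ?ltr0n //= ltr_pdivrMr ?ltr0n // mul1r ltr_nat.
  case: (d) d0 dN @w wN => n d0 dN w wN; first by apply: pos; apply/andP; split; [rewrite lt0n|].
  rewrite /w NegzE mulrNz mulNr -cis_conj; apply/eqP => h.
  have := congr1 Num.conj h; rewrite conjCK rmorph1 => h'.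
  by have := pos n.+1 dN; rewrite h' eqxx.
have : (w - 1) * \sum_(b < N) w ^+ b = w ^+ N - 1 by rewrite subrX1.
by rewrite wN subrr => /eqP; rewrite mulf_eq0 subr_eq0 (negbTE w1) /= => /eqP.
Qed.

(** The number of sample points: a power of 2, as in [disc_fourier], and larger
    than 2 n, so that the frequencies from -n to n are not aliased. *)
Definition NN n := (2 ^ n.+1)%N.

Lemma NN_gt n : (n.*2 < NN n)%N.
Proof. by rewrite /NN expnS mul2n ltn_double ltn_expl. Qed.

(** The equidistant sample points. *)
Definition fp n b : circle R := cpt (b%:R / 2 ^+ n.+1).

(** The discrete Fourier coefficients of h. *)
Definition fc n (h : circle R -> C R) (m : int) : C R :=
  (2 ^+ n.+1)^-1 * \sum_(b < NN n) h (fp n b) * Num.conj (zc m (fp n b)).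

Lemma fc_zc n (m i : int) : (`|m - i| < NN n)%N -> fc n (zc m) i = (m == i)%:R.
Proof.
move=> h; rewrite /fc.
have E b : zc m (fp n b) * Num.conj (zc i (fp n b)) = cis ((m - i)%:~R * (b%:R / (NN n)%:R)).
  by rewrite zc_conj -zcD zc_cpt natrX.
under eq_bigr do rewrite E.
have [->|mi] := eqVneq m i.
  under eq_bigr do rewrite subrr mul0r cis0.
  by rewrite sumr_const card_ord natrX mulVf // expf_neq0 // pnatr_eq0.
by rewrite cis_sum0 ?mulr0 ?expn_gt0 // subr_eq0.
Qed.

Lemma fcD n f g m : fc n (f + g) m = fc n f m + fc n g m.
Proof.
by rewrite /fc -mulrDr -big_split; congr (_ * _); apply: eq_bigr => b _; rewrite fctE mulrDl.
Qed.
Lemma fcZ n c f m : fc n (fun t => c * f t) m = c * fc n f m.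
Proof.
by rewrite /fc mulrCA; congr (_ * _); rewrite mulr_sumr; apply: eq_bigr => b _; rewrite mulrA.
Qed.

Section Mod.
Variable X : lmodType (C R).
(** The Fejer mean of order n of h with the characters z^m replaced by p m.  With
    p m = z^m this is a function, with p m = U^m x it approximates the
    multiplication by h applied to x. *)
Definition fej n (h : circle R -> C R) (p : int -> X) : X :=
  (n.+1%:R^-1 : C R) *: \sum_(k < n.+1) \sum_(l < n.+1)
     fc n h (k%:Z - l%:Z) *: p (k%:Z - l%:Z).

Lemma fejD n f g p : fej n (f + g) p = fej n f p + fej n g p.
Proof.
rewrite /fej -scalerDr -big_split; congr (_ *: _); apply: eq_bigr => k _.
by rewrite -big_split; apply: eq_bigr => l _; rewrite fcD scalerDl.
Qed.
Lemma fejZ n c f p : fej n (fun t => c * f t) p = c *: fej n f p.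
Proof.
rewrite /fej scalerA mulrC -scalerA; congr (_ *: _); rewrite scaler_sumr.
apply: eq_bigr => k _; rewrite scaler_sumr; apply: eq_bigr => l _.
by rewrite fcZ scalerA.
Qed.

(** The Fejer weight 1 - |m| / (n + 1), written as a proportion of pairs (k, l)
    with k - l = m. *)
Definition kap n (m : int) : R := n.+1%:R^-1 * \sum_(k < n.+1) \sum_(l < n.+1) (k%:Z - l%:Z == m)%:R.

Lemma fej_zc n m p : (`|m| <= n)%N -> fej n (zc m) p = rc (kap n m) *: p m.
Proof.
move=> mn; rewrite /fej /kap.
have -> : rc (n.+1%:R^-1 * \sum_(k < n.+1) \sum_(l < n.+1) (k%:Z - l%:Z == m)%:R)
  = n.+1%:R^-1 * \sum_(k < n.+1) \sum_(l < n.+1) (k%:Z - l%:Z == m)%:R :> C R.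
  rewrite [LHS](rmorphM (real_complex R)) fmorphV rmorph_nat; congr (_ * _).
  rewrite [LHS](rmorph_sum (real_complex R)); apply: eq_bigr => k _.
  by rewrite [LHS](rmorph_sum (real_complex R)); apply: eq_bigr => l _; rewrite [LHS]rmorph_nat.
rewrite -scalerA; congr (_ *: _); rewrite scaler_suml; apply: eq_bigr => k _.
rewrite scaler_suml; apply: eq_bigr => l _.
rewrite fc_zc; last first.
  have := NN_gt n; have := ltn_ord k; have := ltn_ord l; lia.
by rewrite eq_sym; case: eqP => [->|]; rewrite ?scale0r.
Qed.
End Mod.

(** For each k at most one l contributes, and the pairs (l + m, l) with
    l <= n - m all do. *)
Lemma kap_bounds n m : (`|m| <= n)%N -> 1 - (`|m|%N)%:R / n.+1%:R <= kap n m <= 1.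
Proof.
move=> mn.
have n1 : 0 < n.+1%:R :> R by rewrite ltr0n.
have row k : \sum_(l < n.+1) (k%:Z - l%:Z == m)%:R <= 1 :> R.
  have [[l hl]|h] := pselect (exists l : 'I_n.+1, k%:Z - l%:Z = m).
    rewrite (bigD1 l) //= hl eqxx big1 ?addr0 // => l' /eqP ll.
    case: eqP => // h; exfalso; apply: ll; apply: val_inj => /=; lia.
  rewrite big1 // => l _; case: eqP => // hl; exfalso; apply: h; by exists l.
have up : kap n m <= 1.
  rewrite /kap mulrC ler_pdivrMr // mul1r.
  apply: le_trans (_ : \sum_(k < n.+1) 1 <= _); first by apply: ler_sum.
  by rewrite sumr_const card_ord.
rewrite up andbT /kap.
have hsum : (n.+1 - `|m|)%:R <= \sum_(k < n.+1) \sum_(l < n.+1) (k%:Z - l%:Z == m)%:R :> R.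
  have gen (a : nat) (f : 'I_n.+1 -> 'I_n.+1 -> bool) : (a <= n)%N ->
     (forall k l : 'I_n.+1, (l + a = k)%N -> f k l) ->
     (n.+1 - a)%:R <= \sum_(k < n.+1) \sum_(l < n.+1) (f k l)%:R :> R.
    move=> an hf; rewrite exchange_big /=.
    apply: (@le_trans _ _ (\sum_(l < n.+1) (l < n.+1 - a)%:R)).
      rewrite -natr_sum ler_nat -(big_mkord xpredT (fun l => (l < n.+1 - a : nat)%N)).
      rewrite (@big_cat_nat _ _ _ (n.+1 - a)%N) //=; last exact: leq_subr.
      rewrite big_nat (eq_bigr (fun=> 1%N)); last by move=> l /andP [_ ->].
      by rewrite -big_nat sum_nat_const_nat subn0 muln1 leq_addr.
    apply: ler_sum => l _; case: ltnP => // hl; last by apply: sumr_ge0 => k _; exact: ler0n.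
    have hk : (l + a < n.+1)%N by lia.
    rewrite (bigD1 (Ordinal hk)) //= hf //= lerDl; apply: sumr_ge0 => k _; exact: ler0n.
  case: m mn {row up} => a mn.
    by apply: (gen a (fun k l => k%:Z - l%:Z == a)) => // k l /= E; apply/eqP; lia.
  rewrite exchange_big /=.
  by apply: (gen a.+1 (fun k l => l%:Z - k%:Z == Negz a)) => // k l /= E; apply/eqP; lia.
apply: (@le_trans _ _ (n.+1%:R^-1 * (n.+1 - `|m|)%:R)); last first.
  by rewrite ler_pM2l ?invr_gt0.
rewrite natrB; last by lia.
by rewrite mulrBr mulVf ?gt_eqF // mulrC.
Qed.

Lemma kap0 n : kap n 0 = 1.
Proof.
have n00 : (`|0 : int| <= n)%N by rewrite absz0.
by have := kap_bounds n00; rewrite absz0 mul0r subr0 -eq_le => /eqP.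
Qed.

Lemma kap_cvg (e : R) m : 0 < e -> exists n0, forall n, (n0 <= n)%N -> (`|m| <= n)%N /\ `|1 - kap n m| <= e.
Proof.
move=> e0.
have hb := archi_boundP (divr_ge0 (ler0n R `|m|%N) (ltW e0)); set B := Num.bound _ in hb.
exists (maxn `|m| B) => n; rewrite geq_max => /andP [mn Bn]; split=> //.
have /andP [h1 h2] := kap_bounds mn.
rewrite ger0_norm ?subr_ge0 //.
apply: (@le_trans _ _ (`|m|%N%:R / n.+1%:R)); first by rewrite lerBlDr addrC -lerBlDr.
rewrite ler_pdivrMr ?ltr0n // mulrC -ler_pdivrMr //; apply: le_trans (ltW hb) _.
by rewrite ler_nat; apply: leq_trans Bn _.
Qed.

(** Fejer's kernel is positive: it is the square of a Dirichlet kernel. *)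
Lemma fej_kernel n h t : fej n h (zc ^~ t) = (n.+1%:R^-1 / 2 ^+ n.+1) *
  \sum_(b < NN n) h (fp n b) *
    rc (nrm (\sum_(k < n.+1) zc k t * Num.conj (zc k (fp n b))) ^+ 2).
Proof.
rewrite /fej -mulrA; congr (_ * _).
transitivity (\sum_(k < n.+1) \sum_(l < n.+1) (2 ^+ n.+1)^-1 * \sum_(b < NN n) h (fp n b) *
   (zc k t * Num.conj (zc k (fp n b)) * Num.conj (zc l t * Num.conj (zc l (fp n b))))).
  apply: eq_bigr => k _; apply: eq_bigr => l _.
  rewrite /fc -[LHS]mulrA; congr (_ * _); rewrite mulr_suml; apply: eq_bigr => b _.
  rewrite !zcD rmorphM /= !rmorphM /= !zc_conj !opprK; ring.
under eq_bigr do rewrite -mulr_sumr exchange_big /=.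
rewrite -mulr_sumr exchange_big /=; congr (_ * _); apply: eq_bigr => b _.
rewrite nrm_sq rmorph_sum mulr_suml mulr_sumr; apply: eq_bigr => k _.
by rewrite -!mulr_sumr.
Qed.

Lemma chord (a a' b b' q : C R) : a * a' = 1 -> b * b' = 1 ->
  q * ((a - b) * (a' - b')) = q * 2 - (b' * (a * q) + b * (a' * q)).
Proof.
move=> ha hb.
transitivity (q * (a * a' + b * b' - (b' * a + b * a'))); first by ring.
by rewrite ha hb; ring.
Qed.

(** The mean is an average of the values of h with weights w_b, and
    [circle_quad] bounds the error by e/2 plus K times the average of
    |w - t|^2, which is 2 - 2 kap n 1 and tends to 0. *)
Lemma korovkin (h : circle R -> C R) (e : R) : continuous h -> 0 < e ->
  exists n0, forall n, (n0 <= n)%N -> forall t, nrm (fej n h (zc ^~ t) - h t) <= e.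
Proof.
move=> ch e0.
have e2 : 0 < e / 2 by rewrite divr_gt0.
have [K K0 hK] := circle_quad ch e2.
have eK : 0 < e / 2 / (2 * K + 1) by rewrite divr_gt0 // ltr_wpDl // mulr_ge0.
have [n0 hn0] := kap_cvg 1 eK.
exists n0 => n /hn0 [n1 hk] t.
have /andP [_ k1] := kap_bounds n1.
pose c : R := n.+1%:R^-1 / 2 ^+ n.+1.
have c0 : 0 <= c by rewrite divr_ge0 ?invr_ge0 // exprn_ge0.
pose w b : R := c * nrm (\sum_(k < n.+1) zc k t * Num.conj (zc k (fp n b))) ^+ 2.
have w0 b : 0 <= w b by rewrite mulr_ge0 // sqr_ge0.
have E g : fej n g (zc ^~ t) = \sum_(b < NN n) g (fp n b) * rc (w b).
  rewrite fej_kernel mulr_sumr; apply: eq_bigr => b _.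
  have -> : rc (w b) = rc c * rc (nrm (\sum_(k < n.+1) zc k t * Num.conj (zc k (fp n b))) ^+ 2).
    exact: rmorphM.
  have -> : rc c = n.+1%:R^-1 / 2 ^+ n.+1.
    by rewrite [LHS](rmorphM (real_complex R)) !fmorphV rmorphXn /= !rmorph_nat.
  by rewrite mulrCA.
clearbody w.
have w1 : \sum_(b < NN n) rc (w b) = 1.
  have := E (zc 0); rewrite fej_zc ?absz0 // => H.
  by move: H; rewrite kap0 scale1r zc0 => ->; apply: eq_bigr => b _; rewrite zc0 mul1r.
have w1' : \sum_(b < NN n) w b = 1.
  by apply: rc_inj; rewrite -[RHS]w1; exact: (rmorph_sum (real_complex R)).
have wz : \sum_(b < NN n) w b * nrm (val (fp n b) - val t : C R) ^+ 2 = 2 - 2 * kap n 1.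
  apply: rc_inj; rewrite [LHS](rmorph_sum (real_complex R)).
  have z1 := E (zc 1); rewrite fej_zc // in z1.
  have hb (b : 'I_(NN n)) : rc (w b * nrm (val (fp n b) - val t : C R) ^+ 2) =
      rc (w b) * 2 - (zc (-1) t * (zc 1 (fp n b) * rc (w b))
          + Num.conj (zc (-1) t * (zc 1 (fp n b) * rc (w b)))).
    have -> : rc (w b * nrm (val (fp n b) - val t : C R) ^+ 2) =
      rc (w b) * rc (nrm (val (fp n b) - val t : C R) ^+ 2) by exact: rmorphM.
    have v s : val s = zc 1 s by rewrite /zc expr1z.
    rewrite nrm_sq !v rmorphB /= !rmorphM /= !zc_conj opprK.
    have -> : Num.conj (rc (w b)) = rc (w b) by rewrite conj_Creal // complex_real.
    have u s : zc 1 s * zc (-1) s = 1 by rewrite -zcD subrr zc0.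
    exact: (chord _ (u _) (u _)).
  transitivity (\sum_(b < NN n) (rc (w b) * 2 - (zc (-1) t * (zc 1 (fp n b) * rc (w b))
          + Num.conj (zc (-1) t * (zc 1 (fp n b) * rc (w b)))))).
    by apply: eq_bigr => b _; exact: hb.
  have Z : \sum_(b < NN n) zc (-1) t * (zc 1 (fp n b) * rc (w b)) = rc (kap n 1).
    rewrite -mulr_sumr -z1 -[_ *: _]/(_ * _) mulrCA -zcD addNr zc0 mulr1 //.
  have cr : Num.conj (rc (kap n 1)) = rc (kap n 1) by rewrite conj_Creal // complex_real.
  rewrite sumrB -mulr_suml w1 mul1r big_split /= -rmorph_sum /= Z cr.
  have -> : rc (2 - 2 * kap n 1) = rc 2 - rc (2 * kap n 1) by exact: rmorphB.
  have -> : rc (2 * kap n 1) = rc 2 * rc (kap n 1) by exact: rmorphM.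
  have -> : rc 2 = 2 by exact: rmorph_nat.
  by ring.
have -> : fej n h (zc ^~ t) - h t = \sum_(b < NN n) (h (fp n b) - h t) * rc (w b).
  by under [RHS]eq_bigr do rewrite mulrBl; rewrite sumrB -mulr_sumr w1 mulr1 -E.
apply: le_trans (nrm_sum _ _ _) _.
apply: (@le_trans _ _ (\sum_(b < NN n) (e / 2 * w b + K * (w b * nrm (val (fp n b) - val t : C R) ^+ 2)))).
  apply: ler_sum => b _; rewrite nrmM nrm_rc //.
  have -> : e / 2 * w b + K * (w b * nrm (val (fp n b) - val t : C R) ^+ 2)
    = (e / 2 + K * nrm (val (fp n b) - val t : C R) ^+ 2) * w b by ring.
  by rewrite ler_wpM2r.
rewrite big_split /= -!mulr_sumr w1' wz mulr1.
move: hk; rewrite ger0_norm ?subr_ge0 // ler_pdivlMr; last by rewrite ltr_wpDl // mulr_ge0.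
by move: k1; nra.
Qed.

(** Induction for continuous functions: the Laurent polynomials are dense. *)
Lemma circle_ind (P : (circle R -> C R) -> Prop) :
  (forall m, P (zc m)) ->
  (forall f g, continuous f -> continuous g -> P f -> P g -> P (f + g)) ->
  (forall c f, continuous f -> P f -> P (fun t => c * f t)) ->
  (forall h, continuous h -> (forall e : R, 0 < e -> exists g, [/\ continuous g, P g &
       forall t, nrm (h t - g t) <= e]) -> P h) ->
  forall h, continuous h -> P h.
Proof.
move=> Pz PD PZ Pc h ch; apply: Pc; first exact: ch.
move=> e e0; have [n hn] := korovkin ch e0.
pose Q f := continuous f /\ P f.
have Qz m : Q (zc m) by split; [exact: cont_zc|exact: Pz].
have QD f g : Q f -> Q g -> Q (f + g).
  move=> [cf Pf] [cg Pg]; split; last exact: (PD f g cf cg Pf Pg).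
  exact: (@cont_add R _ f g cf cg).
have QZ c f : Q f -> Q (fun t => c * f t).
  move=> [cf Pf]; split; last exact: (PZ c f cf Pf).
  exact: (@cont_mul R _ (fun=> c) f (@cont_cst _ _ c) cf).
have Q0 : Q (fun=> 0).
  have := QZ 0 _ (Qz 0); congr Q; apply/funext => t; exact: mul0r.
have Qs (I : Type) (s : seq I) (F : I -> circle R -> C R) : (forall i, Q (F i)) ->
    Q (fun t => \sum_(i <- s) F i t).
  move=> hF; elim: s => [|i s ih].
    by move: Q0; congr Q; apply/funext => t; rewrite big_nil.
  by move: (QD _ _ (hF i) ih); congr Q; apply/funext => t; rewrite big_cons.
have [cg Pg] : Q (fun t => fej n h (zc ^~ t)).
  pose A (k l : 'I_n.+1) t := fc n h (k%:Z - l%:Z) * zc (k%:Z - l%:Z) t.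
  have QA k l : Q (A k l) by exact: (QZ _ _ (Qz _)).
  have QA2 k : Q (fun t => \sum_l A k l t) by exact: (Qs _ _ (A k) (QA k)).
  exact: (QZ _ _ (Qs _ _ _ QA2)).
exists (fun t => fej n h (zc ^~ t)); split; [exact: cg|exact: Pg|].
by move=> t; rewrite nrm_distC; exact: hn.
Qed.

End Fejer.

(** * Multiplication operators from a unitary group *)

Section Laurent.
Variables (R : realType) (H : hilbertType R) (U : int -> H -> H).
Notation rc := (real_complex R).
Hypotheses (Ulin : forall m, linear (U m)) (UD : forall m k x, U (m + k) x = U m (U k x))
  (U0 : forall x, U 0 x = x) (Uiso : forall m x y, hdot (U m x) (U m y) = hdot x y).
Implicit Types f g h : circle R -> C R.

(** For the bilateral shift U, the Fejer mean of order n of the multiplication by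
    h. *)
Definition fejop n h x : H := fej n h (fun m => U m x).
(** The Dirichlet kernel centred at the b-th sample point, applied to x. *)
Definition Rb n b x : H := \sum_(l < n.+1) zc l (fp R n b) *: U (- l%:Z) x.

Lemma Uadj m x y : hdot (U m x) y = hdot x (U (- m) y).
Proof. by rewrite -(Uiso m x) -UD subrr U0. Qed.

Lemma nrm_U m x : nrm (U m x) = nrm x.
Proof.
by apply/eqP; rewrite -(eqrXn2 (_ : (0 < 2)%N)) ?nrm_ge0 // !nrm2E Uiso.
Qed.

(** The operator counterpart of the positivity of Fejer's kernel. *)
Lemma fejop_form n h x y : hdot (fejop n h x) y = (n.+1%:R^-1 / 2 ^+ n.+1) *
  \sum_(b < NN n) h (fp R n b) * hdot (Rb n b x) (Rb n b y).
Proof.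
rewrite /fejop /fej hdotZl -[RHS]mulrA; congr (_ * _).
transitivity (\sum_(k < n.+1) \sum_(l < n.+1) (2 ^+ n.+1)^-1 * \sum_(b < NN n) h (fp R n b) *
   (zc l (fp R n b) * Num.conj (zc k (fp R n b)) * hdot (U (- l%:Z) x) (U (- k%:Z) y))).
  rewrite hdot_suml; apply: eq_bigr => k _; rewrite hdot_suml; apply: eq_bigr => l _.
  rewrite hdotZl /fc -[LHS]mulrA; congr (_ * _); rewrite mulr_suml; apply: eq_bigr => b _.
  rewrite UD Uadj zcD rmorphM /= -(zc_conj l) conjCK; ring.
under eq_bigr do rewrite -mulr_sumr exchange_big /=.
rewrite -mulr_sumr exchange_big /=; congr (_ * _); apply: eq_bigr => b _.
rewrite exchange_big /= /Rb hdot_suml mulr_sumr; apply: eq_bigr => l _.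
rewrite hdotZl hdot_sumr !mulr_sumr; apply: eq_bigr => k _.
by rewrite hdotZr; ring.
Qed.

Lemma fejop_lin n h : linear (fejop n h).
Proof.
move=> a x y; rewrite /fejop /fej scalerA mulrC -scalerA -scalerDr; congr (_ *: _).
rewrite scaler_sumr -big_split; apply: eq_bigr => k _.
rewrite scaler_sumr -big_split; apply: eq_bigr => l _.
by rewrite Ulin scalerDr !scalerA mulrC.
Qed.

Lemma fejopD n f g x : fejop n (f + g) x = fejop n f x + fejop n g x.
Proof. exact: fejD. Qed.
Lemma fejopZ n c f x : fejop n (fun t => c * f t) x = c *: fejop n f x.
Proof. exact: fejZ. Qed.

Lemma fejop_zc n m x : (`|m| <= n)%N -> fejop n (@zc R m) x = rc (kap R n m) *: U m x.
Proof. exact: fej_zc. Qed.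

(** By [fejop_form], (F x, y) is an average of h times (R_b x, R_b y); for h = 1
    the form is (x, y), so the inequality of Cauchy and Schwarz gives the bound by
    the supremum of |h|. *)
Lemma fejop_lip n h M : 0 <= M -> (forall t, nrm (h t) <= M) -> lip M (fejop n h).
Proof.
move=> M0 hM x.
pose c : R := n.+1%:R^-1 / 2 ^+ n.+1.
have c0 : 0 <= c by rewrite divr_ge0 ?invr_ge0 // exprn_ge0.
have cE : rc c = n.+1%:R^-1 / 2 ^+ n.+1.
  by rewrite [LHS](rmorphM (real_complex R)) !fmorphV rmorphXn /= !rmorph_nat.
have one y : c * \sum_(b < NN n) nrm (Rb n b y) ^+ 2 = nrm y ^+ 2.
  have E1 := fejop_form n (@zc R 0) y y.
  rewrite fejop_zc ?absz0 // kap0 scale1r U0 -cE hdotxx in E1.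
  apply: rc_inj; rewrite E1 [LHS](rmorphM (real_complex R)); congr (_ * _).
  rewrite [LHS](rmorph_sum (real_complex R)); apply: eq_bigr => b _.
  by rewrite zc0 mul1r hdotxx.
have key y : nrm (hdot (fejop n h x) y) * 2 <= M * (nrm x ^+ 2 + nrm y ^+ 2).
  rewrite fejop_form -cE nrmM nrm_rc // -(one x) -(one y) -mulrDr -big_split /=.
  rewrite -mulrA [leRHS]mulrCA ler_wpM2l //.
  apply: (@le_trans _ _ ((\sum_(b < NN n) M * (nrm (Rb n b x) * nrm (Rb n b y))) * 2)).
    rewrite ler_wpM2r //; apply: le_trans (nrm_sum _ _ _) _; apply: ler_sum => b _.
    by rewrite nrmM; apply: ler_pM; rewrite ?nrm_ge0 // hdot_le.
  rewrite -mulr_sumr -mulrA ler_wpM2l // mulr_suml; apply: ler_sum => b _.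
  by have := sqr_ge0 (nrm (Rb n b x) - nrm (Rb n b y)); nra.
have [x0|x0] := eqVneq (nrm x) 0.
  by rewrite (nrm_eq0 x0) (lin0 (@fejop_lin n h)) nrm0 mulr0.
have xp : 0 < nrm x by rewrite lt_neqAle eq_sym x0 nrm_ge0.
move: (fejop n h x) key => T key.
have [T0|T0] := eqVneq (nrm T) 0; first by rewrite T0 mulr_ge0 // nrm_ge0.
have Tp : 0 < nrm T by rewrite lt_neqAle eq_sym T0 nrm_ge0.
(* The factor makes both vectors of the estimate have the same norm. *)
have := key (rc (nrm x / nrm T) *: T).
rewrite hdotZr nrmM nrm_conj nrmZ nrm_rc; last by rewrite divr_ge0 ?nrm_ge0.
rewrite hdotxx nrm_rc ?sqr_ge0 // divfK // expr2 mulrA divfK //.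
have -> : M * (nrm x ^+ 2 + nrm x ^+ 2) = nrm x * (M * nrm x) * 2 by ring.
by rewrite ler_pM2r // ler_pM2l.
Qed.

(** The continuous functional calculus of the unitary group: h is mapped to h(U).
    Its properties are checked on characters and extended by [circle_ind]. *)
Definition laurent h x : H := lim (fejop n h x @[n --> \oo]).

Lemma cvg_zc m x : fejop n (@zc R m) x @[n --> \oo] --> U m x.
Proof.
apply/nrm_cvgnP => e e0.
have e1 : 0 < e / (nrm x + 1) / 2 by rewrite !divr_gt0 // ltr_wpDl // nrm_ge0.
have [n0 hn0] := kap_cvg m e1; exists n0 => n /hn0 [mn hk].
rewrite fejop_zc //.
have -> : U m x - rc (kap R n m) *: U m x = rc (1 - kap R n m) *: U m x.
  have -> : rc (1 - kap R n m) = 1 - rc (kap R n m).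
    by rewrite [LHS](rmorphB (real_complex R)) rmorph1.
  by rewrite scalerBl scale1r.
rewrite nrmZ nrm_U nrm_real.
have x1 : 0 < nrm x + 1 by rewrite ltr_wpDl // nrm_ge0.
apply: le_lt_trans (_ : e / (nrm x + 1) / 2 * (nrm x + 1) < _).
  apply: ler_pM; rewrite ?nrm_ge0 //; by rewrite lerDl.
rewrite mulrAC divfK ?gt_eqF // ltr_pdivrMr // ltr_pMr // ltr1n //.
Qed.

Lemma fejop_dist n h g x (e : R) : 0 <= e -> (forall t, nrm (h t - g t) <= e) ->
  nrm (fejop n h x - fejop n g x) <= e * nrm x.
Proof.
move=> e0 hg.
have -> : fejop n h x - fejop n g x = fejop n (h + (fun t => -1 * g t)) x.
  by rewrite fejopD fejopZ scaleN1r.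
by apply: fejop_lip => // t; rewrite fctE mulN1r.
Qed.

(** The means converge on characters, and they are uniformly bounded, so that the
    functions for which they form a Cauchy sequence are closed under uniform
    limits. *)
Lemma laurent_cvg h x : continuous h -> fejop n h x @[n --> \oo] --> laurent h x.
Proof.
move: h; apply: (@circle_ind R (fun h => fejop n h x @[n --> \oo] --> laurent h x)).
- by move=> m; apply/cvg_ex; exists (U m x); exact: cvg_zc.
- move=> f g _ _ hf hg; apply/cvg_ex; exists (laurent f x + laurent g x).
  under eq_fun do rewrite fejopD.
  exact: cvgD hf hg.
- move=> c f _ hf; apply/cvg_ex; exists (c *: laurent f x).
  under eq_fun do rewrite fejopZ.
  by apply: cvgZr; exact: hf.
move=> h _ ha; apply: cauchy_cvg; apply/cauchyP => e0 e0p.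
have er : e0 = rc (complex.Re e0) by rewrite RRe_real // gtr0_real.
set e := complex.Re e0 in er.
have ep : 0 < e by rewrite -rc_lt -er rmorph0.
have x1 : 0 < nrm x + 1 by rewrite ltr_wpDl // nrm_ge0.
have ed : 0 < e / 4 / (nrm x + 1) by rewrite !divr_gt0.
have [g [_ Pg hg]] := ha _ ed.
exists (laurent g x).
have e2 : 0 < e / 2 by rewrite divr_gt0.
have /nrm_cvgP /(_ _ e2) := Pg.
apply: filterS => n hn; rewrite -ball_normE /ball_ /= nrmE er rc_lt.
have -> : laurent g x - fejop n h x = (laurent g x - fejop n g x) - (fejop n h x - fejop n g x).
  by rewrite opprB addrA subrK.
apply: le_lt_trans (nrmB _ _) _.
have := fejop_dist n x (ltW ed) hg.
have : e / 4 / (nrm x + 1) * nrm x <= e / 4.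
  by rewrite mulrAC ler_pdivrMr // ler_wpM2l ?lerDl // divr_ge0 // ltW.
lra.
Qed.

Lemma laurent_eq h x y : fejop n h x @[n --> \oo] --> y -> laurent h x = y.
Proof. by move=> hy; exact: (cvg_lim (@norm_hausdorff _ _) hy). Qed.

Lemma laurent_zc m x : laurent (@zc R m) x = U m x.
Proof. by apply: laurent_eq; exact: cvg_zc. Qed.

Lemma laurentD f g x : continuous f -> continuous g -> laurent (f + g) x = laurent f x + laurent g x.
Proof.
move=> cf cg; apply: laurent_eq; under eq_fun do rewrite fejopD.
have h1 := laurent_cvg (x:=x) cf; have h2 := laurent_cvg (x:=x) cg.
by apply: cvgD; [exact: h1|exact: h2].
Qed.

Lemma laurentZ c f x : continuous f -> laurent (fun t => c * f t) x = c *: laurent f x.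
Proof.
move=> cf; apply: laurent_eq; under eq_fun do rewrite fejopZ.
by apply: cvgZr; exact: laurent_cvg.
Qed.

Lemma laurent_lin h : continuous h -> linear (laurent h).
Proof.
move=> ch a x y; apply: laurent_eq; under eq_fun do rewrite fejop_lin.
by apply: cvgD; [apply: cvgZr|]; exact: laurent_cvg.
Qed.

Lemma lim_le (u : nat -> H) y M : u @ \oo --> y -> (forall n, nrm (u n) <= M) -> nrm y <= M.
Proof.
move=> /nrm_cvgnP hu hM; rewrite leNgt; apply/negP => lt.
have d0 : 0 < nrm y - M by rewrite subr_gt0.
have [N hN] := hu _ d0.
have := hN N (leqnn N); have := nrmD (y - u N) (u N); rewrite subrK.
by have := hM N; lra.
Qed.

Lemma laurent_lip h M : continuous h -> 0 <= M -> (forall t, nrm (h t) <= M) -> lip M (laurent h).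
Proof. by move=> ch M0 hM x; apply: (lim_le (laurent_cvg (x:=x) ch)) => n; exact: fejop_lip. Qed.

Lemma laurent_dist h g x (e : R) : continuous h -> continuous g -> 0 <= e ->
  (forall t, nrm (h t - g t) <= e) -> nrm (laurent h x - laurent g x) <= e * nrm x.
Proof.
move=> ch cg e0 hg.
have cgN := @cont_mul R _ (fun=> -1) g (@cont_cst _ _ (-1)) cg.
have -> : laurent h x - laurent g x = laurent (h + (fun t => -1 * g t)) x.
  by rewrite (laurentD x ch cgN) (laurentZ _ x cg) scaleN1r.
have hb t : nrm ((h + (fun t => -1 * g t)) t) <= e by rewrite fctE mulN1r.
have cs := @cont_add R _ h _ ch cgN.
exact: (laurent_lip cs e0 hb).
Qed.

Lemma eq_of_close (x y : H) (K : R) : 0 <= K ->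
  (forall e : R, 0 < e -> nrm (x - y) <= e * K) -> x = y.
Proof.
move=> K0 hK; apply/eqP; rewrite -subr_eq0; apply/eqP; apply: nrm_eq0.
apply/eqP; rewrite eq_le nrm_ge0 andbT leNgt; apply/negP => lt.
have K1 : 0 < K + 1 by rewrite ltr_wpDl.
have := hK (nrm (x - y) / 2 / (K + 1)) (divr_gt0 (divr_gt0 lt (ltr0Sn R 1)) K1).
rewrite leNgt => /negP; apply.
rewrite mulrAC ltr_pdivrMr //; nra.
Qed.

Lemma bounded_circle h : continuous h -> exists2 M : R, 0 <= M & forall t, nrm (h t) <= M.
Proof.
move=> ch; have [K K0 hK] := circle_quad ch ltr01.
pose t0 := cpt (0 : R).
exists (1 + K * 4 + nrm (h t0)); first by rewrite !addr_ge0 ?mulr_ge0 ?nrm_ge0.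
move=> t; have := hK t t0; have := nrmD (h t - h t0) (h t0); rewrite subrK.
have : nrm (val t - val t0 : C R) ^+ 2 <= 4.
  have : nrm (val t - val t0 : C R) <= 2.
    by apply: le_trans (nrmB _ _) _; rewrite !nrm_circle.
  by have := nrm_ge0 (val t - val t0 : C R); nra.
by move=> /(ler_wpM2l K0); lra.
Qed.

Lemma laurent_comm (W : H -> H) h x : bounded_operator W -> (forall m y, W (U m y) = U m (W y)) ->
  continuous h -> W (laurent h x) = laurent h (W x).
Proof.
move=> bW WU; have [K K0 hW] := bop_lip bW; have lW := bop_lin bW.
move: h; apply: (@circle_ind R (fun h => W (laurent h x) = laurent h (W x))).
- by move=> m; rewrite !laurent_zc WU.
- by move=> f g cf cg hf hg; rewrite !(laurentD _ cf cg) (linD lW) hf hg.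
- by move=> c f cf hf; rewrite !(laurentZ _ _ cf) (linZ lW) hf.
move=> h ch ha; apply: (@eq_of_close _ _ (K * nrm x + nrm (W x))).
  by rewrite addr_ge0 ?mulr_ge0 ?nrm_ge0.
move=> e e0; have [g [cg Pg hg]] := ha e e0.
have -> : W (laurent h x) - laurent h (W x) = W (laurent h x - laurent g x) - (laurent h (W x) - laurent g (W x)).
  by rewrite (linB lW) Pg opprB addrA subrK.
apply: le_trans (nrmB _ _) _; rewrite mulrDr.
apply: lerD; last exact: (laurent_dist (W x) ch cg (ltW e0) hg).
apply: le_trans (hW _) _; rewrite mulrCA ler_wpM2l //.
exact: (laurent_dist x ch cg (ltW e0) hg).
Qed.

Lemma laurent_bop h : continuous h -> bounded_operator (laurent h).
Proof.
move=> ch; have [M M0 hM] := bounded_circle ch.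
exact: (lip_bop (laurent_lin ch) M0 (laurent_lip ch M0 hM)).
Qed.

(** Density first in f, for g a character, and then in g. *)
Lemma laurent_mul f g x : continuous f -> continuous g ->
  laurent (fun t => f t * g t) x = laurent f (laurent g x).
Proof.
move=> cf; move: g.
have hzU m : laurent (fun t => f t * zc m t) x = laurent f (U m x).
  move: f cf; apply: (@circle_ind R (fun f => laurent (fun t => f t * zc m t) x = laurent f (U m x))).
  - move=> k; have -> : (fun t => zc k t * zc m t) = @zc R (k + m).
      by apply/funext => t; rewrite zcD.
    by rewrite !laurent_zc UD.
  - move=> f g cf cg hf hg.
    have cfm := cont_mul cf (@cont_zc R m); have cgm := cont_mul cg (@cont_zc R m).
    have -> : (fun t => (f + g) t * zc m t) = (fun t => f t * zc m t) + (fun t => g t * zc m t).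
      by apply/funext => t; rewrite !fctE mulrDl.
    by rewrite (laurentD _ cfm cgm) (laurentD _ cf cg) hf hg.
  - move=> c f cf hf.
    have cfm := cont_mul cf (@cont_zc R m).
    have -> : (fun t => c * f t * zc m t) = (fun t => c * (f t * zc m t)).
      by apply/funext => t; rewrite mulrA.
    by rewrite (laurentZ _ _ cfm) (laurentZ _ _ cf) hf.
  move=> h ch ha; apply: (@eq_of_close _ _ (nrm x + nrm x)).
    by rewrite addr_ge0 ?nrm_ge0.
  move=> e e0; have [g [cg Pg hg]] := ha e e0.
  have chm := cont_mul ch (@cont_zc R m); have cgm := cont_mul cg (@cont_zc R m).
  have -> : laurent (fun t => h t * zc m t) x - laurent h (U m x) =
     (laurent (fun t => h t * zc m t) x - laurent (fun t => g t * zc m t) x) - (laurent h (U m x) - laurent g (U m x)).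
    by rewrite Pg opprB addrA subrK.
  apply: le_trans (nrmB _ _) _; rewrite mulrDr; apply: lerD.
    have hb t : nrm (h t * zc m t - g t * zc m t) <= e by rewrite -mulrBl nrmM nrm_zc mulr1.
    exact: (laurent_dist x chm cgm (ltW e0) hb).
  have := laurent_dist (U m x) ch cg (ltW e0) hg; by rewrite nrm_U.
apply: (@circle_ind R (fun g => laurent (fun t => f t * g t) x = laurent f (laurent g x))).
- by move=> m; rewrite hzU laurent_zc.
- move=> g1 g2 c1 c2 h1 h2.
  have -> : (fun t => f t * (g1 + g2) t) = (fun t => f t * g1 t) + (fun t => f t * g2 t).
    by apply/funext => t; rewrite !fctE mulrDr.
  have cf1 := cont_mul cf c1; have cf2 := cont_mul cf c2.
  by rewrite (laurentD _ cf1 cf2) (laurentD _ c1 c2) (linD (laurent_lin cf)) h1 h2.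
- move=> c g cg hg.
  have -> : (fun t => f t * (c * g t)) = (fun t => c * (f t * g t)).
    by apply/funext => t; rewrite mulrCA.
  have cfg := cont_mul cf cg.
  by rewrite (laurentZ _ _ cfg) (laurentZ _ _ cg) (linZ (laurent_lin cf)) hg.
move=> h ch ha.
have [M M0 hM] := bounded_circle cf.
apply: (@eq_of_close _ _ (M * nrm x + M * nrm x)).
  by rewrite addr_ge0 ?mulr_ge0 ?nrm_ge0.
move=> e e0; have [g [cg Pg hg]] := ha e e0.
have -> : laurent (fun t => f t * h t) x - laurent f (laurent h x) =
   (laurent (fun t => f t * h t) x - laurent (fun t => f t * g t) x) - laurent f (laurent h x - laurent g x).
  by rewrite (linB (laurent_lin cf)) Pg opprB addrA subrK.
apply: le_trans (nrmB _ _) _; rewrite mulrDr; apply: lerD.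
  have hb t : nrm (f t * h t - f t * g t) <= e * M.
    by rewrite -mulrBr nrmM mulrC ler_pM ?nrm_ge0.
  have c1 := cont_mul cf ch; have c2 := cont_mul cf cg.
  by rewrite mulrA; exact: (laurent_dist x c1 c2 (mulr_ge0 (ltW e0) M0) hb).
apply: le_trans (laurent_lip cf M0 hM _) _; rewrite mulrCA ler_wpM2l //.
exact: (laurent_dist x ch cg (ltW e0) hg).
Qed.

Lemma laurent_adj h x y : continuous h -> hdot (laurent h x) y = hdot x (laurent (fun t => Num.conj (h t)) y).
Proof.
move: h; apply: (@circle_ind R (fun h => hdot (laurent h x) y = hdot x (laurent (fun t => Num.conj (h t)) y))).
- move=> m; have -> : (fun t => Num.conj (zc m t)) = @zc R (- m).
    by apply/funext => t; rewrite zc_conj.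
  by rewrite !laurent_zc Uadj.
- move=> f g cf cg hf hg.
  have -> : (fun t => Num.conj ((f + g) t)) = (fun t => Num.conj (f t)) + (fun t => Num.conj (g t)).
    by apply/funext => t; rewrite !fctE rmorphD.
  have c1 := cont_conj cf; have c2 := cont_conj cg.
  by rewrite (laurentD _ cf cg) (laurentD _ c1 c2) hdotDl hdotDr hf hg.
- move=> c f cf hf.
  have -> : (fun t => Num.conj (c * f t)) = (fun t => Num.conj c * Num.conj (f t)).
    by apply/funext => t; rewrite rmorphM.
  have c1 := cont_conj cf.
  by rewrite (laurentZ _ _ cf) (laurentZ _ _ c1) hdotZl hdotZr conjCK hf.
move=> h ch ha; apply/eqP; rewrite -subr_eq0; apply/eqP; apply: nrm_eq0.
apply/eqP; rewrite eq_le nrm_ge0 andbT leNgt; apply/negP => lt.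
set d := nrm _ in lt.
pose K := nrm x * nrm y.
have K0 : 0 <= K by rewrite mulr_ge0 ?nrm_ge0.
have K1 : 0 < 2 * K + 1 by rewrite ltr_wpDl // mulr_ge0.
have e0 : 0 < d / 2 / (2 * K + 1) by rewrite !divr_gt0.
have [g [cg Pg hg]] := ha _ e0.
set e := d / 2 / _ in e0 hg.
have : d <= e * (2 * K).
  rewrite /d.
  have -> : hdot (laurent h x) y - hdot x (laurent (fun t => Num.conj (h t)) y)
    = hdot (laurent h x - laurent g x) y - hdot x (laurent (fun t => Num.conj (h t)) y - laurent (fun t => Num.conj (g t)) y).
    by rewrite hdotBl hdotBr Pg opprB addrA subrK.
  apply: le_trans (nrmB _ _) _.
  have h1 : nrm (hdot (laurent h x - laurent g x) y) <= e * K.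
    apply: le_trans (hdot_le _ _) _; rewrite mulrA ler_wpM2r ?nrm_ge0 //.
    exact: (laurent_dist x ch cg (ltW e0) hg).
  have h2 : nrm (hdot x (laurent (fun t => Num.conj (h t)) y - laurent (fun t => Num.conj (g t)) y)) <= e * K.
    apply: le_trans (hdot_le _ _) _; rewrite /K mulrCA ler_wpM2l ?nrm_ge0 //.
    have hb t : nrm (Num.conj (h t) - Num.conj (g t)) <= e by rewrite -rmorphB nrm_conj.
    have c1 := cont_conj ch; have c2 := cont_conj cg.
    exact: (laurent_dist y c1 c2 (ltW e0) hb).
  by lra.
have : e * (2 * K) <= d / 2.
  by rewrite /e mulrAC ler_pdivrMr // ler_wpM2l ?lerDl // divr_ge0 // ltW.
lra.
Qed.

End Laurent.

(** * Operators given by partial injections of the indices *)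

Section PartialMaps.
Variables (R : realType) (I : countType).
Notation rc := (real_complex R).
Notation G := (L2H R I).

Definition pinj (g : I -> option I) := forall i i' j, g i = Some j -> g i' = Some j -> i = i'.
Definition wfun (g : I -> option I) (x : I -> C R) : I -> C R := fun i => oapp x 0 (g i).

Lemma wfun_sum g (x : I -> C R) s : pinj g -> uniq s ->
  exists2 s', uniq s' & l2sum (wfun g x) s = l2sum x s'.
Proof.
move=> hg us; exists (pmap g s).
  elim: s us => [//|i s ih] /= /andP [is_ /ih us].
  case gi: (g i) => [j|] //=; rewrite us andbT.
  apply/negP; rewrite mem_pmap => /mapP [i' i's /esym h].
  by move: is_; rewrite (hg _ _ _ gi h) i's.
elim: s {us} => [|i s ih]; first by rewrite /l2sum !big_nil.
rewrite /l2sum big_cons /=; rewrite /l2sum in ih; rewrite ih /wfun.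
case gi: (g i) => [j|] /=; first by rewrite big_cons.
by rewrite nrm0 expr0n add0r.
Qed.

Lemma wfun_summable g (x : l2 R I) : pinj g -> wfun g x \in @summable2 R I.
Proof.
move=> hg; apply/summable2P; exists (nrm x ^+ 2) => s us.
have [s' us' ->] := wfun_sum x hg us; exact: l2sum_le.
Qed.

(** The operator of composition with a partial injection of the index set;
    shifts, matrix units and coordinate projections are all of this form, and
    identities between them reduce to identities between partial maps. *)
Definition wop g (hg : pinj g) (x : G) : G := L2 (wfun_summable x hg).

Lemma wopE g (hg : pinj g) x i : l2f (wop hg x) i = oapp (l2f x) 0 (g i).
Proof. by []. Qed.

Lemma wop_lin g (hg : pinj g) : linear (wop hg).
Proof.
move=> a x y; apply: l2_ext => i; rewrite l2fD l2fZ !wopE.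
by case: (g i) => [j|] /=; rewrite ?mulr0 ?addr0.
Qed.

Lemma wop_lip g (hg : pinj g) : lip 1 (wop hg).
Proof.
move=> x; rewrite mul1r -(ler_pXn2r (_ : (0 < 2)%N)) ?nnegrE ?nrm_ge0 //.
rewrite [X in X <= _](nrm2_l2 (wop hg x)); apply: l2N2_le => s us.
have [s' us' E] := wfun_sum (l2f x) hg us; rewrite [X in X <= _]E; exact: l2sum_le.
Qed.

Lemma wop_bop g (hg : pinj g) : bounded_operator (wop hg).
Proof. exact: (lip_bop (@wop_lin g hg) ler01 (@wop_lip g hg)). Qed.

Lemma wop_some g (hg : pinj g) x i j : g i = Some j -> l2f (wop hg x) i = l2f x j.
Proof. by rewrite wopE => ->. Qed.

Lemma wop_none g (hg : pinj g) x i : g i = None -> l2f (wop hg x) i = 0.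
Proof. by rewrite wopE => ->. Qed.

Lemma wop_ebas g (hg : pinj g) i j : g i = Some j -> wop hg (ebas R j) = ebas R i.
Proof.
move=> gi; apply: l2_ext => i'; rewrite ebasE.
case gi': (g i') => [j'|].
  rewrite (wop_some hg _ gi') ebasE; have [jj|jj] := eqVneq j' j.
    by rewrite jj in gi'; rewrite (hg _ _ _ gi' gi) eqxx.
  case: eqP => // ii; move: jj; rewrite ii gi in gi'; case: gi' => ->; by rewrite eqxx.
rewrite (wop_none hg _ gi').
by case: eqP => // ii; rewrite ii gi in gi'.
Qed.

Lemma wop_ebas0 g (hg : pinj g) j : (forall i, g i <> Some j) -> wop hg (ebas R j) = 0.
Proof.
move=> h; apply: l2_ext => i.
case gi: (g i) => [j'|]; last by rewrite (wop_none hg _ gi).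
rewrite (wop_some hg _ gi) ebasE.
by case: eqP => // jj; rewrite jj in gi; have := h i; rewrite gi.
Qed.

(** Inverse partial injections give adjoint operators.  Both sides agree on basis
    vectors, and [l2_ind] extends the identity. *)
Lemma wop_adj g g' (hg : pinj g) (hg' : pinj g') :
  (forall i j, g i = Some j <-> g' j = Some i) -> is_adjoint (wop hg) (wop hg').
Proof.
move=> gg x y; move: x; apply: l2_ind.
- move=> j; rewrite [RHS]hdotC hdot_ebas.
  case g'j: (g' j) => [i|].
    rewrite (wop_some hg' _ g'j).
    have gi : g i = Some j by apply/gg.
    by rewrite (wop_ebas hg gi) hdotC hdot_ebas.
  rewrite (wop_none hg' _ g'j) rmorph0 wop_ebas0 ?hdot0l // => i gi.
  by have /gg := gi; rewrite g'j.
- by rewrite (lin0 (@wop_lin g hg)) !hdot0l.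
- by move=> a b ha hb; rewrite (linD (@wop_lin g hg)) !hdotDl ha hb.
- by move=> c a ha; rewrite (linZ (@wop_lin g hg)) !hdotZl ha.
move=> x hx; apply/eqP; rewrite -subr_eq0; apply/eqP; apply: nrm_eq0.
apply/eqP; rewrite eq_le nrm_ge0 andbT leNgt; apply/negP => lt.
set d := nrm _ in lt.
have K1 : 0 < 2 * nrm y + 1 by rewrite ltr_wpDl // mulr_ge0 ?nrm_ge0.
have e0 : 0 < d / (2 * nrm y + 1) by rewrite divr_gt0.
have [z hz xz] := hx _ e0.
have : d <= nrm (x - z) * (2 * nrm y).
  rewrite /d.
  have -> : hdot (wop hg x) y - hdot x (wop hg' y)
     = hdot (wop hg (x - z)) y - hdot (x - z) (wop hg' y).
    by rewrite (linB (@wop_lin g hg)) !hdotBl hz opprB addrA subrK.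
  apply: le_trans (nrmB _ _) _.
  have h1 : nrm (hdot (wop hg (x - z)) y) <= nrm (x - z) * nrm y.
    apply: le_trans (hdot_le _ _) _; rewrite ler_wpM2r ?nrm_ge0 //.
    by have := wop_lip hg (x - z); rewrite mul1r.
  have h2 : nrm (hdot (x - z) (wop hg' y)) <= nrm (x - z) * nrm y.
    apply: le_trans (hdot_le _ _) _; rewrite ler_wpM2l ?nrm_ge0 //.
    by have := wop_lip hg' y; rewrite mul1r.
  by lra.
move: xz; rewrite ltr_pdivlMr // => xz h.
have := nrm_ge0 (x - z); lra.
Qed.

Lemma wop_comp g1 g2 g3 (h1 : pinj g1) (h2 : pinj g2) (h3 : pinj g3) x :
  (forall i, g3 i = obind g2 (g1 i)) -> wop h1 (wop h2 x) = wop h3 x.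
Proof.
move=> hg; apply: l2_ext => i; rewrite !wopE hg.
by case: (g1 i) => [j|].
Qed.

Lemma wop_comp0 g1 g2 (h1 : pinj g1) (h2 : pinj g2) x :
  (forall i, obind g2 (g1 i) = None) -> wop h1 (wop h2 x) = 0.
Proof.
move=> hg; apply: l2_ext => i; have := hg i.
case gi: (g1 i) => [j|] h; last by rewrite (wop_none h1 _ gi).
by rewrite (wop_some h1 _ gi) (wop_none h2 _ h).
Qed.

Lemma wop_id g (hg : pinj g) x : (forall i, l2f x i != 0 -> g i = Some i) ->
  (forall i j, g i = Some j -> j = i) -> wop hg x = x.
Proof.
move=> h1 h2; apply: l2_ext => i; rewrite wopE.
case gi: (g i) => [j|] /=; first by rewrite (h2 _ _ gi).
have [->//|x0] := eqVneq (l2f x i) 0.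
by have := h1 i x0; rewrite gi.
Qed.
End PartialMaps.

(** * The representation of M_2(C(T)) on H^2 + L^2 *)

Section MatrixUnits.
Variables (R : realType) (H : hilbertType R) (U : int -> H -> H).
Hypothesis Ulin : forall m, linear (U m).
Hypothesis UD : forall m k x, U (m + k) x = U m (U k x).
Hypothesis U0 : forall x, U 0 x = x.
Hypothesis Uiso : forall m x y, hdot (U m x) (U m y) = hdot x y.
Variable E : 'I_2 -> 'I_2 -> H -> H.
Hypothesis E_bop : forall k l, bounded_operator (E k l).
Hypothesis E_mul : forall k l k' l' x, E k l (E k' l' x) = if l == k' then E k l' x else 0.
Hypothesis E_adj : forall k l, is_adjoint (E k l) (E l k).
Hypothesis E_sum : forall x, \sum_k E k k x = x.
Hypothesis EU : forall k l m x, E k l (U m x) = U m (E k l x).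
Notation cfun := (circle R -> 'M[C R]_2).
Notation G := H.
Notation LL := (@laurent R H U).
Let E_lin k l : linear (E k l). Proof. exact: bop_lin. Qed.

Definition ent (F : cfun) k l : circle R -> C R := fun t => F t k l.
Lemma cont_ent F k l : M2CT R F -> continuous (ent F k l).
Proof. by move/M2CTP; apply. Qed.
Arguments cont_ent [F] k l _ [x t] _.

(** The matrix F acts entrywise, with the operators E k l in the role of matrix
    units commuting with U. *)
Definition matrep (F : cfun) (x : G) : G := \sum_k \sum_l LL (ent F k l) (E k l x).

Lemma LLcomm k l h x : continuous h -> E k l (LL h x) = LL h (E k l x).
Proof. exact: (laurent_comm Ulin UD U0 Uiso x (E_bop k l) (EU k l)). Qed.

Lemma LL_cst c x : LL (fun=> c) x = c *: x.
Proof.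
have c0 : continuous (@zc R 0) by exact: cont_zc.
have -> : (fun=> c) = (fun t => c * zc 0 t) :> (circle R -> C R).
  by apply/funext => t; rewrite zc0 mulr1.
by rewrite (laurentZ Ulin UD U0 Uiso c x c0) (laurent_zc Uiso) U0.
Qed.

(** The functional calculus of U combined with the relations of matrix units. *)
Lemma matrep_star : star_rep matrep.
Proof.
have LLD := laurentD Ulin UD U0 Uiso; have LLZ := laurentZ Ulin UD U0 Uiso.
have LLlin := laurent_lin Ulin UD U0 Uiso.
have bsum (f : 'I_2 -> G -> G) : (forall k, bounded_operator (f k)) ->
    bounded_operator (fun x => \sum_k f k x).
  move=> hf; have -> : (fun x => \sum_k f k x) = f 0 + f 1 by apply/funext => x; rewrite sum2.
  exact: bopD.
split; [|split|].
- move=> F mF; apply: (bsum _ _) => k; apply: (bsum _ _) => l.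
  exact: (bop_comp (laurent_bop Ulin UD U0 Uiso (cont_ent k l mF)) (E_bop k l)).
- move=> F1 F2 m1 m2; apply/funext => x; transitivity (matrep F1 x + matrep F2 x); last by [].
  have c1 k l := cont_ent k l m1; have c2 k l := cont_ent k l m2.
  have e k l : ent (F1 + F2) k l = ent F1 k l + ent F2 k l.
    by apply/funext => t; rewrite /ent !fctE mxE.
  have LLDe k l y := LLD _ _ y (c1 k l) (c2 k l).
  rewrite /matrep !sum2 !e !LLDe.
  by rewrite [X in X + _ = _]addrACA [X in _ + X = _]addrACA [LHS]addrACA.
- move=> c F mF; apply/funext => x; transitivity (c *: matrep F x); last by [].
  have c1 k l := cont_ent k l mF.
  have e k l : ent (c *: F) k l = fun t => c * ent F k l t.
    by apply/funext => t; rewrite /ent !fctE mxE.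
  have LLZe k l y := LLZ c _ y (c1 k l).
  by rewrite /matrep !sum2 !e !LLZe !scalerDr.
- move=> F1 F2 m1 m2; apply/funext => x; transitivity (matrep F1 (matrep F2 x)); last by [].
  rewrite /matrep.
  apply: eq_bigr => k _.
  transitivity (\sum_l \sum_m LL (ent F1 k m) (LL (ent F2 m l) (E k l x))).
    apply: eq_bigr => l _; rewrite sum2.
    have c1 m := cont_ent k m m1; have c2 m := cont_ent m l m2.
    rewrite -(laurent_mul Ulin UD U0 Uiso _ (c1 0) (c2 0)) -(laurent_mul Ulin UD U0 Uiso _ (c1 1) (c2 1)).
    have p0 := cont_mul (c1 0) (c2 0); have p1 := cont_mul (c1 1) (c2 1).
    rewrite -(LLD _ _ _ p0 p1); congr (laurent _ _ _); apply/funext => t.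
    by rewrite /ent !fctE mxE sum2.
  rewrite exchange_big /=; apply: eq_bigr => m _.
  have c1 := cont_ent k m m1.
  rewrite -(lin_sum (LLlin _ c1)); congr (LL _ _).
  rewrite (lin_sum (E_lin k m)) [RHS](bigD1 m) //= [X in _ = _ + X]big1 ?addr0 => [|m' /negbTE mm].
    rewrite (lin_sum (E_lin k m)); apply: eq_bigr => l _.
    by rewrite (LLcomm k m _ (cont_ent m l m2)) E_mul eqxx.
  rewrite (lin_sum (E_lin k m)) big1 // => l _.
  have c2 := cont_ent m' l m2.
  by rewrite (LLcomm k m _ c2) E_mul eq_sym mm (lin0 (LLlin _ c2)).
- apply/funext => x; rewrite /matrep.
  have -> : idfun x = \sum_k E k k x by rewrite E_sum.
  apply: eq_bigr => k _; rewrite (bigD1 k) //= big1 ?addr0 => [|l /negbTE lk].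
    have -> : ent 1 k k = fun=> 1 by apply/funext => t; rewrite /ent mxE eqxx.
    by rewrite LL_cst scale1r.
  have -> : ent 1 k l = fun=> 0 by apply/funext => t; rewrite /ent mxE eq_sym lk.
  by rewrite LL_cst scale0r.
- move=> F mF x y; rewrite /matrep hdot_suml.
  under eq_bigr do rewrite hdot_suml.
  rewrite exchange_big hdot_sumr; apply: eq_bigr => l _; rewrite hdot_sumr.
  apply: eq_bigr => k _.
  have c1 := cont_ent k l mF; have c2 := cont_conj c1.
  rewrite (laurent_adj Ulin UD U0 Uiso _ _ c1) E_adj (LLcomm _ _ _ c2).
  have -> : (fun t => Num.conj (ent F k l t)) = ent (cadj F) l k.
    by apply/funext => t; rewrite /ent /cadj !mxE.
  by [].
Qed.

Lemma matrepE F x : M2CT R F ->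
  matrep F x = \sum_k \sum_l E k l (LL (ent F k l) x).
Proof.
move=> mF; apply: eq_bigr => k _; apply: eq_bigr => l _.
by rewrite (LLcomm _ _ _ (cont_ent k l mF)).
Qed.
End MatrixUnits.

Section Concrete.
Variable R : realType.
Notation rc := (real_complex R).
Notation cfun := (circle R -> 'M[C R]_2).
Notation J := ('I_2 * int)%type.
Notation G := (L2H R J).

Definition gshift (m : int) (i : J) : option J := Some (i.1, i.2 - m).
Lemma gshift_inj m : pinj (gshift m).
Proof. by move=> [p a] [q b] j [<-] [-> /addIr ->]. Qed.
Definition shift m : G -> G := wop (@gshift_inj m).

Definition gunit (k l : 'I_2) (i : J) : option J := if i.1 == k then Some (l, i.2) else None.
Lemma gunit_inj k l : pinj (gunit k l).
Proof.
move=> [p a] [q b] j; rewrite /gunit /=; case: eqP => // -> [<-]; case: eqP => // -> [->] //.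
Qed.
Definition munit k l : G -> G := wop (@gunit_inj k l).

Definition ghardy (i : J) : option J := if (i.1 == 1) || (0 <= i.2) then Some i else None.
Lemma ghardy_inj : pinj ghardy.
Proof. by move=> i i' j; rewrite /ghardy; case: ifP => // _ [->]; case: ifP => // _ [->]. Qed.
(** The projection on H^2 + L^2: in the component 0 only the indices m >= 0 are
    kept. *)
Definition hardy : G -> G := wop ghardy_inj.

Lemma shift_lin m : linear (shift m). Proof. exact: wop_lin. Qed.
Lemma shiftD m k x : shift (m + k) x = shift m (shift k x).
Proof. by rewrite /shift (wop_comp _ _ (@gshift_inj (m + k))) // => i /=; rewrite /gshift /= opprD addrA. Qed.
Lemma shift0 x : shift 0 x = x.
Proof. by apply: wop_id => [[p a] _|[p a] j []]; rewrite /gshift /= subr0. Qed.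
Lemma shift_iso m x y : hdot (shift m x) (shift m y) = hdot x y.
Proof.
have adj : is_adjoint (shift m) (shift (- m)).
  apply: wop_adj => -[p a] [q b]; rewrite /gshift /= opprK; split=> -[-> <-].
    by rewrite subrK.
  by rewrite addrK.
by rewrite adj -shiftD addNr shift0.
Qed.

Notation LL := (@laurent R G shift).

Lemma munit_shift k l m x : munit k l (shift m x) = shift m (munit k l x).
Proof.
apply: l2_ext => -[p a]; rewrite /munit /shift.
rewrite [RHS](wop_some _ _ (erefl (gshift m (p, a)))).
have [pk|pk] := eqVneq p k.
  have e b : gunit k l (p, b) = Some (l, b) by rewrite /gunit pk eqxx.
  by rewrite !(wop_some _ _ (e _)) (wop_some _ _ (erefl (gshift m (l, a)))).
have e b : gunit k l (p, b) = None by rewrite /gunit (negbTE pk).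
by rewrite !(wop_none _ _ (e _)).
Qed.

Lemma munit_bop k l : bounded_operator (munit k l). Proof. exact: wop_bop. Qed.

Lemma munit_mul k l k' l' x : munit k l (munit k' l' x) = if l == k' then munit k l' x else 0.
Proof.
case: eqP => [->|h].
  by apply: wop_comp => -[p a]; rewrite /gunit /=; case: (p == k) => //=; rewrite eqxx.
apply: wop_comp0 => -[p a]; rewrite /gunit /=; case: (p == k) => //=.
by case: eqP.
Qed.

Lemma munit_adj k l : is_adjoint (munit k l) (munit l k).
Proof.
apply: wop_adj => -[p a] [q b]; rewrite /gunit /=; split.
  by case: eqP => // -> [<- <-]; rewrite eqxx.
by case: eqP => // -> [<- <-]; rewrite eqxx.
Qed.

Lemma munit_sum x : \sum_k munit k k x = x.
Proof.
rewrite sum2; apply: l2_ext => -[p a]; rewrite l2fD /munit !wopE /gunit /=.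
by have [->|->] := ord2P p; rewrite /= ?addr0 ?add0r.
Qed.

Notation PI := (matrep shift munit).
Definition PI_star : star_rep PI := matrep_star shift_lin shiftD shift0 shift_iso munit_bop munit_mul munit_adj munit_sum munit_shift.
Definition LLcst := LL_cst shift_lin shiftD shift0 shift_iso.

Lemma PI_coord F x p j : M2CT R F -> l2f (PI F x) (p, j) = \sum_l l2f (LL (ent F p l) x) (l, j).
Proof.
move=> mF.
rewrite (matrepE shift_lin shiftD shift0 shift_iso munit_bop munit_shift x mF).
have ls (f : 'I_2 -> G) i : l2f (\sum_k f k) i = \sum_k l2f (f k) i by rewrite !sum2 l2fD.
rewrite ls [LHS](bigD1 p) //= [X in _ + X = _]big1 ?addr0 => [|k /negbTE kp].
  by rewrite ls; apply: eq_bigr => l _; rewrite wopE /gunit /= eqxx.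
by rewrite ls big1 // => l _; rewrite wopE /gunit /= eq_sym kp.
Qed.

Lemma shift_ebas m p j : shift m (ebas R (p, j)) = ebas R (p, j + m).
Proof. by apply: wop_ebas; rewrite /gshift /= addrK. Qed.

(** Functions of the disc algebra have no negative Fourier coefficients: the matrix
    coefficient of a Fejer mean is a discrete Fourier coefficient of f with index
    k - j < 0, up to a factor in [0, 1], and [disc_fourier] applies. *)
Lemma disc_lower f (p : 'I_2) (j k : int) : @disc_algebra R f -> (0 <= j) || (p == 1) -> (k < 0)%R ->
  hdot (LL f (ebas R ((p, j) : J))) (ebas R ((0, k) : J)) = 0.
Proof.
move=> df hj k0.
have cf := disc_cont df.
apply: nrm_eq0; apply/eqP; rewrite eq_le nrm_ge0 andbT leNgt; apply/negP => lt.
set d := nrm _ in lt.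
have d2 : 0 < d / 4 by rewrite divr_gt0.
have /nrm_cvgnP /(_ _ d2) [n1 h1] := laurent_cvg shift_lin shiftD shift0 shift_iso (x := ebas R (p, j)) cf.
have small : exists n2, forall n, (n2 <= n)%N ->
    nrm (hdot (@fejop R G shift n f (ebas R (p, j))) (ebas R (0, k))) <= d / 4.
  have dotU n : hdot (@fejop R G shift n f (ebas R (p, j))) (ebas R (0, k)) =
    n.+1%:R^-1 * \sum_(a < n.+1) \sum_(b < n.+1) fc n f (a%:Z - b%:Z) *
        ((p == 0) && (a%:Z - b%:Z == k - j))%:R.
    rewrite /fejop /fej hdotZl; congr (_ * _); rewrite hdot_suml; apply: eq_bigr => a _.
    rewrite hdot_suml; apply: eq_bigr => b _; rewrite hdotZl shift_ebas hdot_ebas ebasE.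
    congr (_ * _%:R); rewrite xpair_eqE [0 == p]eq_sym; congr (nat_of_bool (_ && _)).
    by rewrite [RHS]eq_sym subr_eq addrC.
  have [p0|p0] := eqVneq p 0; last first.
    exists 0%N => n _; rewrite dotU (negbTE p0) /= big1 ?mulr0 ?nrm0 ?(ltW d2) // => a _.
    by rewrite big1 // => b _; rewrite mulr0.
  have {}hj : 0 <= j by move: hj; rewrite p0 orbF.
  have [m mE] : exists m : nat, k - j = - m.+1%:Z by exists (`|k - j|.-1)%N; lia.
  have [k1 hk1] := disc_fourier m df d2.
  exists (maxn k1 m.+1) => n; rewrite geq_max => /andP [kn mn].
  have -> : hdot (@fejop R G shift n f (ebas R (p, j))) (ebas R (0, k))
    = rc (kap R n (k - j)) * fc n f (k - j).
    rewrite dotU p0 eqxx /=.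
    have -> : rc (kap R n (k - j)) = n.+1%:R^-1 * \sum_(a < n.+1) \sum_(b < n.+1) (a%:Z - b%:Z == k - j)%:R :> C R.
      rewrite [LHS](rmorphM (real_complex R)) fmorphV rmorph_nat; congr (_ * _).
      rewrite [LHS](rmorph_sum (real_complex R)); apply: eq_bigr => a _.
      by rewrite [LHS](rmorph_sum (real_complex R)); apply: eq_bigr => b _; rewrite [LHS]rmorph_nat.
    rewrite -mulrA; congr (_ * _); rewrite mulr_suml; apply: eq_bigr => a _.
    rewrite mulr_suml; apply: eq_bigr => b _.
    by case: eqP => [->|]; rewrite ?mul1r ?mulr1 // mul0r mulr0.
  have mn' : (`|k - j| <= n)%N by rewrite mE abszN.
  have /andP [b1 b2] := kap_bounds R mn'.
  have b0 : 0 <= kap R n (k - j).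
    apply: le_trans b1; rewrite subr_ge0 ler_pdivrMr ?ltr0n // mul1r ler_nat.
    exact: leqW.
  rewrite nrmM nrm_rc //.
  apply: (@le_trans _ _ (1 * (d / 4))); last by rewrite mul1r.
  apply: ler_pM; rewrite ?nrm_ge0 //.
  rewrite /fc mE.
  have -> : \sum_(b < NN n) f (fp R n b) * Num.conj (zc (- m.+1%:Z) (fp R n b))
    = \sum_(b < 2 ^ n.+1) f (cpt (b%:R / 2 ^+ n.+1)) * cis (b%:R / 2 ^+ n.+1) ^+ m.+1.
    by apply: eq_bigr => b _; rewrite zc_conj opprK.
  by apply: hk1; apply: leqW.
have [n2 h2] := small.
pose n := maxn n1 n2.
have := h1 n (leq_maxl _ _); have := h2 n (leq_maxr _ _).
set y := fejop _ _ _ _ => hy hxy.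
have : d <= nrm (LL f (ebas R (p, j)) - y) + nrm (hdot y (ebas R (0, k))).
  rewrite /d -[X in hdot X _](subrK y) hdotDl; apply: le_trans (nrmD _ _) _.
  rewrite lerD2r; apply: le_trans (hdot_le _ _) _.
  by rewrite [nrm (ebas R (0, k))]nrm_ebas mulr1.
lra.
Qed.

(** In the coordinates (0, k) with k < 0 only the analytic entry f of F
    contributes, since the entry above the diagonal is 0, and [disc_lower] applies
    to f. *)
Lemma hardy_invariant F x : algB R F -> hardy (PI F (hardy x)) = PI F (hardy x).
Proof.
move=> hF; have mF := algB_M2CT hF; move: hF => [f [g [h [df dg ch hF]]]].
have cf := disc_cont df.
apply: wop_id => [[p j]|i j]; last by rewrite /ghardy; case: ifP => // _ [].
rewrite /ghardy /=; case: ifP => // /negbT; rewrite negb_or => /andP [p1 j0] /negP nz.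
exfalso; apply: nz; apply/eqP.
have p0 : p = 0 by case: (ord2P p) p1 => -> //; rewrite eqxx.
rewrite (PI_coord _ _ _ mF) p0 sum2.
have -> : ent F 0 0 = f by apply/funext => t; have [] := hF t.
have -> : ent F 0 1 = fun=> 0 by apply/funext => t; have [] := hF t.
rewrite LLcst scale0r addr0.
rewrite -hdot_ebas (laurent_adj shift_lin shiftD shift0 shift_iso _ _ cf).
apply: hdot_disjoint => -[q i].
have [qi|qi] := boolP ((q == 1) || (0 <= i)); last first.
  by left; rewrite wopE /ghardy /= (negbTE qi).
right; rewrite -hdot_ebas (laurent_adj shift_lin shiftD shift0 shift_iso _ _ (cont_conj cf)).
have -> : (fun t => Num.conj (Num.conj (f t))) = f by apply/funext => t; rewrite conjCK.
rewrite hdotC (disc_lower df) ?rmorph0 //; first by rewrite orbC.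
by rewrite ltNge.
Qed.

(** The restriction of the representation to H^2 + L^2, extended by 0 to the
    orthogonal complement.  It is multiplicative on B by [hardy_invariant]. *)
Definition Phi (F : cfun) : G -> G := PI F \o hardy.

Lemma hardy_bop : bounded_operator hardy. Proof. exact: wop_bop. Qed.

(** Complete contractivity is that of the star representation on L^2 + L^2, by
    comparison with [rho] through point evaluations. *)
Lemma Phi_rep (K : hilbertType R) (rho : cfun -> (K -> K)) : faithful_unital_star_rep rho ->
  representation (rho @` algB R) (fun T => Phi (rinv rho T)).
Proof.
move=> hrho; have [bPI [DPI ZPI MPI _] _] := PI_star.
apply: algB_rep => //.
- by move=> F hF; exact: (bop_comp (bPI _ (algB_M2CT hF)) hardy_bop).
- move=> F1 F2 h1 h2; rewrite /Phi (DPI _ _ (algB_M2CT h1) (algB_M2CT h2)).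
  by apply/funext.
- by move=> c F hF; rewrite /Phi (ZPI _ _ (algB_M2CT hF)); apply/funext.
- move=> F1 F2 h1 h2; rewrite /Phi (MPI _ _ (algB_M2CT h1) (algB_M2CT h2)).
  by apply/funext => x; rewrite /comp (hardy_invariant x h2).
move=> n A hA.
have cA : entries_cont A by move=> i j; exact: (algB_M2CT (hA i j)).
have bA := mapp_bop (faithful_star_rep hrho) cA.
have c0 := opnorm_ge0 bA.
apply: opnorm_le => // x.
have -> : app (map_mx Phi A) x = mapp PI A (fun i => hardy (x i)).
  by apply/funext => i; rewrite /mapp /app; apply: eq_bigr => j _; rewrite !mxE.
apply: le_trans (star_rep_le PI_star cA c0
   (star_rep_ge (faithful_star_rep hrho) (faithful_inj hrho) cA) _) _.
rewrite ler_wpM2l // -(ler_pXn2r (_ : (0 < 2)%N)) ?nnegrE ?hnorm_ge0 // !hnorm2.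
apply: ler_sum => i _; rewrite ler_pXn2r ?nnegrE ?nrm_ge0 //.
by have := wop_lip ghardy_inj (x i); rewrite mul1r.
Qed.

End Concrete.

(** * The element of the maximal C-star-algebra *)

Section PartialIsometry.
Variables (R : realType) (H : hilbertType R) (pi : (circle R -> 'M[C R]_2) -> (H -> H)).
Hypothesis hpi : star_rep pi.

(** F is a partial isometry with initial projection e. *)
Lemma star_rep_partial_isometry F e : M2CT R F -> M2CT R e ->
  cadj F * F = e -> cadj e * e = e -> lip 1 (pi F).
Proof.
move=> mF me Fe ee x; rewrite mul1r.
have h1 := star_rep_sq hpi x mF; have h2 := star_rep_sq hpi x me.
rewrite Fe in h1; rewrite ee in h2.
have h3 := hdot_le (pi e x) x.
have h4 : nrm (pi F x) ^+ 2 = nrm (pi e x) ^+ 2.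
  by apply: rc_inj; rewrite -h1 -h2.
have h5 : nrm (pi F x) = nrm (pi e x).
  by apply/eqP; rewrite -(eqrXn2 (_ : (0 < 2)%N)) ?nrm_ge0 //; apply/eqP.
rewrite h5; move: h3; rewrite h2 nrm_rc ?sqr_ge0 // expr2.
have [->|n0] := eqVneq (nrm (pi e x)) 0; first by rewrite nrm_ge0.
by rewrite ler_pM2l // lt_neqAle eq_sym n0 nrm_ge0.
Qed.
End PartialIsometry.

Section Monomials.
Variable R : realType.
Notation cfun := (circle R -> 'M[C R]_2).

(** z^m E_k0. *)
Definition zunit (k : 'I_2) (m : int) : cfun := fun t => zc m t *: delta_mx k 0.

Lemma ent_zunit k m a b :
  ent (zunit k m) a b = if (a == k) && (b == 0) then @zc R m else fun=> 0.
Proof.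
apply/funext => t; rewrite /ent /zunit !mxE.
by case: ifP => _; rewrite ?mulr1 ?mulr0.
Qed.

Lemma M2CT_zunit k m : M2CT R (zunit k m).
Proof.
apply/M2CTP => a b.
have -> : (fun t => zunit k m t a b) = ent (zunit k m) a b by [].
rewrite ent_zunit; case: ifP => _; [exact: cont_zc|exact: cont_cst].
Qed.

Lemma zunit_mul k m j : zunit k m * zunit 0 j = zunit k (m + j).
Proof.
apply/funext => t; rewrite /zunit !fctE -scalerAl -scalerAr scalerA -zcD.
congr (_ *: _); exact: mul_delta_mx.
Qed.

Lemma zunit_sq k m : cadj (zunit k m) * zunit k m = zunit 0 0.
Proof.
apply/funext => t; rewrite /cadj /zunit !fctE.
have -> : (map_mx Num.conj (zc m t *: delta_mx k 0))^T = zc (- m) t *: delta_mx 0 k :> 'M[C R]_2.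
  apply/matrixP => a b; rewrite !mxE rmorphM /= zc_conj rmorph_nat andbC.
  by [].
rewrite -scalerAl -scalerAr scalerA -zcD addNr.
congr (_ *: _); exact: mul_delta_mx.
Qed.

Lemma algB_zunit0 : algB R (zunit 0 1).
Proof.
exists (fun t => val t), (fun=> 0), (fun=> 0); split.
- exact: disc_id.
- exact: disc_cst.
- exact: cont_cst.
move=> t; have e a b : zunit 0 1 t a b = ent (zunit 0 1) a b t by [].
by rewrite !e !ent_zunit /= rmorph0 /zc expr1z.
Qed.

Lemma algB_zunit1 m : algB R (zunit 1 m).
Proof.
exists (fun=> 0), (fun=> 0), (@zc R m); split.
- exact: disc_cst.
- exact: disc_cst.
- exact: cont_zc.
move=> t; have e a b : zunit 1 m t a b = ent (zunit 1 m) a b t by [].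
by rewrite !e !ent_zunit /= rmorph0.
Qed.

Lemma algB_1 : algB R 1.
Proof.
have -> : 1 = (fun=> 1) :> cfun by [].
by apply: algB_const; rewrite mxE.
Qed.

Lemma matrep_zunit k m x : matrep (@shift R) (@munit R) (zunit k m) x = shift m (munit k 0 x).
Proof.
have LLc := LLcst (R := R).
rewrite /matrep (bigD1 k) //= [X in _ + X]big1 ?addr0 => [|a /negbTE ak].
  rewrite sum2 !ent_zunit !eqxx /= LLc scale0r addr0 (laurent_zc (@shift_iso R)).
  by [].
by rewrite big1 // => b _; rewrite ent_zunit ak LLc scale0r.
Qed.

(** The range of the unilateral shift is orthogonal to the constant function 1. *)
Lemma Phi_shift_coord y : l2f (Phi (zunit 0 1) y) (0, 0) = 0.
Proof.
have -> : Phi (zunit 0 1) y = shift 1 (munit 0 0 (hardy y)) by exact: matrep_zunit.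
have u0 : gshift 1 ((0, 0) : 'I_2 * int) = Some (0, -1) by [].
have e0 : gunit 0 0 ((0, -1) : 'I_2 * int) = Some (0, -1) by [].
have p0 : ghardy ((0, -1) : 'I_2 * int) = None by [].
by rewrite (wop_some _ _ u0) (wop_some _ _ e0) (wop_none _ _ p0).
Qed.

Lemma Phi_corner : Phi (zunit 1 0) (ebas R ((0, 0) : 'I_2 * int)) = ebas R ((1, 0) : 'I_2 * int).
Proof.
have -> : Phi (zunit 1 0) (ebas R ((0, 0) : 'I_2 * int)) = shift 0 (munit 1 0 (hardy (ebas R ((0, 0) : 'I_2 * int)))).
  exact: matrep_zunit.
have p0 : ghardy ((0, 0) : 'I_2 * int) = Some (0, 0) by [].
have e0 : gunit 1 0 ((1, 0) : 'I_2 * int) = Some (0, 0) by [].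
by rewrite shift0 /hardy (wop_ebas R ghardy_inj p0) /munit (wop_ebas R (@gunit_inj 1 0) e0).
Qed.

End Monomials.
Arguments M2CT_zunit : clear implicits.

Section Main.
Variables (R : realType) (K : hilbertType R) (rho : (circle R -> 'M[C R]_2) -> (K -> K)).
Hypothesis hrho : faithful_unital_star_rep rho.
Variables (L : hilbertType R) (D : set (L -> L)) (iota : (K -> K) -> (L -> L)).
Hypotheses (hom_i : algebra_hom (rho @` algB R) iota) (i1 : iota idfun = idfun)
  (iso_i : completely_isometric (rho @` algB R) iota)
  (cD : cstar_algebra D) (iD : forall F, algB R F -> D (iota (rho F))).

Let A := iota (rho (@zunit R 0 1)).
Let B := iota (rho (@zunit R 1 0)).
Let Y n := iota (rho (zunit 1 (- n%:Z))).

Lemma iota_lip F : algB R F -> cadj F * F = @zunit R 0 0 -> lip 1 (iota (rho F)).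
Proof.
move=> hF FF.
have m0 := M2CT_zunit R 0 0.
have h := star_rep_partial_isometry (faithful_star_rep hrho) (algB_M2CT hF) m0 FF (zunit_sq R 0 0).
have hA : (rho @` algB R) (rho F) by exists F.
have [bi _ _ _] := hom_i.
move=> x; apply: le_trans (opnorm1_ge (bi _ hA) x) _; rewrite ler_wpM2r ?nrm_ge0 //.
rewrite -(map_const_mx iota) iso_i => [|i j]; last by rewrite mxE.
exact: opnorm1_le.
Qed.

Lemma Y_step k : Y k.+1 \o A = Y k.
Proof.
have [_ _ _ iM] := hom_i; have [_ [_ _ rM _] _] := faithful_star_rep hrho.
have hY : (rho @` algB R) (rho (zunit 1 (- k.+1%:Z))).
  by exists (zunit 1 (- k.+1%:Z)) => //; exact: algB_zunit1.
have hA : (rho @` algB R) (rho (zunit 0 1)).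
  by exists (zunit 0 1) => //; exact: algB_zunit0.
rewrite /Y /A -(iM _ _ hY hA) -(rM _ _ (M2CT_zunit R 1 _) (M2CT_zunit R 0 1)).
by rewrite zunit_mul; congr (iota (rho (zunit 1 _))); lia.
Qed.

Lemma D_id : D idfun.
Proof.
have [_ [_ _ _ r1] _] := faithful_star_rep hrho.
by rewrite -i1 -r1; apply: iD; exact: algB_1.
Qed.

(** The element w = B (1 - A V), with A, B, V the images of z E_00, E_10 and the
    adjoint of A.  Every finite-dimensional representation kills it by
    [findim_defect], so its norm is 0 if D is residually finite dimensional. *)
Lemma witness_vanishes V x : D V -> is_adjoint A V -> RFD D ->
  (B \o (idfun + (-1) *: (A \o V))) x = 0.
Proof.
move=> DV aV rfd.
have [[bD [D0 DD DZ DM] _] _] := cD.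
have DA : D A := iD (algB_zunit0 R).
have DB : D B := iD (algB_zunit1 R 0).
have DY n : D (Y n) := iD (algB_zunit1 R (- n%:Z)).
have lA : lip 1 A by apply: iota_lip; [exact: algB_zunit0|exact: zunit_sq].
have lY n : lip 1 (Y n) by apply: iota_lip; [exact: algB_zunit1|exact: zunit_sq].
have lV : lip 1 V.
  move=> y; rewrite mul1r; have [->|n0] := eqVneq (nrm (V y)) 0; first exact: nrm_ge0.
  have np : 0 < nrm (V y) by rewrite lt_neqAle eq_sym n0 nrm_ge0.
  rewrite -(ler_pM2l np) -expr2.
  have <- : nrm (hdot (V y) (V y)) = nrm (V y) ^+ 2 by rewrite hdotxx nrm_rc ?sqr_ge0.
  rewrite -aV; apply: le_trans (hdot_le _ _) _; rewrite ler_wpM2r ?nrm_ge0 //.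
  by have := lA (V y); rewrite mul1r.
set w := _ \o _.
have DAV : D (A \o V) by exact: DM.
have DZAV : D ((-1) *: (A \o V)) by exact: DZ.
have DI := D_id.
have DS : D (idfun + (-1) *: (A \o V)) by exact: DD.
have Dw : D w by exact: DM.
have kill (H : hilbertType R) (phi : (L -> L) -> (H -> H)) :
    finite_dimensional H -> representation D phi -> forall y, phi w y = 0.
  move=> fH rphi y; have [[bp pD pZ pM] _] := rphi.
  have -> : phi w y = phi B (y - phi A (phi V y)).
    have lB := bop_lin (bp _ DB).
    rewrite /w pM // pD // pZ // pM //= !fctE.
    rewrite (linD lB) (linZ lB) scaleN1r (linB lB); congr (_ - _).
    by rewrite -[LHS]/((phi B \o phi idfun) y) -pM.
  have one M T : D T -> lip M T -> 0 <= M -> lip M (phi T).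
    by move=> DT hT M0; exact: (rep_contr rphi DT M0 hT).
  apply: (findim_defect (T := phi A) (T' := phi V) (Y := fun n => phi (Y n)) fH).
  - exact: (contractive_star cD DI rphi DA DV aV).
  - exact: (bop_lin (bp _ DA)).
  - exact: one.
  - exact: one.
  - by move=> n; exact: one.
  elim=> [z|n ih z]; first by have -> : B = Y 0 by rewrite /B /Y oppr0.
  by rewrite ih -(Y_step n) pM.
have rw : opnorm (const_mx w : 'M[L -> L]_1) <= 0.
  rewrite rfd => [|i j]; last by rewrite mxE.
  set S := [set r | _].
  have hS r : S r -> r <= 0.
    move=> [H [phi [fH rphi ->]]]; rewrite map_const_mx.
    by apply: opnorm1_le => // y; rewrite (kill _ _ fH rphi) nrm0 mul0r.
  (* The supremum of the empty set is 0. *)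
  have [S0|S0] := pselect (S = set0); first by rewrite S0 sup0.
  by apply: ge_sup => //; apply/set0P/eqP.
have := opnorm1_ge (bD _ Dw) x => hx.
apply: nrm_eq0; apply/eqP; rewrite eq_le nrm_ge0 andbT.
by apply: le_trans hx _; rewrite mulr_le0_ge0 ?nrm_ge0.
Qed.

End Main.

Section Final.
Variables (R : realType) (K : hilbertType R) (rho : (circle R -> 'M[C R]_2) -> (K -> K)).
Hypothesis hrho : faithful_unital_star_rep rho.

(** Extend the representation on H^2 + L^2 to D and apply it to w: at the constant
    function 1 of H^2 the term with the adjoint of the shift vanishes, and what
    remains is E_10 applied to it, which is not 0. *)
Theorem Cstar_max_not_RFD (L : hilbertType R) (D : set (L -> L)) :
  is_Cstar_max (rho @` algB R) D -> ~ RFD D.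
Proof.
move=> [iota [hom_i i1 iso_i [cD sD _] univ]] rfd.
have iD F : algB R F -> D (iota (rho F)).
  by move=> hF; apply: sD; exists (rho F) => //; exists F.
have [sigma [[[bs sDD sZ sM] sstar] sE]] := univ _ _ (Phi_rep hrho).
have hA := iD _ (algB_zunit0 R); have hB := iD _ (algB_zunit1 R 0).
have sigmaE F : algB R F -> sigma (iota (rho F)) = Phi F.
  by move=> hF; rewrite sE ?(rinvK hrho) //; exists F.
have [V DV aV] := cD.2 _ hA.
have wz x := witness_vanishes hrho hom_i i1 iso_i cD iD x DV aV rfd.
set A := iota _ in hA aV wz; set B := iota _ in hB wz.
have [[bD [D0 DD DZ DM] _] _] := cD.
have DI := D_id hrho i1 iD.
have DAV : D (A \o V) by exact: DM.
have DZAV : D ((-1) *: (A \o V)) by exact: DZ.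
have DS : D (idfun + (-1) *: (A \o V)) by exact: DD.
pose e0 : L2H R ('I_2 * int)%type := ebas R ((0, 0) : 'I_2 * int).
have Ve : sigma V e0 = 0.
  apply: nrm_eq0; apply/eqP; rewrite -[_ == 0](expf_eq0 _ 2).
  have h : hdot (sigma A (sigma V e0)) e0 = hdot (sigma V e0) (sigma V e0).
    exact: (sstar _ _ hA DV aV).
  apply/eqP/rc_inj; rewrite -hdotxx -h.
  by rewrite (sigmaE _ (algB_zunit0 R)) [hdot _ _]hdot_ebas Phi_shift_coord.
have w0 : (B \o (idfun + (-1) *: (A \o V))) = 0 *: idfun.
  by apply/funext => x; rewrite wz scale0r.
have lA := bop_lin (bs _ hA); have lB := bop_lin (bs _ hB).
have : sigma B (sigma idfun e0 + (-1) *: sigma A (sigma V e0)) = 0 *: sigma idfun e0.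
  transitivity (sigma (B \o (idfun + (-1) *: (A \o V))) e0).
    by rewrite (sM _ _ hB DS) (sDD _ _ DI DZAV) (sZ _ _ DAV) (sM _ _ hA DV).
  by rewrite w0 (sZ _ _ DI).
rewrite Ve (lin0 lA) scaler0 addr0 scale0r -[LHS]/((sigma B \o sigma idfun) e0).
rewrite -(sM _ _ hB DI) -[B \o idfun]/B (sigmaE _ (algB_zunit1 R 0)) Phi_corner => E1.
have : nrm (ebas R ((1, 0) : 'I_2 * int)) = 0 by rewrite E1 nrm0.
by rewrite nrm_ebas => /eqP; rewrite oner_eq0.
Qed.
End Final.

Theorem corollary1p4 (R : realType) (K : hilbertType R)
    (rho : (circle R -> 'M[C R]_2) -> (K -> K))
    (rho_rep : faithful_unital_star_rep rho) :
  RFD (rho @` algB R) /\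
  forall (L : hilbertType R) (D : set (L -> L)),
    is_Cstar_max (rho @` algB R) D -> ~ RFD D.
Proof. by split; [exact: algB_RFD|move=> L D; exact: Cstar_max_not_RFD]. Qed.
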